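(* Let $1<p<\infty$, let $\omega\in\widehat{\mathcal{D}}$ be a radial weight, and let $\nu$ be a radial weight. Then $P_\omega:L^p_\nu\to L^p_\nu$ is bounded if and only if $(A^{p'}_\sigma)^\star\simeq A^p_\nu$ via the $A^2_\omega$-pairing with equivalence of norms, that is: every $g\in A^p_\nu$ induces a bounded linear functional $T_g(f)=\langle f,g\rangle_{A^2_\omega}=\int_{\mathbb{D}}f\overline{g}\,\omega\,dA$ on $A^{p'}_\sigma$, every bounded linear functional on $A^{p'}_\sigma$ is of the form $T_g$ for a unique $g\in A^p_\nu$, and $\|T_g\|\asymp\|g\|_{A^p_\nu}$ with constants independent of $g$.
   Context: $\mathbb{D}$ is the unit disc of $\mathbb{C}$ and $dA(z)=\frac{dx\,dy}{\pi}$. A radial weight is a nonnegative $\omega\in L^1([0,1))$, extended to $\mathbb{D}$ by $\omega(z)=\omega(|z|)$; it is always assumed that $\widehat{\omega}(r)=\int_r^1\omega(s)\,ds>0$ for all $0\le r<1$. For a nonnegative measurable $\eta$ on $[0,1)$ (extended radially) and $0<p<\infty$, $L^p_\eta$ is the space of measurable $f$ on $\mathbb{D}$ with $\|f\|_{L^p_\eta}^p=\int_{\mathbb{D}}|f|^p\eta\,dA<\infty$, and $A^p_\eta$ is the subspace of analytic functions in $\mathbb{D}$. The class $\widehat{\mathcal{D}}$ consists of radial weights with $\sup_{0\le r<1}\widehat{\omega}(r)/\widehat{\omega}(\frac{1+r}{2})<\infty$. Write $\omega_x=\int_0^1 r^x\omega(r)\,dr$. The Bergman projection is $P_\omega(f)(z)=\int_{\mathbb{D}}f(\zeta)\overline{B^\omega_z(\zeta)}\omega(\zeta)\,dA(\zeta)$,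 where $B^\omega_z(\zeta)=\sum_{n=0}^\infty\frac{(\overline{z}\zeta)^n}{2\omega_{2n+1}}$ is the reproducing kernel of $A^2_\omega$. For $1<p<\infty$, $p'=\frac{p}{p-1}$ and $\sigma(r)=\left(\frac{\omega(r)}{\nu(r)^{1/p}}\right)^{p'}$. *)

(* Defs.v *)
From HB Require Import structures.
From mathcomp Require Import all_boot all_order all_algebra.
From mathcomp Require Import all_classical all_reals all_analysis.
From mathcomp Require Import complex.
Set Implicit Arguments.
Unset Strict Implicit.
Unset Printing Implicit Defensive.
Import Order.TTheory GRing.Theory Num.Theory.
Import numFieldNormedType.Exports.
Local Open Scope classical_set_scope.
Local Open Scope ring_scope.
Local Open Scope complex_scope.

Section Bergman.
Variable R : realType.

Definition leb2 := (@lebesgue_measure R \x @lebesgue_measure R)%E.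

Definition cabs (z : R[i]) : R :=
  Num.sqrt (complex.Re z ^+ 2 + complex.Im z ^+ 2).

Definition cplx (q : R * R) : R[i] := Complex q.1 q.2.

Definition cdisc : set R[i] := [set z | cabs z < 1].
Definition disc : set (R * R) := [set q | cabs (cplx q) < 1].

(* radial extension: omega(z) = omega(|z|) *)
Definition rad (q : R * R) : R := cabs (cplx q).

(* integral over the disc against dA = dx dy / pi (nonnegative, extended) *)
Definition dAint (F : R * R -> \bar R) : \bar R :=
  ((pi : R)^-1)%:E * (\int[leb2]_(q in disc) F q)%E.

Definition cint (F : R * R -> R[i]) : R[i] :=
  Complex ((pi : R)^-1 * Rintegral leb2 disc (fun q => complex.Re (F q)))
          ((pi : R)^-1 * Rintegral leb2 disc (fun q => complex.Im (F q))).

Definition cintegrable (F : R * R -> R[i]) : Prop :=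
  leb2.-integrable disc (fun q => (complex.Re (F q))%:E) /\
  leb2.-integrable disc (fun q => (complex.Im (F q))%:E).

Definition cmeasurable (f : R[i] -> R[i]) : Prop :=
  measurable_fun disc (fun q => complex.Re (f (cplx q))) /\
  measurable_fun disc (fun q => complex.Im (f (cplx q))).

(* analytic (= complex differentiable) at every point of the disc *)
Definition analytic_in_disc (f : R[i] -> R[i]) : Prop :=
  forall z : R[i], cdisc z -> derivable (f : R[i]^o -> R[i]^o) z 1.

Definition Lp_pow (p : R) (eta : R -> \bar R) (f : R[i] -> R[i]) : \bar R :=
  dAint (fun q => ((cabs (f (cplx q))) `^ p)%:E * eta (rad q))%E.

Definition Lp (p : R) (eta : R -> \bar R) : set (R[i] -> R[i]) :=
  [set f | cmeasurable f /\ (Lp_pow p eta f < +oo)%E].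

Definition Lpnorm (p : R) (eta : R -> \bar R) (f : R[i] -> R[i]) : R :=
  (fine (Lp_pow p eta f)) `^ p^-1.

Definition Ap (p : R) (eta : R -> \bar R) : set (R[i] -> R[i]) :=
  [set f | Lp p eta f /\ analytic_in_disc f].

Definition omegahat (w : R -> R) (r : R) : \bar R :=
  (\int[@lebesgue_measure R]_(s in `[r, 1%R[) (w s)%:E)%E.

Definition radial_weight (w : R -> R) : Prop :=
  (forall r, 0 <= r < 1 -> 0 <= w r) /\
  (@lebesgue_measure R).-integrable `[0%R, 1%R[ (fun s => (w s)%:E) /\
  (forall r, 0 <= r < 1 -> (0 < omegahat w r)%E).

Definition Dhat (w : R -> R) : Prop :=
  exists C : R, forall r, 0 <= r < 1 ->
    (omegahat w r <= C%:E * omegahat w ((1 + r) / 2))%E.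

Definition moment (w : R -> R) (x : nat) : R :=
  fine (\int[@lebesgue_measure R]_(s in `[0%R, 1%R[) (s ^+ x * w s)%:E)%E.

Definition bergman_kernel (w : R -> R) (z zeta : R[i]) : R[i] :=
  limn ([series (((conjc z * zeta) ^+ n / (2 * moment w (2 * n + 1))%:C)
                 : R[i]^o)]_n).

Definition Pint (w : R -> R) (f : R[i] -> R[i]) (z : R[i]) (q : R * R) : R[i] :=
  f (cplx q) * conjc (bergman_kernel w z (cplx q)) * (w (rad q))%:C.

Definition Pw (w : R -> R) (f : R[i] -> R[i]) (z : R[i]) : R[i] :=
  cint (Pint w f z).

Definition Pw_bounded (p : R) (w nu : R -> R) : Prop :=
  exists C : R, forall f, Lp p (fun r => (nu r)%:E) f ->
    (forall z, cdisc z -> cintegrable (Pint w f z)) /\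
    Lp p (fun r => (nu r)%:E) (Pw w f) /\
    Lpnorm p (fun r => (nu r)%:E) (Pw w f)
      <= C * Lpnorm p (fun r => (nu r)%:E) f.

Definition conj_exp (p : R) : R := p / (p - 1).

(* sigma = (omega / nu^(1/p))^(p'), with omega/0 = +oo for omega > 0 and
   0/0 = 0 *)
Definition sigma (p : R) (w nu : R -> R) (r : R) : \bar R :=
  if nu r == 0 then (if w r == 0 then 0%E else +oo%E)
  else ((w r / (nu r) `^ p^-1) `^ conj_exp p)%:E.

Definition pair_int (w : R -> R) (g f : R[i] -> R[i]) (q : R * R) : R[i] :=
  f (cplx q) * conjc (g (cplx q)) * (w (rad q))%:C.

Definition Tg (w : R -> R) (g : R[i] -> R[i]) (f : R[i] -> R[i]) : R[i] :=
  cint (pair_int w g f).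

Definition linear_on (A : set (R[i] -> R[i])) (L : (R[i] -> R[i]) -> R[i]) :=
  forall (f g : R[i] -> R[i]) (a : R[i]), A f -> A g ->
    L (fun z => f z + a * g z) = L f + a * L g.

Definition bounded_on (A : set (R[i] -> R[i])) (nrm : (R[i] -> R[i]) -> R)
    (L : (R[i] -> R[i]) -> R[i]) :=
  exists C : R, forall f, A f -> cabs (L f) <= C * nrm f.

Definition opnorm (A : set (R[i] -> R[i])) (nrm : (R[i] -> R[i]) -> R)
    (L : (R[i] -> R[i]) -> R[i]) : \bar R :=
  ereal_sup [set (cabs (L f))%:E | f in [set f | A f /\ nrm f <= 1]].

End Bergman.

(* Main.v *)
(* Fejer means of a power series are limits of convex combinations of its
   rotations, so they are contractive on every weighted space with a radial
   weight and converge there along a subsequence. Consequently, for f with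
   f w integrable, P_w f is the power series with coefficients
   <f, z^n> / (2 w_(2n+1)), and P_w reproduces analytic functions.

   If P_w is bounded on L^p_nu, testing it on min(sigma, n) / w and reading
   the constant coefficient shows that sigma is integrable. Given a bounded
   functional L on A^p'_sigma, the candidate g has coefficients
   conj(L(z^n)) / (2 w_(2n+1)). With S_N the Fejer means, G = S_N g and
   phi = G |G|^(p-2) nu / w,
     int |G|^p nu = <phi, G> = L(S_N P_w phi) <= |L| |S_N P_w phi|_sigma,
   and S_N P_w is bounded on L^p'_sigma because it is symmetric for the
   pairing and bounded on L^p_nu. Applying P_w to G 1_(w <> 0) takes care of
   the zeros of w; Fatou's lemma gives the bound on g, and density of
   polynomials gives L = T_g.

   Conversely, the lower bound on |T_1| yields f in A^p'_sigma with
   f(0) <> 0, so sigma is integrable by the mean value property; for f in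
   L^p_nu the functional <., f> equals some T_g, and comparing coefficients
   P_w f = g. *)
Require Import Defs.
From HB Require Import structures.
From mathcomp Require Import all_boot all_order all_algebra.
From mathcomp Require Import all_classical all_reals all_analysis.
From mathcomp Require Import measurable_realfun complex ring lra.
From mathcomp Require Import separable cyclic cyclotomic.
(* Imported again because MathComp-Analysis also defines [disc] and [rad]. *)
Require Import Defs.
Import Order.TTheory GRing.Theory Num.Theory.
Import numFieldNormedType.Exports.
Local Open Scope classical_set_scope.
Local Open Scope ring_scope.
Set Implicit Arguments.
Unset Strict Implicit.
Unset Printing Implicit Defensive.

(** * Complex numbers, series and power series *)

(** L is given only on analytic functions. No extension to L^p'_sigma and no Riesz representation is
    used: monomials force the coefficients of g, and what remains is a bound on its norm. That bound
    comes from an inequality B <= X B^t with t < 1, so B must be finite beforehand; Fejer means,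
    being polynomials, guarantee this. They also turn exchanges of sum and integral into finite
    identities, and they cost no constant, since rotations preserve radial weights and x^p is
    convex.

    Two degeneracies shape the argument. Where nu = 0 < w, sigma is [+oo]; where w = 0 < nu, the
    pairing does not see nu, so testing reaches only the part of nu carried by the set where w is
    nonzero.

    Integrability of sigma is the hinge in both directions: it puts monomials into A^p'_sigma and
    L^p_nu inside L^1_w, which makes P_w f a convergent power series for every f in L^p_nu.
    Analyticity means complex differentiability, so Taylor expansion has to be established. Factors
    2 come from estimating real and imaginary parts separately, factors [kap] from leaving the area
    of the disc uncomputed. *)

Section ComplexModulus.
Variable R : realType.
Implicit Types (x y z : R[i]) (u v : nat -> R[i]).

Lemma cabsE z : cabs z = Normc.normc z.
Proof. by case: z. Qed.

Lemma normcC z : `|z| = ((cabs z)%:C)%C.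
Proof. by rewrite normc_def. Qed.

Lemma cabs_ge0 z : 0 <= cabs z.
Proof. exact: sqrtr_ge0. Qed.

Lemma cabs0 : cabs (0 : R[i]) = 0.
Proof. by rewrite cabsE Normc.normc0. Qed.

Lemma cabs1 : cabs (1 : R[i]) = 1.
Proof. by rewrite cabsE Normc.normc1. Qed.

Lemma cabsM x y : cabs (x * y) = cabs x * cabs y.
Proof. by rewrite !cabsE Normc.normcM. Qed.

Lemma cabsV x : cabs x^-1 = (cabs x)^-1.
Proof. by rewrite !cabsE Normc.normcV. Qed.

Lemma cabsX x n : cabs (x ^+ n) = cabs x ^+ n.
Proof. by elim: n => [|n ih]; rewrite ?expr0 ?cabs1// !exprS cabsM ih. Qed.

Lemma cabsN x : cabs (- x) = cabs x.
Proof. by rewrite !cabsE (normcN (x : Rcomplex R)). Qed.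

Lemma cabsD x y : cabs (x + y) <= cabs x + cabs y.
Proof. by rewrite !cabsE; exact: (le_normcD (x : Rcomplex R)). Qed.

Lemma cabsB x y : cabs (x - y) = cabs (y - x).
Proof. by rewrite -cabsN opprB. Qed.

Lemma cabs_le_sub x y : cabs x - cabs y <= cabs (x - y).
Proof. by rewrite lerBlDr -{1}(subrK y x) cabsD. Qed.

Lemma cabs_eq0 x : (cabs x == 0) = (x == 0).
Proof.
apply/eqP/eqP => [|->]; last exact: cabs0.
by rewrite cabsE; exact: Normc.eq0_normc.
Qed.

Lemma cabs_gt0 x : (0 < cabs x) = (x != 0).
Proof. by rewrite lt_neqAle cabs_ge0 andbT eq_sym cabs_eq0. Qed.

Lemma cabs_conj x : cabs (conjc x) = cabs x.
Proof. by case: x => a b; rewrite /cabs /= sqrrN. Qed.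

Lemma cabs_real (r : R) : cabs (r%:C)%C = `|r|.
Proof. by rewrite /cabs /= expr0n addr0 sqrtr_sqr. Qed.

Lemma cabs_sum (I : Type) (s : seq I) (P : pred I) (F : I -> R[i]) :
  cabs (\sum_(i <- s | P i) F i) <= \sum_(i <- s | P i) cabs (F i).
Proof.
elim/big_ind2 : _ => [|x1 x2 y1 y2 h1 h2|//]; first by rewrite cabs0.
by rewrite (le_trans (cabsD _ _))// lerD.
Qed.

Lemma Re_le_cabs z : `|complex.Re z| <= cabs z.
Proof. by rewrite -sqrtr_sqr /cabs ler_sqrt ?lerDl ?addr_ge0 ?sqr_ge0. Qed.

Lemma Im_le_cabs z : `|complex.Im z| <= cabs z.
Proof. by rewrite -sqrtr_sqr /cabs ler_sqrt ?lerDr ?addr_ge0 ?sqr_ge0. Qed.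

Lemma cabs_sqr z : cabs z ^+ 2 = complex.Re z ^+ 2 + complex.Im z ^+ 2.
Proof. by rewrite sqr_sqrtr// addr_ge0 ?sqr_ge0. Qed.

Lemma cabs_le_ReIm z : cabs z <= `|complex.Re z| + `|complex.Im z|.
Proof.
rewrite -(@ler_pXn2r _ 2)// ?nnegrE ?cabs_ge0 ?addr_ge0// cabs_sqr sqrrD !real_normK ?num_real//.
by rewrite addrAC lerDl mulrn_wge0// mulr_ge0.
Qed.

Lemma mul_conjc z : z * conjc z = ((cabs z ^+ 2)%:C)%C.
Proof. by rewrite cabs_sqr; case: z => a b /=; congr Complex; ring. Qed.

Lemma ReD x y : complex.Re (x + y) = complex.Re x + complex.Re y.
Proof. by case: x y => [? ?] []. Qed.
Lemma ImD x y : complex.Im (x + y) = complex.Im x + complex.Im y.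
Proof. by case: x y => [? ?] []. Qed.
Lemma ReN x : complex.Re (- x) = - complex.Re x.
Proof. by case: x. Qed.
Lemma ImN x : complex.Im (- x) = - complex.Im x.
Proof. by case: x. Qed.
Lemma ReM x y : complex.Re (x * y) =
  complex.Re x * complex.Re y - complex.Im x * complex.Im y.
Proof. by case: x y => [? ?] []. Qed.
Lemma ImM x y : complex.Im (x * y) =
  complex.Re x * complex.Im y + complex.Im x * complex.Re y.
Proof. by case: x y => [? ?] []. Qed.
Lemma Re_sum (I : Type) (s : seq I) (P : pred I) (F : I -> R[i]) :
  complex.Re (\sum_(i <- s | P i) F i) = \sum_(i <- s | P i) complex.Re (F i).
Proof. by elim/big_rec2 : _ => //= i y1 y2 _ <-; rewrite ReD. Qed.
Lemma Im_sum (I : Type) (s : seq I) (P : pred I) (F : I -> R[i]) :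
  complex.Im (\sum_(i <- s | P i) F i) = \sum_(i <- s | P i) complex.Im (F i).
Proof. by elim/big_rec2 : _ => //= i y1 y2 _ <-; rewrite ImD. Qed.

Lemma complex_ext x y :
  complex.Re x = complex.Re y -> complex.Im x = complex.Im y -> x = y.
Proof. by case: x y => [? ?] [? ?] /= -> ->. Qed.

(** Stated by components so that limit theorems for real sequences and real integrals apply to each
    part; [ccvgP] is the form with moduli. *)
Definition ccvg u (l : R[i]) :=
  ((fun n => complex.Re (u n)) @ \oo --> complex.Re l) /\
  ((fun n => complex.Im (u n)) @ \oo --> complex.Im l).

Lemma ccvgP u l : ccvg u l <-> ((fun n => cabs (u n - l)) @ \oo --> (0 : R)).
Proof.
split=> [[hr hi]|h].
- have h : (fun n => `|complex.Re (u n) - complex.Re l| +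
    `|complex.Im (u n) - complex.Im l|) @ \oo --> (0 : R).
    rewrite [X in _ --> X](_ : _ = `|complex.Re l - complex.Re l| +
      `|complex.Im l - complex.Im l|); last by rewrite !subrr normr0 addr0.
    by apply: cvgD; apply: cvg_norm; apply: cvgB => //; exact: cvg_cst.
  apply: (@squeeze_cvgr _ _ _ _ (fun=> 0) _ _ _ _ _ h); last exact: cvg_cst.
  apply: nearW => n; rewrite cabs_ge0/= (le_trans (cabs_le_ReIm _))//.
  by rewrite ReD ImD ReN ImN.
- split; apply/cvgrPdist_le => e e0.
  + move/cvgrPdist_le : h => /(_ e e0); apply: filterS => n.
    rewrite sub0r normrN (ger0_norm (cabs_ge0 _)); apply: le_trans.
    by rewrite distrC -ReN -ReD Re_le_cabs.
  + move/cvgrPdist_le : h => /(_ e e0); apply: filterS => n.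
    rewrite sub0r normrN (ger0_norm (cabs_ge0 _)); apply: le_trans.
    by rewrite distrC -ImN -ImD Im_le_cabs.
Qed.

Lemma ccvg_unique u l l' : ccvg u l -> ccvg u l' -> l = l'.
Proof.
move=> [h1 h2] [h3 h4]; apply: complex_ext.
- exact: (cvg_unique _ h1 h3).
- exact: (cvg_unique _ h2 h4).
Qed.

Lemma ccvg_cst l : ccvg (fun=> l) l.
Proof. by split; exact: cvg_cst. Qed.

Lemma ccvgD u v l m : ccvg u l -> ccvg v m -> ccvg (fun n => u n + v n) (l + m).
Proof.
move=> [h1 h2] [h3 h4]; split.
- by under eq_fun do rewrite ReD; rewrite ReD; exact: cvgD.
- by under eq_fun do rewrite ImD; rewrite ImD; exact: cvgD.
Qed.

Lemma ccvgM u v l m : ccvg u l -> ccvg v m -> ccvg (fun n => u n * v n) (l * m).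
Proof.
move=> [h1 h2] [h3 h4]; split.
- by under eq_fun do rewrite ReM; rewrite ReM; apply: cvgB; exact: cvgM.
- by under eq_fun do rewrite ImM; rewrite ImM; apply: cvgD; exact: cvgM.
Qed.

Lemma ccvg_conj u l : ccvg u l -> ccvg (fun n => conjc (u n)) (conjc l).
Proof.
move=> [h1 h2]; split.
- case: l h1 h2 => a b /= h1 h2.
  by rewrite (_ : (fun n => _) = (fun n => complex.Re (u n)))//; apply/funext => n; case: (u n).
- case: l h1 h2 => a b /= h1 h2.
  rewrite (_ : (fun n => _) = (fun n => - complex.Im (u n))); last by apply/funext => n; case: (u n).
  exact: cvgN.
Qed.

Lemma ccvg_sum (I : Type) (s : seq I) (P : pred I) (F : I -> nat -> R[i]) (l : I -> R[i]) :
  (forall i, ccvg (F i) (l i)) ->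
  ccvg (fun n => \sum_(i <- s | P i) F i n) (\sum_(i <- s | P i) l i).
Proof.
move=> h; elim: s => [|i s ih].
  by rewrite big_nil; under eq_fun do rewrite big_nil; exact: ccvg_cst.
rewrite big_cons; under eq_fun do rewrite big_cons.
by case: ifP => // _; exact: ccvgD.
Qed.

Lemma ccvg_cabs u l : ccvg u l -> (fun n => cabs (u n)) @ \oo --> cabs l.
Proof.
move=> /ccvgP h; apply/cvgrPdist_le => e e0.
move/cvgrPdist_le : h => /(_ e e0); apply: filterS => n.
rewrite sub0r normrN (ger0_norm (cabs_ge0 _)); apply: le_trans.
by rewrite ler_norml lerNl opprB cabs_le_sub cabsB cabs_le_sub.
Qed.

Lemma ccvg_shift u l k : ccvg u l -> ccvg (fun n => u (n + k)%N) l.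
Proof. by move=> [h1 h2]; split; [rewrite (cvg_shiftn k (fun n => complex.Re (u n)))|rewrite (cvg_shiftn k (fun n => complex.Im (u n)))]. Qed.

End ComplexModulus.

Section ComplexSeries.
Variable R : realType.
Implicit Types (a b : nat -> R[i]) (z : R[i]).

Definition csums a (n : nat) : R[i] := \sum_(0 <= k < n) a k.
Definition cser a : R[i] :=
  Complex (limn (series (fun k => complex.Re (a k)))) (limn (series (fun k => complex.Im (a k)))).
Definition cabs_summable a := cvgn (series (fun n => cabs (a n))).

Lemma csums_cvg a : cabs_summable a -> ccvg (csums a) (cser a).
Proof.
move=> h; split.
- rewrite (_ : (fun n => _) = series (fun k => complex.Re (a k))); last first.
    by apply/funext => n; rewrite /csums Re_sum.
  by apply: normed_cvg; apply: (series_le_cvg _ _ _ h) => n /=; rewrite ?cabs_ge0 ?Re_le_cabs.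
- rewrite (_ : (fun n => _) = series (fun k => complex.Im (a k))); last first.
    by apply/funext => n; rewrite /csums Im_sum.
  by apply: normed_cvg; apply: (series_le_cvg _ _ _ h) => n /=; rewrite ?cabs_ge0 ?Im_le_cabs.
Qed.

Lemma cser_tail a N : cabs_summable a ->
  cabs (cser a - csums a N) <=
    limn (series (fun n => cabs (a n))) - series (fun n => cabs (a n)) N.
Proof.
move=> h; have /ccvg_cabs c1 := ccvgD (csums_cvg h) (ccvg_cst (- csums a N)).
have c2 : series (fun n => cabs (a n)) n - series (fun n => cabs (a n)) N
    @[n --> \oo] --> limn (series (fun n => cabs (a n))) - series (fun n => cabs (a n)) N.
  by apply: cvgB => //; exact: cvg_cst.
apply: (ler_cvg_to c1 c2); exists N => // n /= Nn.
rewrite /csums /series /= (@big_cat_nat _ _ _ N 0 n)//= addrAC subrr add0r.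
by rewrite [X in _ <= X - _](@big_cat_nat _ _ _ N 0 n)//= addrAC subrr add0r cabs_sum.
Qed.

Lemma cabs_cser_le a : cabs_summable a ->
  cabs (cser a) <= limn (series (fun n => cabs (a n))).
Proof.
move=> h; have := cser_tail 0 h.
by rewrite /csums /series /= !big_geq// !subr0.
Qed.

Lemma cser_unique a l : cabs_summable a -> ccvg (csums a) l -> cser a = l.
Proof. by move=> h; apply: ccvg_unique; exact: csums_cvg. Qed.

Lemma cabs_summable_le a (M : nat -> R) : (forall n, cabs (a n) <= M n) ->
  cvgn (series M) -> cabs_summable a.
Proof.
move=> h; apply: series_le_cvg => // n; first exact: cabs_ge0.
exact: le_trans (cabs_ge0 _) (h n).
Qed.

Lemma cser_le a (M : nat -> R) : (forall n, cabs (a n) <= M n) ->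
  cvgn (series M) -> cabs (cser a) <= limn (series M).
Proof.
move=> h c; have s := cabs_summable_le h c.
by rewrite (le_trans (cabs_cser_le s))// lim_series_le.
Qed.

Lemma cabs_summableD a b : cabs_summable a -> cabs_summable b ->
  cabs_summable (fun n => a n + b n).
Proof.
move=> h1 h2; apply: (@cabs_summable_le _ (fun n => cabs (a n) + cabs (b n))).
  by move=> n; exact: cabsD.
have := is_cvg_seriesD h1 h2.
by [].
Qed.

Lemma cabs_summableZ a c : cabs_summable a -> cabs_summable (fun n => c * a n).
Proof.
move=> h; rewrite /cabs_summable.
rewrite (_ : (fun n => _) = (cabs c) *: (fun n => cabs (a n) : R^o)); last first.
  by apply/funext => n; rewrite cabsM.
exact: is_cvg_seriesZ.
Qed.

Lemma cserD a b : cabs_summable a -> cabs_summable b ->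
  cser (fun n => a n + b n) = cser a + cser b.
Proof.
move=> h1 h2; apply: cser_unique; first exact: cabs_summableD.
rewrite (_ : csums _ = fun n => csums a n + csums b n).
  by apply: ccvgD; exact: csums_cvg.
by apply/funext => n; rewrite /csums big_split.
Qed.

Lemma cserZ a c : cabs_summable a -> cser (fun n => c * a n) = c * cser a.
Proof.
move=> h; apply: cser_unique; first exact: cabs_summableZ.
rewrite (_ : csums _ = fun n => c * csums a n).
  by apply: ccvgM; [exact: ccvg_cst|exact: csums_cvg].
by apply/funext => n; rewrite /csums big_distrr.
Qed.

Lemma cser_sum (I : Type) (s : seq I) (F : I -> nat -> R[i]) :
  (forall i, cabs_summable (F i)) ->
  cabs_summable (fun n => \sum_(i <- s) F i n) /\
  cser (fun n => \sum_(i <- s) F i n) = \sum_(i <- s) cser (F i).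
Proof.
move=> h; elim: s => [|i s [ih1 ih2]].
  have e : (fun n => \sum_(i <- [::]) F i n) = fun=> 0.
    by apply/funext => n; rewrite big_nil.
  have s0 : cabs_summable (fun=> (0 : R[i])).
    rewrite /cabs_summable; under eq_fun do rewrite cabs0.
    rewrite (_ : series _ = fun=> 0); first exact: is_cvg_cst.
    by apply/funext => n; rewrite /series /= big1.
  split; rewrite e// big_nil; apply: cser_unique => //.
  rewrite (_ : csums _ = fun=> 0); first exact: ccvg_cst.
  by apply/funext => n; rewrite /csums big1.
have e : (fun n => \sum_(j <- i :: s) F j n) = fun n => F i n + \sum_(j <- s) F j n.
  by apply/funext => n; rewrite big_cons.
by rewrite e big_cons -ih2; split; [exact: cabs_summableD|exact: cserD].
Qed.

Lemma cser_finite a N : (forall n, (N <= n)%N -> a n = 0) ->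
  cabs_summable a /\ cser a = csums a N.
Proof.
move=> h.
have e (b : nat -> R[i]) : (forall n, (N <= n)%N -> b n = 0) -> ccvg (csums b) (csums b N).
  move=> hb; apply/ccvgP/cvgrPdist_le => e e0; exists N => // n /= Nn.
  rewrite /csums (@big_cat_nat _ _ _ N 0 n)//= [\sum_(N <= _ < n) _]big_nat_cond.
  rewrite [X in _ + X - _]big1; last by move=> i /andP[/andP[Ni _] _]; exact: hb.
  by rewrite addr0 subrr cabs0 subrr normr0 ltW.
have s : cabs_summable a.
  rewrite /cabs_summable; apply/cvg_ex; exists (series (fun n => cabs (a n)) N).
  apply/cvgrPdist_le => e' e0; exists N => // n /= Nn.
  rewrite /series /= (@big_cat_nat _ _ _ N 0 n)//= [\sum_(N <= _ < n) _]big_nat_cond.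
  rewrite [X in _ - (_ + X)]big1; last first.
    by move=> i /andP[/andP[Ni _] _]; rewrite h// cabs0.
  by rewrite addr0 subrr normr0 ltW.
by split => //; apply: cser_unique => //; exact: e.
Qed.

Definition ps a z : R[i] := cser (fun n => a n * z ^+ n).
(** Radius of convergence at least 1, in the form of absolute convergence. *)
Definition rad1 a := forall r : R, 0 <= r < 1 -> cvgn (series (fun n => cabs (a n) * r ^+ n)).

(** Abel's lemma: a bound at the midpoint s of r and 1 leaves the geometric ratio r / s < 1 at r. *)
Lemma rad1_bounded a : (forall r : R, 0 <= r < 1 -> exists C, forall n, cabs (a n) * r ^+ n <= C) ->
  rad1 a.
Proof.
move=> h r /andP[r0 r1].
pose s := (1 + r) / 2.
have s0 : 0 < s by rewrite /s; lra.
have s1 : s < 1 by rewrite /s; lra.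
have rs : r < s by rewrite /s; lra.
have [C hC] := h s ltac:(by rewrite ltW//=).
have C0 : 0 <= C by rewrite (le_trans _ (hC 0%N))// mulr_ge0 ?cabs_ge0.
apply: (@series_le_cvg _ _ (geometric C (r / s))).
- by move=> n; rewrite mulr_ge0 ?cabs_ge0 ?exprn_ge0.
- by move=> n; rewrite /geometric /= mulr_ge0// exprn_ge0// divr_ge0// ltW.
- move=> n; rewrite /geometric /= expr_div_n mulrCA.
  rewrite mulrC ler_wpM2l ?exprn_ge0//.
  by rewrite ler_pdivlMr ?exprn_gt0.
- apply: is_cvg_geometric_series.
  by rewrite ger0_norm ?ltr_pdivrMr ?mul1r// divr_ge0// ltW.
Qed.

Lemma rad1_bound a (r : R) : rad1 a -> 0 <= r < 1 ->
  exists2 C, 0 <= C & forall n, cabs (a n) * r ^+ n <= C.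
Proof.
move=> h /h c; have cb := cvg_series_cvg_0 c.
have /cvg_seq_bounded[M [_ hM]] := cvgP _ cb.
have hM1 : forall n, `|cabs (a n) * r ^+ n| <= `|M| + 1.
  by move=> n; apply: hM => //; rewrite (le_lt_trans (ler_norm M))// ltrDl.
exists (`|M| + 1); first by rewrite addr_ge0.
by move=> n; rewrite (le_trans (ler_norm _)).
Qed.

Lemma rad1_summable a z : rad1 a -> cabs z < 1 -> cabs_summable (fun n => a n * z ^+ n).
Proof.
move=> h z1; rewrite /cabs_summable; under eq_fun do rewrite cabsM cabsX.
by apply: h; rewrite cabs_ge0.
Qed.

Lemma ps_cvg a z : rad1 a -> cabs z < 1 -> ccvg (csums (fun n => a n * z ^+ n)) (ps a z).
Proof. by move=> h z1; apply: csums_cvg; exact: rad1_summable. Qed.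

(** Each of n copies of t^n is dominated by one of the powers 1, t, ..., t^(n-1), whose sum is at
    most 1 / (1 - t). *)
Lemma muln_exp_le (t : R) n : 0 <= t < 1 -> n%:R * t ^+ n <= (1 - t)^-1.
Proof.
move=> /andP[t0 t1]; have t1' : 0 < 1 - t by rewrite subr_gt0.
rewrite -[leRHS]mul1r ler_pdivlMr//.
have h : \sum_(i < n) t ^+ n <= \sum_(i < n) t ^+ i.
  by apply: ler_sum => i _; rewrite ler_wiXn2l//; [exact: ltW|exact: ltnW].
rewrite sumr_const card_ord -mulr_natl in h.
rewrite (le_trans (ler_wpM2r (ltW t1') h))// mulrC.
have := subrX1 t n; rewrite -(opprB 1 t) -(opprB 1 (t ^+ n)) mulNr => /eqP.
by rewrite eqr_opp => /eqP <-; rewrite gerBl exprn_ge0.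
Qed.

(** Passing from r to the midpoint s of r and 1 absorbs the factor n, since n (r / s)^n stays
    bounded by [muln_exp_le]. *)
Lemma rad1_muln a : rad1 a -> rad1 (fun n => n%:R * a n).
Proof.
move=> h; apply: rad1_bounded => r /andP[r0 r1].
pose s := (1 + r) / 2.
have s0 : 0 < s by rewrite /s; lra.
have s1 : s < 1 by rewrite /s; lra.
have rs : r < s by rewrite /s; lra.
clearbody s; have [C C0 hC] := rad1_bound h (r := s) ltac:(by rewrite ltW).
have t1 : 0 <= r / s < 1.
  by rewrite divr_ge0//= ?ltr_pdivrMr ?mul1r// ltW.
exists (C * (1 - r / s)^-1) => n.
rewrite cabsM (_ : cabs n%:R = n%:R); last first.
  by rewrite -(rmorph_nat (real_complex R)) cabs_real ger0_norm.
rewrite (_ : _ * _ * _ = (cabs (a n) * s ^+ n) * (n%:R * (r / s) ^+ n)); last first.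
  rewrite expr_div_n; have : s ^+ n != 0 by rewrite expf_neq0// gt_eqF.
  by move=> ?; field.
have [t0 _] := andP t1.
by apply: ler_pM; rewrite ?muln_exp_le// mulr_ge0 ?cabs_ge0 ?exprn_ge0// ltW.
Qed.

Lemma cabs_subXX x y (r : R) m : cabs x <= r -> cabs y <= r ->
  cabs (x ^+ m - y ^+ m) <= cabs (x - y) * (m%:R * r ^+ m.-1).
Proof.
move=> xr yr; have r0 : 0 <= r := le_trans (cabs_ge0 _) xr.
rewrite subrXX cabsM ler_wpM2l ?cabs_ge0// (le_trans (cabs_sum _ _ _))//.
rewrite mulr_natl -[m in leRHS]card_ord -sumr_const; apply: ler_sum => i _.
rewrite cabsM !cabsX.
have im : (i <= m.-1)%N by case: m i => [[]|m i]//=; rewrite -ltnS.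
rewrite card_ord -[in leRHS](subnK im) exprD.
by rewrite ler_pM ?exprn_ge0 ?cabs_ge0// lerXn2r ?nnegrE ?cabs_ge0.
Qed.

End ComplexSeries.

(** * Complex derivatives, and power series as analytic functions *)

Section ComplexDerivative.
Variable R : realType.
Implicit Types (f : R[i] -> R[i]) (z d : R[i]).

(** First-order expansion measured by the real modulus [cabs]: the norm of [R[i]] takes values in
    [R[i]] itself, so the epsilons of [derivable] are complex. [derivable_cderivP] translates once
    and for all. *)
Definition cderiv_at f z d := forall e : R, 0 < e -> exists2 del : R, 0 < del &
  forall x, cabs (x - z) < del -> cabs (f x - f z - d * (x - z)) <= e * cabs (x - z).

Lemma cvg_real_seriesZ (c : R) (u : nat -> R) : cvgn (series u) ->
  cvgn (series (fun n => c * u n)) /\ limn (series (fun n => c * u n)) = c * limn (series u).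
Proof.
move=> h.
have e : series (fun n => c * u n) = fun n => c * series u n.
  by apply/funext => n; rewrite /series /= big_distrr.
have l : series (fun n => c * u n) @ \oo --> c * limn (series u).
  by rewrite e; apply: cvgM; [exact: cvg_cst|exact: h].
by split; [exact: cvgP l|exact: cvg_lim l].
Qed.

Lemma derivable_cderivP f z :
  derivable (f : R[i]^o -> R[i]^o) z 1 <-> exists d, cderiv_at f z d.
Proof.
split.
- rewrite /derivable => /cvg_ex[/= d] /cvgrPdist_lt hd; exists d => e e0.
  have e0' : 0 < (e%:C)%C :> R[i] by rewrite ltcR.
  have /nbhs_ballP[del /= del0 hdel] := hd _ e0'.
  have del_re : del = ((complex.Re del)%:C)%C.
    by apply: complex_ext => //=; case: del del0 {hdel} => a b; rewrite ltcE /= => /andP[/eqP ].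
  have del0' : 0 < complex.Re del by move: del0; rewrite {1}del_re ltcR.
  exists (complex.Re del) => // x xz.
  have [->|xNz] := eqVneq x z; first by rewrite !subrr mulr0 subr0 cabs0 mulr0.
  have xz0 : x - z != 0 by rewrite subr_eq0.
  have := hdel (x - z); rewrite -ball_normE /ball_/= sub0r normrN normcC del_re ltcR => /(_ xz xz0).
  rewrite normcC ltcR => /ltW h.
  have -> : f x - f z - d * (x - z) = - (x - z) * (d - (x - z)^-1 * (f x - f z)).
    by field.
  rewrite cabsM cabsN mulrC ler_wpM2r ?cabs_ge0//.
  move: h; rewrite /GRing.scale /=.
  by rewrite mulr1 subrK.
- move=> [d hd]; rewrite /derivable; apply/cvg_ex; exists d; apply/cvgrPdist_le => e e0.
  have e_re : e = ((complex.Re e)%:C)%C.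
    by apply: complex_ext => //=; case: e e0 => a b; rewrite ltcE /= => /andP[/eqP ].
  have e0' : 0 < complex.Re e by move: e0; rewrite {1}e_re ltcR.
  have [del del0 h] := hd _ e0'.
  apply/nbhs_ballP; exists (del%:C)%C; first by rewrite /= ltcR.
  move=> y; rewrite -ball_normE /ball_/= sub0r normrN normcC ltcR => yd y0.
  have := h (y + z); rewrite addrK => /(_ yd).
  rewrite e_re normcC lecR /GRing.scale /= mulr1 => hh.
  have -> : d - y^-1 * (f (y + z) - f z) = - y^-1 * (f (y + z) - f z - d * y) by field.
  by rewrite cabsM cabsN cabsV mulrC ler_pdivrMr ?cabs_gt0.
Qed.

Lemma cderiv_continuous f z d : cderiv_at f z d -> forall e : R, 0 < e ->
  exists2 del : R, 0 < del & forall x, cabs (x - z) < del -> cabs (f x - f z) <= e.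
Proof.
move=> h e e0; have [del del0 hdel] := h 1 ltr01.
have k0 : 0 < 1 + cabs d by rewrite ltr_pwDl// cabs_ge0.
exists (Num.min del (e / (1 + cabs d))); first by rewrite lt_min del0 divr_gt0.
move=> x; rewrite lt_min => /andP[/hdel h1]; rewrite ltr_pdivlMr// => h2.
rewrite -(subrK (d * (x - z)) (f x - f z)) (le_trans (cabsD _ _))//.
rewrite (le_trans _ (ltW h2))// [leRHS]mulrDr mulr1 lerD//; first by rewrite mul1r in h1.
by rewrite cabsM mulrC.
Qed.

(** The first-order remainder of the n-th term is at most |x - z|^2 n^2 |a_n| r^(n-2) for x and z of
    modulus at most r < 1; two uses of [rad1_muln] make this majorant summable. *)
Lemma ps_cderiv (a : nat -> R[i]) z : rad1 a -> cabs z < 1 -> exists d, cderiv_at (ps a) z d.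
Proof.
move=> ha z1.
pose r := (1 + cabs z) / 2.
have z0 := cabs_ge0 z.
have r0 : 0 < r by rewrite /r; lra.
have r1 : r < 1 by rewrite /r; lra.
have zr : cabs z < r by rewrite /r; lra.
clearbody r.
have hb := rad1_muln (rad1_muln ha).
have r01 : 0 <= r < 1 by rewrite ltW.
pose M n := (r^-1 * r^-1) * (cabs (n%:R * (n%:R * a n)) * r ^+ n).
have [cM _] := cvg_real_seriesZ (r^-1 * r^-1) (hb _ r01).
rewrite -/M in cM.
pose K := limn (series M).
have s1 : cabs_summable (fun n => (n%:R * a n) * z ^+ n.-1).
  apply: (cabs_summable_le _ (cvg_real_seriesZ r^-1 (rad1_muln ha r01)).1) => -[|n].
    by rewrite !mul0r cabs0 mul0r mulr0.
  rewrite /= cabsM cabsX exprS (mulrCA r^-1) (mulrA r^-1) mulVf ?gt_eqF// mul1r.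
  by rewrite ler_wpM2l ?cabs_ge0// lerXn2r ?nnegrE// ltW.
exists (cser (fun n => (n%:R * a n) * z ^+ n.-1)) => e e0.
have K0 : 0 <= K.
  rewrite (le_trans _ (nondecreasing_cvgn_le _ cM 0%N))//; first by rewrite /series /= big_geq.
  apply: nondecreasing_series => n _ _; have r0' := ltW r0.
  by rewrite /M !mulr_ge0 ?invr_ge0 ?exprn_ge0// cabs_ge0.
exists (Num.min (r - cabs z) (e / (1 + K))).
  by rewrite lt_min subr_gt0 zr divr_gt0// ltr_pwDl.
move=> x; rewrite lt_min => /andP[xr]; rewrite ltr_pdivlMr ?ltr_pwDl// => xe.
have xr' : cabs x <= r.
  by rewrite -(subrK z x) (le_trans (cabsD _ _))// -lerBrDr ltW.
have x1 : cabs x < 1 := le_lt_trans xr' r1.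
pose q n := a n * x ^+ n + (-1) * (a n * z ^+ n) + (- (x - z)) * ((n%:R * a n) * z ^+ n.-1).
have hq n : cabs (q n) <= (cabs (x - z) ^+ 2) * M n.
  (* Factoring x - z out of x^n - z^n and subtracting n z^(n-1) leaves differences of powers, from
     each of which a second factor x - z can be drawn. *)
  have -> : q n = a n * ((x - z) * \sum_(i < n) (x ^+ (n.-1 - i) - z ^+ (n.-1 - i)) * z ^+ i).
    rewrite /q; under eq_bigr do rewrite mulrBl.
    rewrite sumrB mulrBr -subrXX.
    rewrite [X in _ - (x - z) * X](_ : _ = n%:R * z ^+ n.-1); first by ring.
    rewrite -[n in n%:R]card_ord mulr_natl -sumr_const; apply: eq_bigr => i _.
    by rewrite -exprD subnK//; case: n i => [[]//|n i]; rewrite -ltnS.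
  have -> : (cabs (x - z) ^+ 2) * M n = cabs (a n) * (cabs (x - z) *
       (n%:R * (cabs (x - z) * (n%:R * (r^-1 * r^-1 * r ^+ n))))).
    rewrite /M !cabsM (_ : cabs n%:R = n%:R); first by ring.
    by rewrite -(rmorph_nat (real_complex R)) cabs_real ger0_norm.
  rewrite !cabsM !ler_wpM2l ?cabs_ge0//.
  rewrite (le_trans (cabs_sum _ _ _))// mulr_natl -[n in leRHS]card_ord -sumr_const.
  apply: ler_sum => i _; rewrite cabsM cabsX.
  rewrite card_ord.
  rewrite (le_trans (ler_pM _ _ (cabs_subXX _ xr' (ltW zr)) (lexx _)))//.
  - exact: cabs_ge0.
  - by rewrite exprn_ge0 ?cabs_ge0.
  rewrite -[leLHS]mulrA ler_wpM2l ?cabs_ge0//.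
  have : (n.-1 - i + i = n.-1)%N by rewrite subnK//; case: n i => [[]//|n i]; rewrite -ltnS.
  have : (0 < n)%N by case: n i => // -[].
  case: (n.-1 - i)%N => [|k] n0 ki.
    by rewrite mul0r mul0r mulr_ge0// mulr_ge0 ?exprn_ge0 ?mulr_ge0 ?invr_ge0// ltW.
  have {ki} : n = (k + i).+2 by rewrite -addSn ki prednK.
  move: (nat_of_ord i) => {}i ->.
  rewrite !exprS exprD -[leLHS]mulrA ler_pM//.
  - by rewrite mulr_ge0 ?exprn_ge0 ?cabs_ge0// ltW.
  - by rewrite ler_nat ltnS (leq_trans (leq_addr i k)).
  have -> : r^-1 / r * (r * (r * (r ^+ k * r ^+ i))) = r ^+ k * r ^+ i by field; rewrite gt_eqF.
  by rewrite ler_wpM2l ?exprn_ge0 ?lerXn2r ?nnegrE ?cabs_ge0// ltW.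
have sa := rad1_summable ha x1.
have sb := @cabs_summableZ _ _ (-1) (rad1_summable ha z1).
have sc := @cabs_summableZ _ _ (- (x - z)) s1.
have -> : ps a x - ps a z - cser (fun n => (n%:R * a n) * z ^+ n.-1) * (x - z) = cser q.
  rewrite /q cserD//; last exact: cabs_summableD.
  rewrite (cserD sa sb) (@cserZ _ _ (-1) (rad1_summable ha z1)) (@cserZ _ _ (- (x - z)) s1).
  by rewrite mulN1r mulNr [(x - z) * _]mulrC.
have [cM' lM'] := cvg_real_seriesZ (cabs (x - z) ^+ 2) cM.
rewrite (le_trans (cser_le hq cM'))// lM' -/K expr2 -mulrA mulrC ler_wpM2r ?cabs_ge0//.
by rewrite (le_trans _ (ltW xe))// ler_wpM2l ?cabs_ge0// lerDr.
Qed.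

Lemma cderiv_at_local f g z d : (forall x, cdisc x -> g x = f x) -> cdisc z ->
  cderiv_at f z d -> cderiv_at g z d.
Proof.
move=> fg z1 h e e0; have [del del0 hdel] := h e e0.
exists (Num.min del (1 - cabs z)); first by rewrite lt_min del0 subr_gt0.
move=> x; rewrite lt_min => /andP[xd xz]; rewrite !fg//; first exact: hdel.
by rewrite /cdisc/= -(subrK z x) (le_lt_trans (cabsD _ _))// -ltrBrDr.
Qed.

Lemma analytic_ps (a : nat -> R[i]) f : rad1 a -> (forall z, cdisc z -> f z = ps a z) ->
  analytic_in_disc f.
Proof.
move=> ha fa z z1; apply/derivable_cderivP.
have [d hd] := ps_cderiv ha z1.
by exists d; apply: cderiv_at_local hd.
Qed.

Lemma limn_series_complex (a : nat -> R[i]) : cabs_summable a ->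
  limn ([series (a n : R[i]^o)]_n) = cser a.
Proof.
move=> h; apply: cvg_lim; first exact: norm_hausdorff.
apply/cvgrPdist_le => e e0.
have e_re : e = ((complex.Re e)%:C)%C.
  by apply: complex_ext => //=; case: e e0 => a' b; rewrite ltcE /= => /andP[/eqP ].
have e0' : 0 < complex.Re e by move: e0; rewrite {1}e_re ltcR.
have /ccvgP/cvgrPdist_le/(_ _ e0') := csums_cvg h.
apply: filterS => n; rewrite sub0r normrN ger0_norm ?cabs_ge0//.
by rewrite -normrN opprB normcC e_re lecR.
Qed.

Definition bcoef (w : R -> R) (n : nat) : R[i] := (((2 * moment w (2 * n + 1))^-1)%:C)%C.

Lemma bergman_kernelE (w : R -> R) z x : rad1 (bcoef w) -> cabs (conjc z * x) < 1 ->
  bergman_kernel w z x = ps (bcoef w) (conjc z * x).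
Proof.
move=> h zx; have s := rad1_summable h zx.
rewrite /bergman_kernel /ps -(limn_series_complex s).
set u := fun n : nat => _ / _; set v := fun n : nat => _ * _ ^+ _.
suff -> : u = v by [].
by apply/funext => n; rewrite /u /v mulrC /bcoef fmorphV.
Qed.

End ComplexDerivative.

(** * Cauchy's theorem and Taylor expansion *)

Section RealGoursat.
Variable R : realType.
Implicit Types (f g : R -> R) (a b c d : R).

Definition lint f a b : R := \int[@lebesgue_measure R]_(x in `[a, b]) f x.

Lemma lint_integrable f a b : {within `[a, b], continuous f} ->
  (@lebesgue_measure R).-integrable `[a, b] (EFin \o f).
Proof. by move=> h; apply: continuous_compact_integrable => //; exact: segment_compact. Qed.

Lemma lint_cst (k a b : R) : a <= b -> lint (fun=> k) a b = k * (b - a).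
Proof.
move=> ab; transitivity (k * fine (lebesgue_measure (`[a, b]%classic : set R))).
  exact: Rintegral_cst.
rewrite lebesgue_measure_itv/= lte_fin.
by case: ifPn => //=; rewrite -leNgt => ba; rewrite (@le_anti _ _ a b) ?subrr// ab.
Qed.

Lemma lintB f g a b : {within `[a, b], continuous f} -> {within `[a, b], continuous g} ->
  lint (fun x => f x - g x) a b = lint f a b - lint g a b.
Proof. by move=> cf cg; rewrite /lint RintegralB//; exact: lint_integrable. Qed.

Lemma within_cst (k a b : R) : {within `[a, b], continuous (fun=> k : R)}.
Proof. by apply: continuous_subspaceT => x; exact: cvg_cst. Qed.

Lemma withinB f g a b : {within `[a, b], continuous f} -> {within `[a, b], continuous g} ->
  {within `[a, b], continuous (fun x => f x - g x)}.
Proof. by move=> cf cg x; apply: cvgB; [exact: cf|exact: cg]. Qed.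

Lemma within_subitv f a b a' b' : a <= a' -> b' <= b ->
  {within `[a, b], continuous f} -> {within `[a', b'], continuous f}.
Proof.
move=> aa bb; apply: continuous_subspaceW => x /=; rewrite !in_itv/= => /andP[h1 h2].
by rewrite (le_trans aa)// (le_trans h2).
Qed.

Lemma lint_split f a b m : a <= m -> m <= b -> {within `[a, b], continuous f} ->
  lint f a b = lint f a m + lint f m b.
Proof.
move=> am mb cf.
have := @Rintegral_itvB R f (BLeft a) (BRight b) m (lint_integrable cf).
rewrite !bnd_simp => /(_ am mb) h.
rewrite /lint -[X in _ + X]Rintegral_itv_obnd_cbnd; last first.
  apply: (integrableS _ _ _ (lint_integrable cf)) => //.
  by apply: subset_itvr; rewrite bnd_simp.
by rewrite -h addrC subrK.
Qed.

Lemma lint_near_cst f a b (k m : R) : a <= b -> {within `[a, b], continuous f} ->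
  (forall x, a <= x <= b -> `|f x - k| <= m) -> `|lint f a b - k * (b - a)| <= m * (b - a).
Proof.
move=> ab cf h; rewrite -(lint_cst k ab) -lintB//; last exact: within_cst.
rewrite (le_trans (le_normr_Rintegral _ _))//.
  by apply: lint_integrable; apply: withinB => //; exact: within_cst.
rewrite -(lint_cst m ab) /lint le_Rintegral//.
- apply: lint_integrable; have hc := withinB cf (@within_cst k a b).
  by move=> x; apply: cvg_norm; exact: hc.
- exact: lint_integrable (@within_cst _ _ _).
Qed.

Section Bisection.
Variables (a b c d : R) (F : R -> R -> R -> R -> R).
Hypotheses (ab : a <= b) (cd : c <= d).
Hypothesis F_add : forall s1 s2 t1 t2 s t,
  a <= s1 -> s1 <= s -> s <= s2 -> s2 <= b -> c <= t1 -> t1 <= t -> t <= t2 -> t2 <= d ->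
  F s1 s2 t1 t2 = F s1 s t1 t + F s s2 t1 t + F s1 s t t2 + F s s2 t t2.
Hypothesis F_loc : forall s t e, a <= s <= b -> c <= t <= d -> 0 < e ->
  exists2 del : R, 0 < del & forall s1 s2 t1 t2,
    a <= s1 -> s1 <= s -> s <= s2 -> s2 <= b -> c <= t1 -> t1 <= t -> t <= t2 -> t2 <= d ->
    s2 - s1 < del -> t2 - t1 < del ->
    `|F s1 s2 t1 t2| <= e * (((s2 - s1) + (t2 - t1)) ^+ 2).

Let h (n : nat) := (b - a) / 2 ^+ n.
Let k (n : nat) := (d - c) / 2 ^+ n.
Let Fn (n : nat) (q : R * R) := F q.1 (q.1 + h n) q.2 (q.2 + k n).
(** Moves to the corner of a quarter that carries at least a fourth of |F|. The last quarter is the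
    default branch; [Q_big] shows by additivity that it qualifies when the other three fail. *)
Let step (n : nat) (q : R * R) : R * R :=
  let big q' := `|Fn n q| <= 4 * `|Fn n.+1 q'| in
  if big q then q else
  if big (q.1 + h n.+1, q.2) then (q.1 + h n.+1, q.2) else
  if big (q.1, q.2 + k n.+1) then (q.1, q.2 + k n.+1) else (q.1 + h n.+1, q.2 + k n.+1).
Let Q := fix Q n := if n is m.+1 then step m (Q m) else (a, c).

Let h2 n : h n = h n.+1 + h n.+1.
Proof. by rewrite /h exprS; field; rewrite expf_neq0. Qed.
Let k2 n : k n = k n.+1 + k n.+1.
Proof. by rewrite /k exprS; field; rewrite expf_neq0. Qed.
Let h0 n : 0 <= h n.
Proof. by rewrite /h divr_ge0 ?exprn_ge0// subr_ge0. Qed.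
Let k0 n : 0 <= k n.
Proof. by rewrite /k divr_ge0 ?exprn_ge0// subr_ge0. Qed.

Let Q1 n : (Q n).1 <= (Q n.+1).1 /\ (Q n.+1).1 + h n.+1 <= (Q n).1 + h n.
Proof.
have := h0 n.+1; rewrite (h2 n) /= /step => ?.
by do 3 (case: ifP => _ /=; first by split; lra); split; lra.
Qed.

Let Q2 n : (Q n).2 <= (Q n.+1).2 /\ (Q n.+1).2 + k n.+1 <= (Q n).2 + k n.
Proof.
have := k0 n.+1; rewrite (k2 n) /= /step => ?.
by do 3 (case: ifP => _ /=; first by split; lra); split; lra.
Qed.

Let Q_mono n m : (n <= m)%N ->
  [/\ (Q n).1 <= (Q m).1, (Q m).1 + h m <= (Q n).1 + h n,
      (Q n).2 <= (Q m).2 & (Q m).2 + k m <= (Q n).2 + k n].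
Proof.
elim: m => [|m ih]; first by rewrite leqn0 => /eqP ->.
rewrite leq_eqVlt => /predU1P[->//|]; rewrite ltnS => /ih[i1 i2 i3 i4].
have [j1 j2] := Q1 m; have [j3 j4] := Q2 m.
by split; lra.
Qed.

Let Q_big n : `|F a b c d| <= 4 ^+ n * `|Fn n (Q n)|.
Proof.
elim: n => [|n ih].
  by rewrite expr0 mul1r /Fn /h /k /= !divr1 [a + _]addrC [c + _]addrC !subrK.
rewrite (le_trans ih)// exprSr -mulrA ler_wpM2l ?exprn_ge0//=.
rewrite /step; case: ifPn => //; rewrite -ltNge => l1.
case: ifPn => //; rewrite -ltNge => l2.
case: ifPn => //; rewrite -ltNge => l3.
rewrite leNgt; apply/negP => l4.
have [i1 i2 i3 i4] := Q_mono (leq0n n).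
have := h0 n.+1; have := k0 n.+1 => hk0 hh0.
have hh2 := h2 n; have hk2 := k2 n.
have ha : a + h 0 = b by rewrite /h divr1 addrC subrK.
have hc : c + k 0 = d by rewrite /k divr1 addrC subrK.
rewrite /= ha hc in i1 i2 i3 i4.
have := F_add (s1 := (Q n).1) (s2 := (Q n).1 + h n) (t1 := (Q n).2) (t2 := (Q n).2 + k n)
  (s := (Q n).1 + h n.+1) (t := (Q n).2 + k n.+1).
rewrite !lerDl lerD2l hh2 hk2 lerD2l !lerDl -hh2 -hk2.
move=> /(_ i1 hh0 hh0 i2 i3 hk0 hk0 i4) e.
move: l1 l2 l3 l4; rewrite /Fn /= e -!addrA -h2 -k2.
set u1 := F _ _ _ _; set u2 := F _ _ _ _; set u3 := F _ _ _ _; set u4 := F _ _ _ _.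
have := ler_normD u1 (u2 + (u3 + u4)); have := ler_normD u2 (u3 + u4); have := ler_normD u3 u4.
lra.
Qed.

(** Goursat's argument for an additive function of rectangles: nested quarters shrink to a point,
    near which [F_loc] makes F smaller than any multiple of the squared size, while bisection keeps
    |F| at least 4^(-n) times its initial value. *)
Lemma bisection_eq0 : F a b c d = 0.
Proof.
apply/eqP; rewrite -normr_eq0 -[_ == 0]negbK; apply/negP => Fn0.
have F0 : 0 < `|F a b c d| by rewrite lt_neqAle eq_sym Fn0/=.
have ha : a + h 0 = b by rewrite /h divr1 addrC subrK.
have hc : c + k 0 = d by rewrite /k divr1 addrC subrK.
pose u n := (Q n).1; pose v n := (Q n).2.
have bu n m : u n <= u m + h m.
  have [nm|mn] := leqP n m.
    by have [i1 _ _ _] := Q_mono nm; rewrite (le_trans i1)// lerDl.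
  by have [_ i1 _ _] := Q_mono (ltnW mn); rewrite (le_trans _ i1)// lerDl.
have bv n m : v n <= v m + k m.
  have [nm|mn] := leqP n m.
    by have [_ _ i1 _] := Q_mono nm; rewrite (le_trans i1)// lerDl.
  by have [_ _ _ i1] := Q_mono (ltnW mn); rewrite (le_trans _ i1)// lerDl.
have ndu : {homo u : n m / (n <= m)%N >-> n <= m} by move=> n m /Q_mono[].
have ndv : {homo v : n m / (n <= m)%N >-> n <= m} by move=> n m /Q_mono[].
have cu : cvgn u by apply: nondecreasing_is_cvgn => //; exists (u 0 + h 0) => _ [n _ <-].
have cv : cvgn v by apply: nondecreasing_is_cvgn => //; exists (v 0 + k 0) => _ [n _ <-].
pose s := limn u; pose t := limn v.
have us n : u n <= s by exact: nondecreasing_cvgn_le.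
have vt n : v n <= t by exact: nondecreasing_cvgn_le.
have su n : s <= u n + h n by apply: limr_le => //; apply: nearW => m; exact: bu.
have tv n : t <= v n + k n by apply: limr_le => //; apply: nearW => m; exact: bv.
pose L := (b - a) + (d - c).
have L0 : 0 <= L by rewrite addr_ge0// subr_ge0.
have L1 : 0 < 1 + L ^+ 2 by rewrite ltr_pwDl// sqr_ge0.
have abs : a <= s <= b.
  by have := us 0; have := su 0; rewrite ha /u /= => -> ->.
have cdt : c <= t <= d.
  by have := vt 0; have := tv 0; rewrite hc /v /= => -> ->.
(* With e = |F| / (1 + L^2) the n-th rectangle gives 4^n e (L / 2^n)^2 = |F| L^2 / (1 + L^2) < |F|,
   against [Q_big]. *)
have [del del0 hdel] := F_loc abs cdt (divr_gt0 F0 L1).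
have [n hn] : exists n, L / 2 ^+ n < del.
  have l : (fun n => L * 2^-1 ^+ n) @ \oo --> (0 : R).
    rewrite -[X in _ --> X](mulr0 L); apply: cvgM; first exact: cvg_cst.
    by apply: cvg_expr; rewrite ger0_norm// invf_lt1// ltr1n.
  move/cvgrPdist_lt : l => /(_ _ del0)[n _ /(_ n (leqnn n))] /=.
  rewrite sub0r normrN ger0_norm ?mulr_ge0 ?exprn_ge0 ?invr_ge0// exprVn => hn.
  by exists n.
have Lhk : h n + k n = L / 2 ^+ n by rewrite -mulrDl.
have [i1 i2 i3 i4] := Q_mono (leq0n n).
rewrite ha hc /= in i1 i2 i3 i4.
have hn0 := h0 n; have kn0 := k0 n.
have := hdel (u n) (u n + h n) (v n) (v n + k n) i1 (us n) (su n) i2 i3 (vt n) (tv n) i4.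
rewrite ![_ + _ - _]addrAC !subrr !add0r.
move=> /(_ ltac:(lra) ltac:(lra)).
have := Q_big n; rewrite -/(Fn n (Q n)) Lhk => b1 b2.
have := le_trans b1 (ler_wpM2l _ b2).
rewrite exprn_ge0// => /(_ isT).
rewrite leNgt => /negP; apply.
rewrite exprMn exprVn -exprM mulnC exprM (_ : 2 ^+ 2 = 4 :> R); last by rewrite -natrX.
rewrite (_ : _ * _ = `|F a b c d| * (L ^+ 2 / (1 + L ^+ 2))); last first.
  by field; rewrite expf_neq0//= gt_eqF.
by rewrite gtr_pMr// ltr_pdivrMr// mul1r ltrDr.
Qed.

End Bisection.

Lemma dist_in_itv (x y u v : R) : u <= x -> x <= v -> u <= y <= v -> `|y - x| <= v - u.
Proof. by move=> h1 h2 /andP[h3 h4]; rewrite ler_norml; lra. Qed.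

Lemma four_quarters (e D : R) : e / 4 * D + e / 4 * D = e / 2 * D.
Proof. by lra. Qed.

Definition frechet (f : R -> R -> R) (s t l m : R) := forall e : R, 0 < e ->
  exists2 del : R, 0 < del & forall s' t' : R, `|s' - s| < del -> `|t' - t| < del ->
    `|f s' t' - f s t - l * (s' - s) - m * (t' - t)| <= e * (`|s' - s| + `|t' - t|).

(* Green's formula on a rectangle for a field with Q_s = P_t, without continuity
   of the derivatives: bisection as in Goursat's lemma. *)
Lemma goursat_rect (P Q : R -> R -> R) a b c d : a <= b -> c <= d ->
  (forall s, a <= s <= b -> {within `[c, d], continuous (Q s)}) ->
  (forall t, c <= t <= d -> {within `[a, b], continuous (P^~ t)}) ->
  (forall s t, a <= s <= b -> c <= t <= d ->
    exists l m n, frechet P s t n l /\ frechet Q s t l m) ->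
  lint (Q b) c d - lint (Q a) c d = lint (P^~ d) a b - lint (P^~ c) a b.
Proof.
move=> ab cd cQ cP fPQ.
pose F s1 s2 t1 t2 := (lint (Q s2) t1 t2 - lint (Q s1) t1 t2) -
   (lint (P^~ t2) s1 s2 - lint (P^~ t1) s1 s2).
have cQ' s t1 t2 : a <= s <= b -> c <= t1 -> t2 <= d -> {within `[t1, t2], continuous (Q s)}.
  by move=> sab ct td; apply: (within_subitv ct td); exact: cQ.
have cP' t s1 s2 : c <= t <= d -> a <= s1 -> s2 <= b -> {within `[s1, s2], continuous (P^~ t)}.
  by move=> sab ct td; apply: (within_subitv ct td); exact: cP.
apply/eqP; rewrite -subr_eq0; apply/eqP.
apply: (@bisection_eq0 a b c d F) => //.
- move=> s1 s2 t1 t2 s t i1 i2 i3 i4 i5 i6 i7 i8; rewrite /F.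
  rewrite (@lint_split (Q s2) t1 t2 t) ?(@lint_split (Q s1) t1 t2 t)//; last 2 first.
    by apply: cQ'; lra.
    by apply: cQ'; lra.
  rewrite (@lint_split (P^~ t2) s1 s2 s) ?(@lint_split (P^~ t1) s1 s2 s)//; last 2 first.
    by apply: cP'; lra.
    by apply: cP'; lra.
  by ring.
- move=> s t e sab tcd e0.
  have [l [m [n [fP fQ]]]] := fPQ s t sab tcd.
  have e40 : 0 < e / 4 by rewrite divr_gt0.
  have [d1 d10 hP] := fP _ e40; have [d2 d20 hQ] := fQ _ e40.
  exists (Num.min d1 d2); first by rewrite lt_min d10.
  move=> s1 s2 t1 t2 i1 i2 i3 i4 i5 i6 i7 i8; rewrite !lt_min => /andP[j1 j2] /andP[j3 j4].
  have st12 : s1 <= s2 by lra.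
  have tt12 : t1 <= t2 by lra.
  have cQs y : s1 <= y <= s2 -> {within `[t1, t2], continuous (Q y)}.
    by move=> /andP[h1 h2]; apply: cQ' => //; rewrite (le_trans i1)//= (le_trans h2).
  have cPs y : t1 <= y <= t2 -> {within `[s1, s2], continuous (P^~ y)}.
    by move=> /andP[h1 h2]; apply: cP' => //; rewrite (le_trans i5)//= (le_trans h2).
  have s11 : s1 <= s1 <= s2 by rewrite lexx.
  have s22 : s1 <= s2 <= s2 by rewrite lexx st12.
  have t11 : t1 <= t1 <= t2 by rewrite lexx.
  have t22 : t1 <= t2 <= t2 by rewrite lexx tt12.
  pose D := (s2 - s1) + (t2 - t1).
  have bnd s' t' : s1 <= s' <= s2 -> t1 <= t' <= t2 ->
     [/\ `|s' - s| < d1, `|s' - s| < d2, `|t' - t| < d1, `|t' - t| < d2 &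
         `|s' - s| + `|t' - t| <= D].
    move=> /(dist_in_itv i2 i3) ns /(dist_in_itv i6 i7) nt.
    by split; rewrite ?lerD// (le_lt_trans ns, le_lt_trans nt).
  (* In Q(s2, y) - Q(s1, y) the linear terms in y cancel and the constant l (s2 - s1) remains. In
     [bP] the same l, the common value of Q_s and P_t, leaves l (t2 - t1), so the two main terms
     cancel. *)
  have bQ : `|lint (fun y => Q s2 y - Q s1 y) t1 t2 - (l * (s2 - s1)) * (t2 - t1)| <=
      (e / 2 * D) * (t2 - t1).
    apply: lint_near_cst => //.
      by apply: withinB; exact: cQs.
    move=> y ty.
    have [_ k1 _ k2 k3] := bnd s2 y s22 ty.
    have [_ k4 _ k5 k6] := bnd s1 y s11 ty.
    have q1 := hQ _ _ k1 k2; have q2 := hQ _ _ k4 k5.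
    have q1' := le_trans q1 (ler_wpM2l (ltW e40) k3).
    have q2' := le_trans q2 (ler_wpM2l (ltW e40) k6).
    rewrite (_ : _ - _ = (Q s2 y - Q s t - l * (s2 - s) - m * (y - t)) -
      (Q s1 y - Q s t - l * (s1 - s) - m * (y - t))); last by ring.
    by rewrite (le_trans (ler_normB _ _))// (le_trans (lerD q1' q2'))// four_quarters.
  have bP : `|lint (fun x => P x t2 - P x t1) s1 s2 - (l * (t2 - t1)) * (s2 - s1)| <=
      (e / 2 * D) * (s2 - s1).
    apply: lint_near_cst => //.
      by apply: withinB; exact: cPs.
    move=> x xs.
    have [k1 _ k2 _ k3] := bnd x t2 xs t22.
    have [k4 _ k5 _ k6] := bnd x t1 xs t11.
    have q1 := hP _ _ k1 k2; have q2 := hP _ _ k4 k5.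
    have q1' := le_trans q1 (ler_wpM2l (ltW e40) k3).
    have q2' := le_trans q2 (ler_wpM2l (ltW e40) k6).
    rewrite (_ : _ - _ = (P x t2 - P s t - n * (x - s) - l * (t2 - t)) -
      (P x t1 - P s t - n * (x - s) - l * (t1 - t))); last by ring.
    by rewrite (le_trans (ler_normB _ _))// (le_trans (lerD q1' q2'))// four_quarters.
  rewrite /F -(lintB (cQs _ s22) (cQs _ s11)) -(lintB (cPs _ t22) (cPs _ t11)).
  rewrite (_ : _ - _ = (lint (fun y => Q s2 y - Q s1 y) t1 t2 - (l * (s2 - s1)) * (t2 - t1)) -
    (lint (fun x => P x t2 - P x t1) s1 s2 - (l * (t2 - t1)) * (s2 - s1))); last by ring.
  rewrite (le_trans (ler_normB _ _))// (le_trans (lerD bQ bP))//.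
  rewrite -mulrDr [t2 - t1 + _]addrC -/D.
  have D0 : 0 <= D by rewrite addr_ge0// subr_ge0.
  rewrite expr2 mulrA !ler_wpM2r//.
  by rewrite ler_pdivrMr// ler_pMr// ler1n.
Qed.

End RealGoursat.

(** * Logarithmic polar coordinates *)

Section CircleMeans.
Variable R : realType.
Implicit Types (F G H f : R[i] -> R[i]) (g h : R -> R[i]).

Lemma is_derive_littleo (f : R -> R) (x df : R) : is_derive x 1 f df ->
  forall e : R, 0 < e -> exists2 del : R, 0 < del &
    forall y : R, `|y - x| < del -> `|f y - f x - df * (y - x)| <= e * `|y - x|.
Proof.
move=> [dxf dfE] e e0.
have := dxf => /cvgrPdist_le /(_ _ e0).
rewrite -[lim _]/('D_1 f x) dfE => /nbhs_ballP[del /= del0 hdel].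
exists del => // y yd.
have [->|yx] := eqVneq y x; first by rewrite !subrr mulr0 subr0 normr0 mulr0.
have yx0 : y - x != 0 by rewrite subr_eq0.
have := hdel (y - x); rewrite -ball_normE /ball_/= sub0r normrN => /(_ yd yx0).
rewrite /GRing.scale /= mulr1 subrK => h.
rewrite (_ : _ - _ = - (y - x) * (df - (y - x)^-1 * (f y - f x))); last by field.
by rewrite normrM normrN mulrC ler_wpM2r.
Qed.

Lemma frechetM (f g : R -> R) (s t df dg : R) : is_derive s 1 f df -> is_derive t 1 g dg ->
  frechet (fun x y => f x * g y) s t (df * g t) (f s * dg).
Proof.
move=> hf hg e e0.
pose K := 1 + `|g t| + `|f s| + `|df|.
have [n1 n2 n3] := And3 (normr_ge0 (g t)) (normr_ge0 (f s)) (normr_ge0 df).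
have [K0 [Kg [Kf Kdf]]] : 0 < K /\ `|g t| <= K /\ `|f s| <= K /\ 1 + `|df| <= K.
  by rewrite /K; clear -n1 n2 n3; lra.
pose e' := Num.min 1 (e / (3 * K)).
have e3K : 0 < e / (3 * K) by rewrite divr_gt0// mulr_gt0.
have e'0 : 0 < e' by rewrite lt_min ltr01.
have e'1 : e' <= 1 by rewrite ge_min lexx.
have e'K : e' * K <= e / 3.
  have : e' <= e / (3 * K) by rewrite ge_min lexx orbT.
  by rewrite ler_pdivlMr ?mulr_gt0// mulrCA => h; rewrite ler_pdivlMr// mulrC.
have [d1 d10 h1] := is_derive_littleo hf e'0.
have [d2 d20 h2] := is_derive_littleo hg e'0.
have [d3 d30 h3] : exists2 d3 : R, 0 < d3 & forall y : R, `|y - t| < d3 -> `|g y - g t| <= e'.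
  have /derivable1_diffP/differentiable_continuous : derivable g t 1 by case: hg.
  move=> /cvgrPdist_le/(_ _ e'0)/nbhs_ballP[d3 /= d30 h]; exists d3 => // y yd.
  by rewrite distrC; apply: h; rewrite -ball_normE /ball_/= distrC.
exists (Num.min d1 (Num.min d2 d3)); first by rewrite !lt_min d10 d20.
move=> x y; rewrite !lt_min => /andP[x1 _] /and3P[_ y2 y3].
rewrite (_ : _ - _ = (f x - f s - df * (x - s)) * g t + f s * (g y - g t - dg * (y - t))
  + (f x - f s) * (g y - g t)); last by ring.
have b1 : `|(f x - f s - df * (x - s)) * g t| <= e / 3 * `|x - s|.
  rewrite normrM (le_trans (ler_pM _ _ (h1 _ x1) Kg))// mulrAC.
  by rewrite ler_wpM2r.
have b2 : `|f s * (g y - g t - dg * (y - t))| <= e / 3 * `|y - t|.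
  rewrite normrM mulrC (le_trans (ler_pM _ _ (h2 _ y2) Kf))// mulrAC.
  by rewrite ler_wpM2r.
have b3 : `|(f x - f s) * (g y - g t)| <= e / 3 * `|x - s|.
  have fx : `|f x - f s| <= K * `|x - s|.
    rewrite -(subrK (df * (x - s)) (f x - f s)) (le_trans (ler_normD _ _))//.
    rewrite normrM (le_trans (lerD (h1 _ x1) (lexx _)))// -mulrDl ler_wpM2r//.
    by rewrite (le_trans _ Kdf)// lerD2r.
  rewrite normrM (le_trans (ler_pM _ _ fx (h3 _ y3)))// mulrAC ler_wpM2r//.
  by rewrite mulrC.
rewrite (le_trans (ler_normD _ _))// (le_trans (lerD (ler_normD _ _) (lexx _)))//.
rewrite (le_trans (lerD (lerD b1 b2) b3))//.
have := normr_ge0 (x - s); have := normr_ge0 (y - t).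
by clear -e0 => ? ?; nra.
Qed.

Definition pol (s t : R) : R[i] := Complex (expR s * cos t) (expR s * sin t).

Lemma cabs_pol s t : cabs (pol s t) = expR s.
Proof.
by rewrite /cabs /= !exprMn -mulrDr cos2Dsin2 mulr1 sqrtr_sqr ger0_norm// expR_ge0.
Qed.

Lemma pol_neq0 s t : pol s t != 0.
Proof. by rewrite -cabs_gt0 cabs_pol expR_gt0. Qed.

Lemma polV s t : (pol s t)^-1 = pol (- s) (- t).
Proof.
apply: (mulfI (pol_neq0 s t)); rewrite mulfV ?pol_neq0//.
rewrite /pol cosN sinN expRN; apply: complex_ext; rewrite ?ReM ?ImM /=.
- rewrite (_ : _ - _ = expR s / expR s * (cos t ^+ 2 + sin t ^+ 2)); last by ring.
  by rewrite cos2Dsin2 mulr1 mulfV// gt_eqF// expR_gt0.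
- by ring.
Qed.

Lemma pol_periodic s : pol s (2 * pi) = pol s 0.
Proof. by rewrite /pol mulr_natl cos2pi sin2pi cos0 sin0. Qed.

(** The differential is multiplication by one complex number D, so the Cauchy-Riemann equations are
    built in; [cfrechet_Re] and [cfrechet_Im] read them off. *)
Definition cfrechet (h : R -> R -> R[i]) (s t : R) (D : R[i]) := forall e : R, 0 < e ->
  exists2 del : R, 0 < del & forall s' t' : R, `|s' - s| < del -> `|t' - t| < del ->
    cabs (h s' t' - h s t - D * Complex (s' - s) (t' - t)) <= e * (`|s' - s| + `|t' - t|).

Lemma pol_cfrechet s t : cfrechet pol s t (pol s t).
Proof.
move=> e e0; have e20 : 0 < e / 2 by rewrite divr_gt0.
have [d1 d10 h1] := frechetM (is_derive_expR s) (is_derive_cos t) e20.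
have [d2 d20 h2] := frechetM (is_derive_expR s) (is_derive_sin t) e20.
exists (Num.min d1 d2); first by rewrite lt_min d10.
move=> x y; rewrite !lt_min => /andP[x1 x2] /andP[y1 y2].
rewrite (le_trans (cabs_le_ReIm _))// [e]splitr mulrDl lerD//.
- rewrite (le_trans _ (h1 _ _ x1 y1))//; rewrite le_eqVlt; apply/orP; left; apply/eqP.
  by congr (`|_|); rewrite !(ReD, ReN, ReM) /=; ring.
- rewrite (le_trans _ (h2 _ _ x2 y2))//; rewrite le_eqVlt; apply/orP; left; apply/eqP.
  by congr (`|_|); rewrite !(ImD, ImN, ImM) /=; ring.
Qed.

Lemma cabs_Complex_le (x y : R) : cabs (Complex x y) <= `|x| + `|y|.
Proof. exact: cabs_le_ReIm. Qed.

Lemma cfrechet_comp F s t d : cderiv_at F (pol s t) d ->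
  cfrechet (fun s t => F (pol s t)) s t (d * pol s t).
Proof.
move=> hF e e0.
pose K := 1 + cabs (pol s t).
have K0 : 0 < K by rewrite ltr_pwDl ?cabs_ge0.
have d0 : 0 < 1 + cabs d by rewrite ltr_pwDl ?cabs_ge0.
have e1 : 0 < e / 2 / K by rewrite !divr_gt0.
have [d1 d10 h1] := hF _ e1.
have e2 : 0 < Num.min 1 (e / 2 / (1 + cabs d)) by rewrite lt_min ltr01 !divr_gt0.
have [d2 d20 h2] := pol_cfrechet s t e2.
exists (Num.min (d1 / (2 * K)) d2); first by rewrite lt_min d20 divr_gt0// mulr_gt0.
move=> x y; rewrite !lt_min => /andP[x1 x2] /andP[y1 y2].
set l := `|x - s| + `|y - t|.
have l0 : 0 <= l by rewrite addr_ge0.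
have r := h2 _ _ x2 y2.
have zl : cabs (pol x y - pol s t) <= K * l.
  rewrite -(subrK (pol s t * Complex (x - s) (y - t)) (pol x y - pol s t)).
  rewrite (le_trans (cabsD _ _))// mulrDl lerD//.
    by rewrite (le_trans r)// ler_wpM2r// ge_min lexx.
  by rewrite cabsM ler_wpM2l ?cabs_ge0// cabs_Complex_le.
have ld : K * l < d1.
  move: x1 y1; rewrite !ltr_pdivlMr ?mulr_gt0// => x1 y1.
  by rewrite /l; clear -x1 y1; lra.
have q := h1 _ (le_lt_trans zl ld).
rewrite (_ : _ - _ = (F (pol x y) - F (pol s t) - d * (pol x y - pol s t)) +
  d * (pol x y - pol s t - pol s t * Complex (x - s) (y - t))); last by ring.
rewrite (le_trans (cabsD _ _))// [e]splitr mulrDl lerD//.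
- rewrite (le_trans q)// (le_trans (ler_wpM2l (ltW e1) zl))// mulrA divfK//.
  by rewrite gt_eqF.
- rewrite cabsM (le_trans (ler_wpM2l (cabs_ge0 _) r))// mulrA ler_wpM2r//.
  have m2 : Num.min 1 (e / 2 / (1 + cabs d)) <= e / 2 / (1 + cabs d) by rewrite ge_min lexx orbT.
  rewrite (le_trans (ler_wpM2l (cabs_ge0 _) m2))//.
  by rewrite mulrC mulrAC ler_pdivrMr// ler_wpM2l ?lerDr// ltW// divr_gt0.
Qed.

Lemma cfrechet_Re (h : R -> R -> R[i]) s t D : cfrechet h s t D ->
  frechet (fun s t => complex.Re (h s t)) s t (complex.Re D) (- complex.Im D).
Proof.
move=> hh e /hh[del del0 hd]; exists del => // x y /hd h1 /h1.
apply: le_trans; rewrite (le_trans _ (Re_le_cabs _))//.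
by rewrite !(ReD, ReN, ReM) /= mulNr opprB opprK -!addrA [- (_ * _) + _]addrC.
Qed.

Lemma cfrechet_Im (h : R -> R -> R[i]) s t D : cfrechet h s t D ->
  frechet (fun s t => complex.Im (h s t)) s t (complex.Im D) (complex.Re D).
Proof.
move=> hh e /hh[del del0 hd]; exists del => // x y /hd h1 /h1.
apply: le_trans; rewrite (le_trans _ (Im_le_cabs _))//.
by rewrite !(ImD, ImN, ImM) /= opprD addrA addrAC.
Qed.

Lemma frechetN (f : R -> R -> R) s t l m : frechet f s t l m ->
  frechet (fun s t => - f s t) s t (- l) (- m).
Proof.
move=> hh e /hh[del del0 hd]; exists del => // x y /hd h1 /h1.
apply: le_trans; rewrite -normrN le_eqVlt; apply/orP; left; apply/eqP; congr (`|_|).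
by ring.
Qed.

Lemma frechet_cvg_t (f : R -> R -> R) s t l m : frechet f s t l m -> {for t, continuous (f s)}.
Proof.
move=> hf; apply/cvgrPdist_le => e e0.
have [del del0 hd] := hf 1 ltr01.
have k0 : 0 < 1 + `|m| by rewrite ltr_pwDl.
apply/nbhs_ballP; exists (Num.min del (e / (1 + `|m|))).
  by rewrite /= lt_min del0 divr_gt0.
move=> y /=; rewrite lt_min => /andP[y1].
rewrite ltr_pdivlMr// => y2; rewrite distrC in y1; rewrite distrC in y2.
have := hd s y; rewrite subrr normr0 mulr0 subr0 add0r mul1r => /(_ del0 y1) h.
rewrite distrC -(subrK (m * (y - t)) (f s y - f s t)) (le_trans (ler_normD _ _))//.
by rewrite normrM (le_trans (lerD h (lexx _)))// (le_trans _ (ltW y2))// mulrDr mulr1 [_ * `|m|]mulrC.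
Qed.

Lemma frechet_swap (f : R -> R -> R) s t l m : frechet f s t l m ->
  frechet (fun t s => f s t) t s m l.
Proof.
move=> hf e /hf[del del0 hd]; exists del => // y x yt xs.
have := hd _ _ xs yt; rewrite addrAC [_ + `|y - t|]addrC; apply: le_trans.
by rewrite le_eqVlt; apply/orP; left; apply/eqP; congr (`|_|); ring.
Qed.

End CircleMeans.

(** * Integrals over circles centred at 0 *)

Section CauchyTaylor.
Variable R : realType.
Implicit Types (F G H f : R[i] -> R[i]) (g h : R -> R[i]).

Definition ccont g := continuous (fun t => complex.Re (g t)) /\ continuous (fun t => complex.Im (g t)).

Lemma ccont_cst k : ccont (fun=> k).
Proof. by split => x; exact: cvg_cst. Qed.

Lemma ccontD g h : ccont g -> ccont h -> ccont (fun t => g t + h t).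
Proof.
move=> [g1 g2] [h1 h2]; split.
- by under eq_fun do rewrite ReD; move=> x; apply: cvgD; [exact: g1|exact: h1].
- by under eq_fun do rewrite ImD; move=> x; apply: cvgD; [exact: g2|exact: h2].
Qed.

Lemma ccontM g h : ccont g -> ccont h -> ccont (fun t => g t * h t).
Proof.
move=> [g1 g2] [h1 h2]; split.
- under eq_fun do rewrite ReM; move=> x; apply: cvgB; apply: cvgM;
  by [exact: g1|exact: h1|exact: g2|exact: h2].
- under eq_fun do rewrite ImM; move=> x; apply: cvgD; apply: cvgM;
  by [exact: g1|exact: h1|exact: g2|exact: h2].
Qed.

Lemma ccontX g n : ccont g -> ccont (fun t => g t ^+ n).
Proof.
move=> cg; elim: n => [|n ih]; first exact: ccont_cst.
by under eq_fun do rewrite exprS; exact: ccontM.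
Qed.

Lemma ccont_sum (s : seq nat) (F : nat -> R -> R[i]) : (forall n, ccont (F n)) ->
  ccont (fun t => \sum_(n <- s) F n t).
Proof.
move=> h; elim: s => [|i s ih].
  by under eq_fun do rewrite big_nil; exact: ccont_cst.
by under eq_fun do rewrite big_cons; exact: ccontD.
Qed.

Lemma ccont_cabs g : ccont g -> continuous (fun t => cabs (g t)).
Proof.
move=> [g1 g2] x; apply/cvgrPdist_le => e e0.
have e20 : 0 < e / 2 by rewrite divr_gt0.
have /cvgrPdist_le/(_ _ e20) h1 := g1 x.
have /cvgrPdist_le/(_ _ e20) h2 := g2 x.
near=> y.
have k1 : `|complex.Re (g x) - complex.Re (g y)| <= e / 2 by near: y.
have k2 : `|complex.Im (g x) - complex.Im (g y)| <= e / 2 by near: y.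
have : cabs (g x - g y) <= e.
  by rewrite (le_trans (cabs_le_ReIm _))// !(ReD, ImD, ReN, ImN) [e]splitr lerD.
apply: le_trans.
by rewrite ler_norml lerNl opprB cabs_le_sub cabsB cabs_le_sub.
Unshelve. all: by end_near. Qed.

Lemma ccontP g : (forall x (e : R), 0 < e -> exists2 del : R, 0 < del &
  forall y, `|y - x| < del -> cabs (g y - g x) <= e) -> ccont g.
Proof.
move=> h; split => x; apply/cvgrPdist_le => e /(h x)[del del0 hd];
  apply/nbhs_ballP; exists del => // y /=; rewrite distrC => /hd;
  apply: le_trans; rewrite cabsB.
- by rewrite (le_trans _ (Re_le_cabs _))// ReD ReN.
- by rewrite (le_trans _ (Im_le_cabs _))// ImD ImN.
Qed.

Lemma ccont_polV s : ccont (fun t => (pol s t)^-1).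
Proof.
under eq_fun do rewrite polV; split => t /=; under eq_fun do rewrite ?cosN ?sinN.
- by rewrite ?cosN; apply: cvgM; [exact: cvg_cst| exact: continuous_cos].
- by rewrite ?sinN; apply: cvgM; [exact: cvg_cst| apply: cvgN; exact: continuous_sin].
Qed.

Definition ceps_cont H z := forall e : R, 0 < e ->
  exists2 del : R, 0 < del & forall x, cabs (x - z) < del -> cabs (H x - H z) <= e.

Lemma pol_cont s t (e : R) : 0 < e -> exists2 del : R, 0 < del &
  forall s' t' : R, `|s' - s| < del -> `|t' - t| < del -> cabs (pol s' t' - pol s t) < e.
Proof.
move=> e0; have [del del0 h] := pol_cfrechet s t (@ltr01 R).
have K0 : 0 < 2 * (1 + cabs (pol s t)) by rewrite mulr_gt0// ltr_pwDl ?cabs_ge0.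
exists (Num.min del (e / (2 * (1 + cabs (pol s t))))); first by rewrite lt_min del0 divr_gt0.
move=> s' t'; rewrite !lt_min !ltr_pdivlMr// => /andP[s1 s2] /andP[t1 t2].
have q := h _ _ s1 t1.
rewrite -(subrK (pol s t * Complex (s' - s) (t' - t)) (pol s' t' - pol s t)).
rewrite (le_lt_trans (cabsD _ _))// cabsM.
have := ler_wpM2l (cabs_ge0 (pol s t)) (cabs_Complex_le (s' - s) (t' - t)).
move: (cabs (_ - _)) q (cabs (Complex _ _)) (cabs (pol s t)) s2 t2 => u q v w s2 t2 r.
by clear -q s2 t2 r; lra.
Qed.

Lemma ccont_comp H s : (forall z, cabs z = expR s -> ceps_cont H z) -> ccont (fun t => H (pol s t)).
Proof.
move=> h; apply: ccontP => x e e0.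
have [d d0 hd] := h _ (cabs_pol s x) _ e0.
have [d' d'0 hd'] := pol_cont s x d0.
by exists d' => // y yx; apply: hd; apply: hd' => //; rewrite subrr normr0.
Qed.

Definition cI g : R[i] := Complex (lint (fun t => complex.Re (g t)) 0 (2 * pi))
  (lint (fun t => complex.Im (g t)) 0 (2 * pi)).

Let pi2 : (0 : R) <= 2 * pi. Proof. by rewrite mulr_ge0// pi_ge0. Qed.

Let wcont (f : R -> R) : continuous f -> {within `[0 : R, 2 * pi], continuous f}.
Proof. exact: continuous_subspaceT. Qed.

Let lint_int (f : R -> R) : continuous f ->
  (@lebesgue_measure R).-integrable `[0 : R, 2 * pi] (EFin \o f).
Proof. by move=> cf; apply: lint_integrable; exact: wcont. Qed.

Lemma lintD_cont (f g : R -> R) : continuous f -> continuous g ->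
  lint (fun x => f x + g x) 0 (2 * pi) = lint f 0 (2 * pi) + lint g 0 (2 * pi).
Proof. by move=> cf cg; rewrite /lint RintegralD//; exact: lint_int. Qed.

Lemma lintB_cont (f g : R -> R) : continuous f -> continuous g ->
  lint (fun x => f x - g x) 0 (2 * pi) = lint f 0 (2 * pi) - lint g 0 (2 * pi).
Proof. by move=> cf cg; rewrite lintB//; exact: wcont. Qed.

Lemma lintZ_cont (k : R) (f : R -> R) : continuous f ->
  lint (fun x => k * f x) 0 (2 * pi) = k * lint f 0 (2 * pi).
Proof. by move=> cf; rewrite /lint RintegralZl//; exact: lint_int. Qed.

Let cZ (k : R) (f : R -> R) : continuous f -> continuous (fun x => k * f x).
Proof. by move=> cf x; apply: cvgM; [exact: cvg_cst|exact: cf]. Qed.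

Lemma cID g h : ccont g -> ccont h -> cI (fun t => g t + h t) = cI g + cI h.
Proof.
move=> [g1 g2] [h1 h2]; rewrite /cI; under eq_fun do rewrite ReD.
under [X in Complex _ (lint X _ _)]eq_fun do rewrite ImD.
by rewrite !lintD_cont.
Qed.

Lemma cIZ k g : ccont g -> cI (fun t => k * g t) = k * cI g.
Proof.
move=> [g1 g2]; rewrite /cI; under eq_fun do rewrite ReM.
under [X in Complex _ (lint X _ _)]eq_fun do rewrite ImM.
rewrite lintB_cont ?lintD_cont ?lintZ_cont//; try exact: cZ.
by case: k.
Qed.

Lemma cI_sum (s : seq nat) (F : nat -> R -> R[i]) : (forall n, ccont (F n)) ->
  cI (fun t => \sum_(n <- s) F n t) = \sum_(n <- s) cI (F n).
Proof.
move=> h; elim: s => [|i s ih].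
  rewrite big_nil; under eq_fun do rewrite big_nil.
  by rewrite /cI !lint_cst//= mul0r.
rewrite big_cons -ih -cID//; last exact: ccont_sum.
by congr cI; apply/funext => t; rewrite big_cons.
Qed.

Lemma cI_cst k : cI (fun=> k) = ((2 * pi)%:C)%C * k.
Proof.
by rewrite /cI !lint_cst// !subr0; apply: complex_ext; rewrite !(ReM, ImM) /=; ring.
Qed.

Lemma lint_ge0 (f : R -> R) : (forall t, 0 <= f t) -> 0 <= lint f 0 (2 * pi).
Proof. by move=> h; apply: Rintegral_ge0 => t _; exact: h. Qed.

Lemma le_lint (f g : R -> R) : continuous f -> continuous g -> (forall t, 0 <= t <= 2 * pi -> f t <= g t) ->
  lint f 0 (2 * pi) <= lint g 0 (2 * pi).
Proof.
move=> cf cg h; by apply: le_Rintegral => //; exact: lint_int.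
Qed.

(** The two components are bounded separately, whence the factor 2, which is harmless in the limits
    where the bound is used. *)
Lemma cI_bound g : ccont g -> cabs (cI g) <= 2 * lint (fun t => cabs (g t)) 0 (2 * pi).
Proof.
move=> cg; have cc := ccont_cabs cg; have [g1 g2] := cg.
rewrite (le_trans (cabs_le_ReIm _))// mulrDl !mul1r lerD//.
- rewrite (le_trans (le_normr_Rintegral _ _))//; first exact: lint_int.
  apply: (@le_lint (fun t => `|complex.Re (g t)|)) => //; last by move=> t _; exact: Re_le_cabs.
  by move=> t; apply: cvg_norm; exact: g1.
- rewrite (le_trans (le_normr_Rintegral _ _))//; first exact: lint_int.
  apply: (@le_lint (fun t => `|complex.Im (g t)|)) => //; last by move=> t _; exact: Im_le_cabs.
  by move=> t; apply: cvg_norm; exact: g2.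
Qed.

Lemma cI_bound_cst g (m : R) : ccont g -> (forall t, 0 <= t <= 2 * pi -> cabs (g t) <= m) ->
  cabs (cI g) <= 4 * pi * m.
Proof.
move=> cg h; rewrite (le_trans (cI_bound cg))//.
rewrite (_ : 4 * pi * m = 2 * lint (fun=> m) 0 (2 * pi)); last first.
  by rewrite lint_cst// subr0; ring.
rewrite ler_wpM2l// le_lint//; first exact: ccont_cabs.
by move=> x; exact: cvg_cst.
Qed.

(** The contour integral of H(z) / (i z) over the circle of radius e^s. *)
Definition circ H s := cI (fun t => H (pol s t)).

Lemma cderiv_eps_cont H z : (exists d, cderiv_at H z d) -> ceps_cont H z.
Proof. by move=> [d hd] e e0; exact: (cderiv_continuous hd). Qed.

(* In logarithmic coordinates z = e^(s + i t) the mean of H over circles is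
   independent of s, by [goursat_rect] and periodicity in t. *)
Lemma circ_const H a b : a <= b ->
  (forall z, expR a <= cabs z <= expR b -> exists d, cderiv_at H z d) -> circ H a = circ H b.
Proof.
move=> ab hH.
have fr s t : a <= s <= b -> exists d, cfrechet (fun s t => H (pol s t)) s t d.
  move=> sab; have [|d hd] := hH (pol s t); first by rewrite cabs_pol !ler_expR.
  by exists (d * pol s t); exact: cfrechet_comp.
have cre s : a <= s <= b -> continuous (fun t => complex.Re (H (pol s t))).
  move=> sab t; have [d /cfrechet_Re hd] := fr s t sab; exact: (frechet_cvg_t hd).
have cim s : a <= s <= b -> continuous (fun t => complex.Im (H (pol s t))).
  move=> sab t; have [d /cfrechet_Im hd] := fr s t sab; exact: (frechet_cvg_t hd).
have wre t : {within `[a, b], continuous (fun s => complex.Re (H (pol s t)))}.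
  apply: continuous_in_subspaceT => s; rewrite inE/= in_itv/= => sab.
  have [d /cfrechet_Re/frechet_swap hd] := fr s t sab.
  exact: (frechet_cvg_t hd).
have wim t : {within `[a, b], continuous (fun s => complex.Im (H (pol s t)))}.
  apply: continuous_in_subspaceT => s; rewrite inE/= in_itv/= => sab.
  have [d /cfrechet_Im/frechet_swap hd] := fr s t sab.
  exact: (frechet_cvg_t hd).
(* The Cauchy-Riemann equation d/ds Re = d/dt Im. The sides t = 0 and t = 2 pi contribute equally,
   so the integrals of Re over the two circles agree. *)
have := @goursat_rect R (fun s t => complex.Im (H (pol s t))) (fun s t => complex.Re (H (pol s t)))
  a b 0 (2 * pi) ab pi2.
rewrite (_ : (fun s => complex.Im (H (pol s (2 * pi)))) = (fun s => complex.Im (H (pol s 0)))); last first.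
  by apply/funext => s; rewrite pol_periodic.
rewrite subrr.
have h1 s t : a <= s <= b -> 0 <= t <= 2 * pi -> exists l m n,
    frechet (fun s0 t0 => complex.Im (H (pol s0 t0))) s t n l /\
    frechet (fun s0 t0 => complex.Re (H (pol s0 t0))) s t l m.
  move=> /fr-/(_ t)[d hd] _; exists (complex.Re d), (- complex.Im d), (complex.Im d).
  by split; [exact: cfrechet_Im|exact: cfrechet_Re].
move=> /(_ (fun s sab => wcont (cre s sab)) (fun t _ => wim t) h1) /eqP.
rewrite subr_eq0 => /eqP e1.
(* The other Cauchy-Riemann equation, d/ds Im = - d/dt Re, for the imaginary part. *)
have := @goursat_rect R (fun s t => - complex.Re (H (pol s t))) (fun s t => complex.Im (H (pol s t)))
  a b 0 (2 * pi) ab pi2.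
rewrite (_ : (fun s => - complex.Re (H (pol s (2 * pi)))) = (fun s => - complex.Re (H (pol s 0)))); last first.
  by apply/funext => s; rewrite pol_periodic.
rewrite subrr.
have h2 s t : a <= s <= b -> 0 <= t <= 2 * pi -> exists l m n,
    frechet (fun s0 t0 => - complex.Re (H (pol s0 t0))) s t n l /\
    frechet (fun s0 t0 => complex.Im (H (pol s0 t0))) s t l m.
  move=> /fr-/(_ t)[d hd] _; exists (complex.Im d), (complex.Re d), (- complex.Re d).
  split; last exact: cfrechet_Im.
  by rewrite -[X in frechet _ _ _ _ X]opprK; apply: frechetN; exact: cfrechet_Re.
have wreN t : {within `[a, b], continuous (fun s => - complex.Re (H (pol s t)))}.
  by move=> x; apply: cvgN; exact: wre.
move=> /(_ (fun s sab => wcont (cim s sab)) (fun t _ => wreN t) h2) /eqP.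
rewrite subr_eq0 => /eqP e2.
by rewrite /circ /cI e1 e2.
Qed.

(** Pointwise continuity on the circle becomes uniform closeness of neighbouring circles by
    compactness of the segment of angles. *)
Lemma circ_cont H s rho : 0 < rho -> (forall r t, `|r - s| < rho -> ceps_cont H (pol r t)) ->
  forall e : R, 0 < e -> exists2 del : R, 0 < del &
    forall r, `|r - s| < del -> cabs (circ H r - circ H s) <= e.
Proof.
move=> rho0 hH e e0; have p0 := pi_gt0 R.
have e40 : 0 < e / (4 * pi) by rewrite divr_gt0// mulr_gt0.
pose P (r t : R) := cabs (H (pol r t) - H (pol s t)) <= e / (4 * pi).
have : \forall r \near s, forall t, [set` `[0, 2 * pi]] t -> P r t.
  have /compact_near_coveringP cov := @segment_compact R 0 (2 * pi).
  apply: (cov _ (nbhs s) P) => t _.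
  have e80 : 0 < e / (4 * pi) / 2 by rewrite divr_gt0.
  have [d d0 hd] := hH s t ltac:(by rewrite subrr normr0) _ e80.
  have [d' d'0 hd'] := pol_cont s t d0.
  near=> t' r.
  have r1 : `|r - s| < d' by rewrite distrC; near: r; exact: cvgr_dist_lt.
  have t1 : `|t' - t| < d' by rewrite distrC; near: t'; exact: cvgr_dist_lt.
  have q1 := hd _ (hd' _ _ r1 t1).
  have ss : `|s - s| < d' by rewrite subrr normr0.
  have q2 := hd _ (hd' _ _ ss t1).
  rewrite /P -(subrK (H (pol s t)) (H (pol r t'))) -addrA (le_trans (cabsD _ _))//.
  by rewrite [leRHS]splitr lerD// cabsB.
move=> /nbhs_ballP[d /= d0 hd].
exists (Num.min d rho); first by rewrite lt_min d0/=.
move=> r; rewrite lt_min => /andP[rd r1].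
have cr (q : R) : `|q - s| < rho -> ccont (fun t => H (pol q t)).
  move=> q1; apply: ccontP => x ee ee0.
  have [b b0 hb] := hH q x q1 _ ee0.
  have [d' d'0 hd'] := pol_cont q x b0.
  by exists d' => // y yx; apply: hb; apply: hd' => //; rewrite subrr normr0.
have c1 := cr _ r1; have c2 : ccont (fun t => H (pol s t)) by apply: cr; rewrite subrr normr0.
have -> : circ H r - circ H s = cI (fun t => H (pol r t) + -1 * H (pol s t)).
  rewrite cID//; last by apply: ccontM => //; exact: ccont_cst.
  by rewrite cIZ// mulN1r.
rewrite (le_trans (cI_bound_cst (m := e / (4 * pi)) _ _))//.
- by apply: ccontD => //; apply: ccontM => //; exact: ccont_cst.
- move=> t t01; rewrite mulN1r; apply: hd; last by rewrite in_itv.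
  by rewrite -ball_normE /ball_/= distrC.
- by rewrite mulrC divfK// mulf_neq0// gt_eqF.
Unshelve. all: by end_near. Qed.

Lemma circ_lim0 H : ceps_cont H 0 -> (forall s, s < 0 -> ccont (fun t => H (pol s t))) ->
  forall e : R, 0 < e -> exists2 S : R, S < 0 & forall s, s <= S -> cabs (circ H s - ((2 * pi)%:C)%C * H 0) <= e.
Proof.
move=> hH hc e e0; have p0 := pi_gt0 R.
have e40 : 0 < e / (4 * pi) by rewrite divr_gt0// mulr_gt0.
have [d d0 hd] := hH _ e40.
(* Below d, so that small circles stay where H is close to H(0), and below 1, so that ln d' is
   negative. *)
pose d' := Num.min d (1 / 2) / 2.
have m0 : 0 < Num.min d (1 / 2) by rewrite lt_min d0 divr_gt0.
have d'0 : 0 < d' by rewrite divr_gt0.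
have d'd : d' < d.
  by rewrite /d' (lt_le_trans (y := Num.min d (1 / 2)))// ?ge_min ?lexx// ltr_pdivrMr// ltr_pMr// ltr1n.
have d'1 : d' < 1.
  have mm : Num.min d (1 / 2) <= 1 / 2 by rewrite ge_min lexx orbT.
  by rewrite /d' ltr_pdivrMr// (le_lt_trans mm)//; lra.
exists (ln d'); first by rewrite ln_lt0// d'0.
move=> s sd.
have s0 : s < 0 by rewrite (le_lt_trans sd)// ln_lt0// d'0.
have ed : expR s < d.
  by rewrite (le_lt_trans _ d'd)// -[leRHS]lnK ?posrE// ler_expR.
have -> : circ H s - ((2 * pi)%:C)%C * H 0 = cI (fun t => H (pol s t) + (- H 0)).
  by rewrite cID ?cI_cst ?mulrN//; [exact: hc|exact: ccont_cst].
rewrite (le_trans (cI_bound_cst (m := e / (4 * pi)) _ _))//.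
- by apply: ccontD; [exact: hc|exact: ccont_cst].
- by move=> t _; apply: hd; rewrite subr0 cabs_pol.
- by rewrite mulrC divfK// mulf_neq0// gt_eqF.
Qed.

End CauchyTaylor.

(** * Mean value property and Taylor expansion *)

Section Taylor.
Variable R : realType.
Implicit Types (F G H f g : R[i] -> R[i]).

Lemma cabs_le_eps (x y : R[i]) : (forall e : R, 0 < e -> cabs (x - y) <= e) -> x = y.
Proof.
move=> h; apply/eqP; rewrite -subr_eq0 -cabs_eq0 eq_le cabs_ge0 andbT.
by apply/ler_addgt0Pl => e e0; rewrite addr0; exact: h.
Qed.

(** At w the function is only continuous: the intended H is a difference quotient centred at w.
    Circles inside |w| shrink to 0 by [circ_const] and [circ_lim0]; the circle through w is reached
    by continuity from smaller radii; larger circles are contracted to one just outside |w| and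
    compared by continuity again. *)
Lemma circ_mean_value H w s : (forall z, cdisc z -> ceps_cont H z) ->
  (forall z, cdisc z -> z != w -> exists d, cderiv_at H z d) -> cdisc w -> s < 0 ->
  circ H s = ((2 * pi)%:C)%C * H 0.
Proof.
move=> hc hd w1 s0.
have ev (r : R) : r < 0 -> expR r < 1 by rewrite -[X in _ -> _ < X]expR0 ltr_expR.
have disc_pol (r t : R) : r < 0 -> cdisc (pol r t) by move=> r0; have := ev r r0; rewrite -(cabs_pol r t).
have cc r : r < 0 -> ccont (fun t => H (pol r t)).
  by move=> r0; apply: ccont_comp => z zr; apply: hc; rewrite /cdisc /= zr; exact: ev.
have d0 : cdisc (0 : R[i]) by rewrite /cdisc/= cabs0.
have A r : r < 0 -> (expR r < cabs w \/ w = 0) -> circ H r = ((2 * pi)%:C)%C * H 0.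
  move=> r0 hw; apply: cabs_le_eps => e e0.
  have [S S0 hS] := circ_lim0 (hc _ d0) cc e0.
  pose r' := Num.min S r.
  rewrite -(@circ_const _ H r' r); first by apply: hS; rewrite ge_min lexx.
    by rewrite ge_min lexx orbT.
  move=> z /andP[z1 z2]; apply: hd; first by rewrite /cdisc/= (le_lt_trans z2)// ev.
  case: hw => [hw|->].
    by apply/eqP => zw; move: hw; rewrite -zw ltNge z2.
  by rewrite -cabs_gt0 (lt_le_trans _ z1)// expR_gt0.
have [w0|wn0] := eqVneq w 0; first by apply: A => //; right.
have aw : 0 < cabs w by rewrite cabs_gt0.
pose sw := ln (cabs w).
have esw : expR sw = cabs w by rewrite lnK.
have sw0 : sw < 0 by rewrite ln_lt0// aw.
have hcs : forall r t, `|r - sw| < - sw -> ceps_cont H (pol r t).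
  by move=> r t; rewrite ltr_norml => /andP[_ h]; apply: hc; apply: disc_pol; lra.
have nsw : 0 < - sw by rewrite oppr_gt0.
have cs := circ_cont nsw hcs.
have B : circ H sw = ((2 * pi)%:C)%C * H 0.
  apply: cabs_le_eps => e e0; have [del del0 hdel] := cs _ e0.
  rewrite -(A (sw - del / 2)).
  - rewrite cabsB; apply: hdel; rewrite addrAC subrr add0r normrN ger0_norm; last by lra.
    by lra.
  - by lra.
  - by left; rewrite -esw ltr_expR; lra.
have [ssw|sws] := leP s sw.
  move: ssw; rewrite le_eqVlt => /predU1P[->//|ssw].
  by apply: A => //; left; rewrite -esw ltr_expR.
rewrite -B; apply: cabs_le_eps => e e0; have [del del0 hdel] := cs _ e0.
pose r := Num.min s (sw + del / 2).
have swr : sw < r by rewrite lt_min sws/=; lra.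
have rs : r <= s by rewrite ge_min lexx.
have rd : r <= sw + del / 2 by rewrite ge_min lexx orbT.
rewrite -(@circ_const _ H r s)//.
  by apply: hdel; rewrite ger0_norm; lra.
move=> z /andP[z1 z2]; apply: hd; first by rewrite /cdisc/= (le_lt_trans z2)// ev.
by apply/eqP => zw; move: z1; rewrite zw -esw ler_expR leNgt swr.
Qed.

Lemma cderiv_at_near f g (z d : R[i]) (r : R) : 0 < r -> (forall x : R[i], cabs (x - z) < r -> g x = f x) ->
  cderiv_at f z d -> cderiv_at g z d.
Proof.
move=> r0 fg h e e0; have [del del0 hdel] := h e e0.
exists (Num.min del r); first by rewrite lt_min del0 r0.
move=> x; rewrite lt_min => /andP[xd xz]; rewrite !fg//; first exact: hdel.
by rewrite subrr cabs0.
Qed.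

Definition chol f (z : R[i]) := exists d, cderiv_at f z d.

Lemma cholM f g (z : R[i]) : chol f z -> chol g z -> chol (fun x => f x * g x) z.
Proof.
move=> /derivable_cderivP hf /derivable_cderivP hg; apply/derivable_cderivP.

exact: (@derivableM _ _ (f : R[i]^o -> R[i]^o) (g : R[i]^o -> R[i]^o) z 1 hf hg).
Qed.

Lemma cholB f g (z : R[i]) : chol f z -> chol g z -> chol (fun x => f x - g x) z.
Proof.
move=> /derivable_cderivP hf /derivable_cderivP hg; apply/derivable_cderivP.
exact: derivableB.
Qed.

Lemma cholV f (z : R[i]) : f z != 0 -> chol f z -> chol (fun x => (f x)^-1) z.
Proof.
move=> f0 /derivable_cderivP hf; apply/derivable_cderivP.
exact: derivableV.
Qed.

Lemma chol_cst (k z : R[i]) : chol (fun=> k) z.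
Proof. by apply/derivable_cderivP; exact: derivable_cst. Qed.

Lemma chol_id (z : R[i]) : chol (fun x => x) z.
Proof. by apply/derivable_cderivP; exact: derivable_id. Qed.

Lemma chol_expV (z : R[i]) n : z != 0 -> chol (fun x => (x ^+ n)^-1) z.
Proof.
move=> z0; elim: n => [|n ih]; first by under eq_fun do rewrite expr0; exact: chol_cst.
under eq_fun do rewrite exprS invfM.
by apply: cholM => //; apply: cholV => //; exact: chol_id.
Qed.

(** By homogeneity the integral at radius e^r is e^(-r n) times that at radius 1, and by
    [circ_const] the integrals at radii 1 and e agree; hence it vanishes, without trigonometric
    integrals. *)
Lemma circ_expV n s : (0 < n)%N -> circ (fun z => (z ^+ n)^-1 : R[i]) s = 0.
Proof.
move=> n0.
have polE (r t : R) : pol r t = ((expR r)%:C)%C * pol 0 t.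
  by rewrite /pol expR0; apply: complex_ext; rewrite !(ReM, ImM) /=; ring.
have cE r : circ (fun z => (z ^+ n)^-1 : R[i]) r =
    (((expR r)%:C)%C ^+ n)^-1 * circ (fun z => (z ^+ n)^-1) 0.
  rewrite /circ -cIZ; last first.
    have := @ccontX _ _ n (@ccont_polV R 0).
    by under eq_fun do rewrite exprVn.
  by congr cI; apply/funext => t; rewrite polE exprMn invfM.
have hd z : expR 0 <= cabs z <= expR 1 -> exists d, cderiv_at (fun z => (z ^+ n)^-1 : R[i]) z d.
  move=> /andP[z1 _]; apply: chol_expV.
  by rewrite -cabs_gt0 (lt_le_trans _ z1)// expR_gt0.
have e01 := circ_const ler01 hd.
have := cE 1; rewrite -e01 => /eqP; rewrite (cE s).
move: (circ _ 0) => X.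
rewrite eq_sym -subr_eq0 -[X in _ - X]mul1r -mulrBl mulf_eq0 subr_eq0 => /orP[|/eqP->]; last by rewrite mulr0.
move=> /eqP h; have : (expR (1 : R) ^+ n)^-1 = 1.
  rewrite -[RHS](@cabs1 R) -h; rewrite cabsV; congr GRing.inv.
  by rewrite cabsX cabs_real ger0_norm ?expR_ge0.
have e1 : 1 < expR (1 : R) ^+ n.
  have q1 : 1 < expR (1 : R) by rewrite expR_gt1.
  by rewrite expr_gt1 ?expR_ge0.
by move=> /eqP; rewrite invr_eq1 gt_eqF.
Qed.

Lemma geometric_kernel (z w : R[i]) N : z != 0 -> z != w ->
  z / (z - w) = \sum_(0 <= n < N) w ^+ n * (z ^+ n)^-1 + w ^+ N * (z ^+ N)^-1 * (z / (z - w)).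
Proof.
move=> z0 zw; have zw0 : z - w != 0 by rewrite subr_eq0.
elim: N => [|N ih]; first by rewrite big_geq// add0r !expr0 invr1 !mul1r.
rewrite {1}ih big_nat_recr//= -addrA; congr (_ + _).
by rewrite !exprS; field; rewrite z0 zw0 expf_neq0.
Qed.

(** For fixed w, the mean value property is applied to G(z) = z (f(z) - f(w)) / (z - w), which
    extends continuously to w and vanishes at 0. Expanding z / (z - w) as a finite geometric sum
    expresses f(w) by a Taylor polynomial up to an error of order (|w| / e^s)^N on a circle of
    radius e^s > |w|. *)
Theorem analytic_taylor f : analytic_in_disc f ->
  exists2 a : nat -> R[i], rad1 a & forall z, cdisc z -> f z = ps a z.
Proof.
move=> hf.
have fd z : cdisc z -> exists d, cderiv_at f z d by move=> /hf/derivable_cderivP.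
have ev (r : R) : r < 0 -> expR r < 1 by rewrite -[X in _ -> _ < X]expR0 ltr_expR.
have cf s : s < 0 -> ccont (fun t => f (pol s t)).
  move=> s0; apply: ccont_comp => z zr; apply: cderiv_eps_cont; apply: fd.
  by rewrite /cdisc/= zr ev.
have cV n s : ccont (fun t => ((pol s t : R[i]) ^+ n)^-1).
  have := @ccontX _ _ n (@ccont_polV R s).
  by under eq_fun do rewrite exprVn.
pose cn n s := circ (fun z => f z * (z ^+ n)^-1) s.
have p0 := pi_gt0 R.
have p20 : ((2 * pi)%:C)%C != 0 :> R[i].
  by apply/negP => /eqP/(congr1 (@complex.Re R))/=/eqP; rewrite gt_eqF// mulr_gt0.
have cnE n s s' : s < 0 -> s' < 0 -> cn n s = cn n s'.
  wlog ss : s s' / s <= s'.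
    by move=> hh s0 s'0; have [/hh->//|/ltW/hh->] := leP s s'.
  move=> s0 s'0; apply: circ_const => // z /andP[z1 z2].
  apply: cholM.
    by apply: fd; rewrite /cdisc/= (le_lt_trans z2) ?ev.
  by apply: chol_expV; rewrite -cabs_gt0 (lt_le_trans _ z1) ?expR_gt0.
(* The radius e^(-1) is an arbitrary choice; [cnE] replaces it by any other below 1. *)
pose a n : R[i] := (((2 * pi)%:C)%C)^-1 * cn n (-1).
have N10 : (-1 : R) < 0 by rewrite oppr_lt0.
have ha : rad1 a.
  apply: rad1_bounded => r /andP[r0 r1].
  have [s s0 rs] : exists2 s : R, s < 0 & r <= expR s.
    have q1 : 0 < (1 + r) / 2 < 1 by rewrite divr_gt0//=; lra.
    exists (ln ((1 + r) / 2)); first by rewrite ln_lt0.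
    by rewrite lnK ?posrE//; lra.
  exists ((2 * pi)^-1 * (2 * lint (fun t => cabs (f (pol s t))) 0 (2 * pi))) => n.
  rewrite /a cabsM cabsV cabs_real ger0_norm; last by rewrite mulr_ge0// ltW.
  rewrite -mulrA ler_wpM2l//; first by rewrite invr_ge0 mulr_ge0// ltW.
  rewrite (cnE n _ s)//.
  have := cI_bound (ccontM (cf s s0) (cV n s)).
  rewrite (_ : (fun t => cabs _) = fun t => ((expR s) ^+ n)^-1 * cabs (f (pol s t))); last first.
    by apply/funext => t; rewrite cabsM cabsV cabsX cabs_pol mulrC.
  rewrite lintZ_cont; last exact: ccont_cabs (cf s s0).
  move=> h; rewrite (le_trans (ler_wpM2r _ h)) ?exprn_ge0//.
  rewrite -mulrA ler_wpM2l// mulrAC -[leRHS]mul1r ler_wpM2r//.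
    by apply: lint_ge0 => t; exact: cabs_ge0.
  rewrite mulrC ler_pdivrMr ?exprn_gt0 ?expR_gt0// mul1r.
  by rewrite lerXn2r ?nnegrE ?expR_ge0.
exists a => // w w1.
have [d fwd] := fd w w1.
pose G z := if z == w then w * d else z * ((f z - f w) / (z - w)).
have Gd z : cdisc z -> z != w -> exists d, cderiv_at G z d.
  move=> z1 zw.
  have [d' hd'] : chol (fun x => x * ((f x - f w) * (x - w)^-1)) z.
    apply: cholM; first exact: chol_id.
    apply: cholM; first by apply: cholB; [exact: fd|exact: chol_cst].
    by apply: cholV; [rewrite subr_eq0|apply: cholB; [exact: chol_id|exact: chol_cst]].
  exists d'.
  apply: (@cderiv_at_near _ _ _ _ (cabs (z - w)) _ _ hd'); first by rewrite cabs_gt0 subr_eq0.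
  move=> x xz; rewrite /G; case: eqP => // xw.
  by move: xz; rewrite xw cabsB ltxx.
have Gc z : cdisc z -> ceps_cont G z.
  move=> z1; have [->|zw] := eqVneq z w; last by apply: cderiv_eps_cont; exact: Gd.
  move=> e e0; have e20 : 0 < e / 2 by rewrite divr_gt0.
  have [del del0 hdel] := fwd _ e20.
  have dd0 : 0 < 1 + cabs d by rewrite ltr_pwDl// cabs_ge0.
  exists (Num.min del (Num.min (1 - cabs w) (e / 2 / (1 + cabs d)))).
    by rewrite !lt_min del0 subr_gt0 w1/= divr_gt0.
  move=> x; rewrite !lt_min => /and3P[x1 x2 x3].
  have xx1 : cabs x <= 1.
    by rewrite -(subrK w x) (le_trans (cabsD _ _))// -lerBrDr ltW.
  have [->|xw] := eqVneq x w; first by rewrite subrr cabs0 ltW.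
  rewrite /G eqxx (negbTE xw).
  have xw0 : x - w != 0 by rewrite subr_eq0.
  rewrite (_ : _ - _ = x * ((f x - f w - d * (x - w)) / (x - w)) + (x - w) * d); last by field.
  rewrite (le_trans (cabsD _ _))// [e]splitr lerD//.
    rewrite cabsM -[leRHS]mul1r ler_pM ?cabs_ge0// cabsM cabsV ler_pdivrMr ?cabs_gt0//.
    exact: hdel.
  rewrite cabsM mulrC; rewrite ltr_pdivlMr// in x3; rewrite (le_trans _ (ltW x3))// mulrC.
  by rewrite ler_wpM2l ?cabs_ge0// lerDr.
have [s s0 ws] : exists2 s : R, s < 0 & cabs w < expR s.
  have w0 := cabs_ge0 w.
  have q1 : 0 < (1 + cabs w) / 2 < 1 by move: w1; rewrite /cdisc/= => w1; rewrite divr_gt0//=; lra.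
  exists (ln ((1 + cabs w) / 2)); first by rewrite ln_lt0.
  by move: w1; rewrite /cdisc/= => w1; rewrite lnK ?posrE//; lra.
(* G(0) = 0 in both branches of G: if w = 0, the first branch gives w d = 0. *)
have G0 : circ G s = 0.
  rewrite (circ_mean_value Gc Gd w1 s0) /G.
  by case: eqP => [<-|_]; rewrite mul0r mulr0.
have cG : ccont (fun t => G (pol s t)).
  by apply: ccont_comp => z zr; apply: Gc; rewrite /cdisc/= zr; exact: ev.
(* N = 0 is set apart because the term n = 0 of the geometric sum is the one that produces f(w); the
   others vanish by [circ_expV], which needs n > 0. *)
have key N : ((2 * pi)%:C)%C * f w - \sum_(0 <= n < N) cn n s * w ^+ n =
    w ^+ N * cI (fun t => ((pol s t) ^+ N)^-1 * G (pol s t)) \/ N = 0%N.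
  case: N => [|N]; [by right|left].
  have e1 : (fun t => G (pol s t)) = fun t =>
      (\sum_(0 <= n < N.+1) w ^+ n * (f (pol s t) * (pol s t ^+ n)^-1)) +
      ((- f w) * (\sum_(0 <= n < N.+1) w ^+ n * (pol s t ^+ n)^-1) +
      w ^+ N.+1 * ((pol s t ^+ N.+1)^-1 * G (pol s t))).
    apply/funext => t; have zw : pol s t != w.
      by apply/eqP => h; move: ws; rewrite -h cabs_pol ltxx.
    have z0 : pol s t != 0 by exact: pol_neq0.
    rewrite /G (negbTE zw); set z := pol s t.
    rewrite (_ : z * ((f z - f w) / (z - w)) = (f z - f w) * (z / (z - w))); last by ring.
    rewrite {1}(geometric_kernel N.+1 z0 zw).
    rewrite -/z (_ : \sum_(0 <= n < N.+1) w ^+ n * (f z / z ^+ n) =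
      f z * \sum_(0 <= n < N.+1) w ^+ n / z ^+ n); last first.
      by rewrite mulr_sumr; apply: eq_bigr => n _; rewrite mulrCA.
    by ring.
  have c1 n : ccont (fun t => w ^+ n * (f (pol s t) * (pol s t ^+ n)^-1)).
    by apply: ccontM; [exact: ccont_cst|apply: ccontM; [exact: cf|exact: cV]].
  have c2 n : ccont (fun t => w ^+ n * (pol s t ^+ n)^-1).
    by apply: ccontM; [exact: ccont_cst|exact: cV].
  have c3 : ccont (fun t => (pol s t ^+ N.+1)^-1 * G (pol s t)).
    by apply: ccontM => //; exact: cV.
  have c4 : ccont (fun t => w ^+ N.+1 * ((pol s t ^+ N.+1)^-1 * G (pol s t))).
    by apply: ccontM => //; exact: ccont_cst.
  have c5 : ccont (fun t => (- f w) * (\sum_(0 <= n < N.+1) w ^+ n * (pol s t ^+ n)^-1)).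
    by apply: ccontM; [exact: ccont_cst|exact: ccont_sum].
  move: G0; rewrite /circ e1 cID; [|exact: ccont_sum|exact: ccontD].
  rewrite cID// !cIZ//; last exact: ccont_sum.
  rewrite !cI_sum// [X in (- f w) * X]big_nat_recl//=.
  rewrite [X in (- f w) * (_ + X)]big1 ?addr0; last first.
    move=> n _; rewrite cIZ; last exact: cV.
    by rewrite -[cI _]/(circ (fun z => (z ^+ n.+1)^-1 : R[i]) s) circ_expV// mulr0.
  rewrite (_ : (fun t => w ^+ 0 * _) = fun=> 1); last first.
    by apply/funext => t; rewrite !expr0 invr1 mulr1.
  rewrite cI_cst mulr1 => h.
  have -> : \sum_(0 <= n < N.+1) cn n s * w ^+ n =
      \sum_(0 <= i < N.+1) cI (fun t => w ^+ i * (f (pol s t) * (pol s t ^+ i)^-1)).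
    apply: eq_bigr => n _; rewrite cIZ; last by apply: ccontM; [exact: cf|exact: cV].
    by rewrite mulrC.
  move: h; set S := \sum_(0 <= i < _) _; set I := cI _ => h.
  apply/eqP; rewrite -subr_eq0 -oppr_eq0; apply/eqP; rewrite -[RHS]h; ring.
pose K := 2 * lint (fun t => cabs (G (pol s t))) 0 (2 * pi).
pose q := cabs w / expR s.
have q1 : `|q| < 1.
  by rewrite ger0_norm ?divr_ge0 ?cabs_ge0 ?expR_ge0// ltr_pdivrMr ?expR_gt0// mul1r.
apply/esym/cser_unique; first exact: rad1_summable.
apply/ccvgP.
have hb : (fun N => (2 * pi)^-1 * (K * q ^+ N.+1)) @ \oo --> (0 : R).
  rewrite -[X in _ --> X](mulr0 ((2 * pi)^-1 : R)); apply: cvgM; first exact: cvg_cst.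
  rewrite -[X in _ --> X](mulr0 K); apply: cvgM; first exact: cvg_cst.
  by rewrite (cvg_shiftS (fun n => q ^+ n)); exact: cvg_expr.
rewrite -(cvg_shiftS (fun N => cabs (csums (fun n => a n * w ^+ n) N - f w))).
apply: (@squeeze_cvgr _ _ _ _ (fun=> 0) _ _ _ _ _ hb); last exact: cvg_cst.
apply: nearW => N; rewrite cabs_ge0/=.
have [h|//] := key N.+1.
have -> : csums (fun n => a n * w ^+ n) N.+1 - f w =
   - ((((2 * pi)%:C)%C)^-1 * (((2 * pi)%:C)%C * f w - \sum_(0 <= n < N.+1) cn n s * w ^+ n)).
  rewrite mulrBr mulrA mulVf// mul1r opprB mulr_sumr; congr (_ - _).
  by apply: eq_bigr => n _; rewrite /a mulrA (cnE n _ s).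
rewrite cabsN cabsM cabsV cabs_real ger0_norm; last by rewrite mulr_ge0// ltW.
rewrite ler_wpM2l//; first by rewrite invr_ge0 mulr_ge0// ltW.
rewrite h cabsM cabsX /q expr_div_n [leRHS]mulrCA ler_wpM2l ?exprn_ge0 ?cabs_ge0//.
have := cI_bound (ccontM (cV N.+1 s) cG).
rewrite (_ : (fun t => cabs _) = fun t => ((expR s) ^+ N.+1)^-1 * cabs (G (pol s t))); last first.
  by apply/funext => t; rewrite cabsM cabsV cabsX cabs_pol.
rewrite lintZ_cont; last exact: ccont_cabs.
by rewrite mulrCA mulrC.
Qed.

End Taylor.

(** * Rotation invariance and polar coordinates *)

Section PlaneLebesgue.
Variable R : realType.
Local Open Scope ereal_scope.
Local Notation leb := (@lebesgue_measure R).
Local Notation leb2 := (@leb2 R).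

Lemma measurable_affine (a b : R) : measurable_fun [set: measurableTypeR R] (fun x : measurableTypeR R => (a * x + b)%R : measurableTypeR R).
Proof. by apply: measurable_funD => //; exact: measurable_funM. Qed.

(** Lebesgue measure is determined by its values on intervals, so the rescaled pushforward has to be
    computed only there. *)
Lemma lebesgue_affine (a b : R) (A : set (measurableTypeR R)) : (0 < a)%R -> measurable A ->
  leb A = a%:E * pushforward leb (fun x : measurableTypeR R => (a * x + b)%R : measurableTypeR R) A.
Proof.
move=> a0 mA.
pose f := (fun x : measurableTypeR R => (a * x + b)%R : measurableTypeR R).
have mf : measurable_fun [set: measurableTypeR R] f by exact: measurable_affine.
pose m : {measure set (measurableTypeR R) -> \bar R} := mscale (NngNum (ltW a0)) (pushforward leb f).
have -> : a%:E * pushforward leb f A = m mf A by [].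
apply: lebesgue_measure_unique => // _ [[u v]] _ <-.
rewrite /m /= /mscale /= /pushforward.
rewrite (_ : f @^-1` _ = `](u - b) / a, (v - b) / a]%classic)%R; last first.
  apply/seteqP; split => x /=; rewrite !in_itv/= ltr_pdivrMr// ler_pdivlMr// ltrBlDr lerBrDr;
    by rewrite ![(x * a)%R]mulrC.
rewrite !lebesgue_measure_itv/= !lte_fin ltr_pM2r ?invr_gt0// ltrD2r.
case: ifPn => _; last by rewrite mule0.
by rewrite -!EFinD -EFinM; congr EFin; field; rewrite gt_eqF.
Qed.

Lemma integral_affine (a b : R) (F : R -> \bar R) : (0 < a)%R ->
  measurable_fun [set: R] F -> (forall x, 0 <= F x) ->
  \int[leb]_x F x = a%:E * \int[leb]_x F (a * x + b)%R.
Proof.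
move=> a0 mF F0.
pose f := (fun x : measurableTypeR R => (a * x + b)%R : measurableTypeR R).
have mf : measurable_fun [set: measurableTypeR R] f by exact: measurable_affine.
pose m : {measure set (measurableTypeR R) -> \bar R} := mscale (NngNum (ltW a0)) (pushforward leb f).
have := @ge0_integral_pushforward _ _ (measurableTypeR R) (measurableTypeR R) R f mf leb setT F measurableT mF (fun y _ => F0 y).
rewrite preimage_setT => <-.
transitivity (\int[m mf]_x F x).
  by apply: eq_measure_integral => A mA _; exact: lebesgue_affine.
by rewrite ge0_integral_mscale.
Qed.

(** On each horizontal line a shear is a translation, so Fubini reduces the claim to
    [integral_affine] with slope 1. *)
Lemma integral_shear1 (t : R) (F : R * R -> \bar R) :
  measurable_fun [set: R * R] F -> (forall q, 0 <= F q) ->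
  \int[leb2]_q F (q.1 + t * q.2, q.2)%R = \int[leb2]_q F q.
Proof.
move=> mF F0.
have ms : measurable_fun [set: R * R] (fun q : R * R => (q.1 + t * q.2, q.2)%R).
  apply: measurable_fun_pair => //=; apply: measurable_funD => //; exact: measurable_funM.
have mFs : measurable_fun [set: R * R] (fun q => F (q.1 + t * q.2, q.2)%R).
  exact: (measurableT_comp mF ms).
rewrite /leb2 !fubini_tonelli1// !fubini_tonelli//.
apply: eq_integral => y _; rewrite /fubini_G/=.
have := @integral_affine 1 (t * y) (fun x => F (x, y)) ltr01.
rewrite mul1e => -> //.
  by apply: eq_integral => x _; rewrite mul1r.
exact: measurableT_comp mF _.
Qed.

Lemma integral_shear2 (t : R) (F : R * R -> \bar R) :
  measurable_fun [set: R * R] F -> (forall q, 0 <= F q) ->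
  \int[leb2]_q F (q.1, q.2 + t * q.1)%R = \int[leb2]_q F q.
Proof.
move=> mF F0.
have ms : measurable_fun [set: R * R] (fun q : R * R => (q.1, q.2 + t * q.1)%R).
  apply: measurable_fun_pair => //=; apply: measurable_funD => //; exact: measurable_funM.
have mFs : measurable_fun [set: R * R] (fun q => F (q.1, q.2 + t * q.1)%R).
  exact: (measurableT_comp mF ms).
rewrite /leb2 !fubini_tonelli1//.
apply: eq_integral => x _; rewrite /fubini_F/=.
have := @integral_affine 1 (t * x) (fun y => F (x, y)) ltr01.
rewrite mul1e => -> //.
  by apply: eq_integral => y _; rewrite mul1r.
exact: measurableT_comp mF _.
Qed.

Lemma integral_scale (k : R) (F : R * R -> \bar R) : (0 < k)%R ->
  measurable_fun [set: R * R] F -> (forall q, 0 <= F q) ->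
  \int[leb2]_q F q = (k ^+ 2)%:E * \int[leb2]_q F (k * q.1, k * q.2)%R.
Proof.
move=> k0 mF F0.
have ms : measurable_fun [set: R * R] (fun q : R * R => (k * q.1, k * q.2)%R).
  by apply: measurable_fun_pair => //=; exact: measurable_funM.
have mFs : measurable_fun [set: R * R] (fun q => F (k * q.1, k * q.2)%R).
  exact: (measurableT_comp mF ms).
have ms1 : measurable_fun [set: R * R] (fun q : R * R => (k * q.1, q.2)%R).
  by apply: measurable_fun_pair => //=; exact: measurable_funM.
have mFs1 : measurable_fun [set: R * R] (fun q => F (k * q.1, q.2)%R).
  exact: (measurableT_comp mF ms1).
transitivity (k%:E * \int[leb2]_q F (k * q.1, q.2)%R).
  rewrite /leb2 !fubini_tonelli1//; rewrite (@integral_affine k 0 _ k0); last 2 first.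
    exact: measurable_fun_fubini_tonelli_F.
    by move=> x; exact: integral_ge0.
  by congr (_ * _); apply: eq_integral => x _; rewrite addr0.
rewrite expr2 EFinM -muleA; congr (_ * _).
rewrite /leb2 !fubini_tonelli1// -ge0_integralZl ?lee_fin ?ltW//; last 2 first.
  exact: measurable_fun_fubini_tonelli_F.
  by move=> x _; exact: integral_ge0.
apply: eq_integral => x _; rewrite /fubini_F/=.
rewrite (@integral_affine k 0 (fun y => F (k * x, y)%R) k0)//.
  by congr (_ * _); apply: eq_integral => y _; rewrite addr0.
exact: measurableT_comp mF _.
Qed.

Definition rot (c : R[i]) (q : R * R) : R * R :=
  (complex.Re c * q.1 - complex.Im c * q.2, complex.Im c * q.1 + complex.Re c * q.2)%R.

Lemma cplx_rot c q : cplx (rot c q) = (c * cplx q)%R.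
Proof. by case: c => a b; apply: complex_ext; rewrite ?ReM ?ImM //= addrC. Qed.

Lemma measurable_rot c : measurable_fun [set: R * R] (rot c).
Proof.
apply: measurable_fun_pair => /=.
- by apply: measurable_funB; exact: measurable_funM.
- by apply: measurable_funD; exact: measurable_funM.
Qed.

(* A rotation is a product of three shears, unless its angle is pi. *)
Lemma integral_rot_half (c : R[i]) (F : R * R -> \bar R) : cabs c = 1%R -> (1 + complex.Re c != 0)%R ->
  measurable_fun [set: R * R] F -> (forall q, 0 <= F q) ->
  \int[leb2]_q F (rot c q) = \int[leb2]_q F q.
Proof.
case: c => a b; move=> c1 /= a1 mF F0.
have ab : (a ^+ 2 + b ^+ 2 = 1)%R by have := cabs_sqr (Complex a b); rewrite c1 expr1n.
pose t := (- b / (1 + a))%R.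
have ms1 : measurable_fun [set: R * R] (fun q : R * R => (q.1 + t * q.2, q.2)%R).
  by apply: measurable_fun_pair => //=; apply: measurable_funD => //; exact: measurable_funM.
have ms2 : measurable_fun [set: R * R] (fun q : R * R => (q.1, q.2 + b * q.1)%R).
  by apply: measurable_fun_pair => //=; apply: measurable_funD => //; exact: measurable_funM.
have m1 := measurableT_comp mF ms1; have m2 := measurableT_comp m1 ms2.
rewrite -(integral_shear1 t mF F0) -(integral_shear2 b m1 (fun q => F0 _)).
rewrite -(integral_shear1 t m2 (fun q => F0 _)).
apply: eq_integral => -[x y] _ /=; congr F; rewrite /rot/= /t.
have b2 : (b ^+ 2 = (1 - a) * (1 + a))%R.
  by apply/eqP; rewrite -subr_eq0; apply/eqP; rewrite -(subrr 1)%R -{3}ab; ring.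
congr pair; last first.
  rewrite (_ : y + b * _ = b * x + (1 - b ^+ 2 / (1 + a)) * y)%R; last by ring.
  by rewrite b2; field.
have -> : (x + - b / (1 + a) * y + - b / (1 + a) * (y + b * (x + - b / (1 + a) * y)) =
  (1 - b ^+ 2 / (1 + a)) * x - b / (1 + a) * (2 - b ^+ 2 / (1 + a)) * y)%R by ring.
by rewrite b2; field.
Qed.

(** The rotation by pi, excluded from [integral_rot_half], is the square of the quarter turn. *)
Lemma integral_rot (c : R[i]) (F : R * R -> \bar R) : cabs c = 1%R ->
  measurable_fun [set: R * R] F -> (forall q, 0 <= F q) ->
  \int[leb2]_q F (rot c q) = \int[leb2]_q F q.
Proof.
move=> c1 mF F0.
have [a1|a1] := eqVneq (1 + complex.Re c)%R 0%R; last exact: (integral_rot_half c1 a1 mF F0).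
have ci : cabs (Complex 0%R 1%R : R[i]) = 1%R by rewrite /cabs/= expr0n/= add0r expr1n sqrtr1.
have ni : (1 + complex.Re (Complex 0%R 1%R : R[i]) != 0)%R by rewrite /= addr0 oner_eq0.
have mi := measurableT_comp mF (measurable_rot (Complex 0%R 1%R)).
rewrite -(integral_rot_half ci ni mF F0) -(integral_rot_half ci ni mi (fun q => F0 _)).
apply: eq_integral => -[x y] _ /=; congr F; rewrite /rot/=.
have rc : complex.Re c = (-1)%R by apply/eqP; rewrite -subr_eq0 opprK addrC a1.
have ic : complex.Im c = 0%R.
  apply/eqP; rewrite -sqrf_eq0; have := cabs_sqr c; rewrite c1 rc sqrrN !expr1n.
  by move=> /eqP; rewrite -subr_eq0 opprD addrA subrr add0r oppr_eq0.
by rewrite rc ic; congr pair; ring.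
Qed.

Local Notation D := (@disc R).

Lemma measurable_cplx_cabs : measurable_fun [set: R * R] (@rad R).
Proof.
rewrite /rad /cabs /=; apply: measurableT_comp; last first.
  by apply: measurable_funD; apply: (@measurable_funX _ _ _ _ _ 2).
by apply: continuous_measurable_fun; exact: sqrt_continuous.
Qed.

Lemma measurable_disc : measurable D.
Proof.
rewrite (_ : D = @rad R @^-1` `]-oo, 1%R[%classic); last first.
  by apply/seteqP; split => q; rewrite /= in_itv.
by rewrite -[X in measurable X]setTI; apply: measurable_cplx_cabs.
Qed.

Lemma rot_disc c q : cabs c = 1%R -> disc (rot c q) = disc q.
Proof. by move=> c1; rewrite /disc/= cplx_rot cabsM c1 mul1r. Qed.

Lemma rad_rot c q : cabs c = 1%R -> rad (rot c q) = rad q.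
Proof. by move=> c1; rewrite /rad cplx_rot cabsM c1 mul1r. Qed.

Lemma integral_disc_rot (c : R[i]) (F : R * R -> \bar R) : cabs c = 1%R ->
  measurable_fun D F -> (forall q, D q -> 0 <= F q) ->
  \int[leb2]_(q in D) F (rot c q) = \int[leb2]_(q in D) F q.
Proof.
move=> c1 mF F0; rewrite [LHS]integral_mkcond [RHS]integral_mkcond.
have h := (measurable_restrictT F measurable_disc).1 mF.
have h0 q : 0 <= (F \_ D) q.
  by rewrite patchE; case: ifPn => // /[!inE]; exact: F0.
rewrite -(integral_rot c1 h h0).
apply: eq_integral => q _; rewrite !patchE.
by have -> : (rot c q \in D) = (q \in D) by apply/idP/idP; rewrite !inE rot_disc.
Qed.

End PlaneLebesgue.

(** * Distributions of functions on the plane *)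

Section PushRestr.
Local Open Scope ereal_scope.
Context (R : realType) d (T : measurableType d) (mu : {measure set T -> \bar R}).
Variables (E : set T) (mE : measurable E) (phi : T -> measurableTypeR R) (mphi : measurable_fun setT phi).

(** The distribution of [phi] on E as a measure on the line. Equality of two such measures on rays
    gives equality of all integrals of radial type. *)
Definition push_restr : {measure set (measurableTypeR R) -> \bar R} :=
  measure_function_pushforward__canonical__measure_function_Measure (mrestr mu mE) mphi.

Lemma integral_push_restr (h : measurableTypeR R -> \bar R) : measurable_fun setT h -> (forall r, 0 <= h r) ->
  \int[push_restr]_r h r = \int[mu]_(q in E) h (phi q).
Proof.
move=> mh h0.
have mhphi : measurable_fun setT (fun q => h (phi q)) by exact: measurableT_comp mh mphi.
transitivity (\int[mrestr mu mE]_q h (phi q)).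
  by rewrite ge0_integral_pushforward// preimage_setT.
rewrite -(setvU E) ge0_integral_setU//; last 3 first.
- exact: measurableC.
- by rewrite setvU.
- by apply/disj_set2P; rewrite setICl.
rewrite [X in X + _](_ : _ = 0) ?add0e; last first.
  apply: null_set_integral; [exact: measurableC|exact: measurable_funTS|].
  by rewrite /= /mrestr setICl measure0.
by apply: eq_measure_integral => A mA AE; rewrite /= /mrestr setIidl.
Qed.

End PushRestr.

(** Open left rays are stable under intersection, generate the Borel sets and exhaust the line, so
    uniqueness of measures on a pi-system applies. *)
Lemma measure_unique_rays (R : realType) (m1 m2 : {measure set (measurableTypeR R) -> \bar R}) :
  (forall x : R, m1 `]-oo, x[%classic = m2 `]-oo, x[%classic) ->
  (forall x : R, (m1 `]-oo, x[%classic < +oo)%E) ->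
  forall A, measurable A -> m1 A = m2 A.
Proof.
move=> m12 moo A mA; apply: (@measure_unique _ R (measurableTypeR R) (@RGenInftyO.G R) (fun n => `]-oo, n%:R[%classic)) => //.
- exact: RGenInftyO.measurableE.
- move=> _ _ [x ->] [y ->]; exists (Num.min x y).
  by apply/seteqP; split => z /=; rewrite !in_itv/= lt_min => /andP.
- by move=> n; exists n%:R.
- apply/seteqP; split => // x _; exists (Num.truncn x).+1 => //=.
  by rewrite in_itv/= truncnS_gt.
- by move=> _ [x ->].
Qed.

(** * Polar coordinates for radial functions *)

Section PolarIntegral.
Variable R : realType.
Local Open Scope ereal_scope.
Local Notation leb := (@lebesgue_measure R).
Local Notation leb2 := (@leb2 R).
Local Notation D := (@disc R).

Lemma leb2_scale (k : R) (A : set (R * R)) : (0 < k)%R -> measurable A ->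
  leb2 A = (k ^+ 2)%:E * leb2 [set q | A (k * q.1, k * q.2)%R].
Proof.
move=> k0 mA.
have ms : measurable_fun [set: R * R] (fun q : R * R => (k * q.1, k * q.2)%R).
  by apply: measurable_fun_pair => //=; exact: measurable_funM.
have mB : measurable [set q : R * R | A (k * q.1, k * q.2)%R].
  by rewrite -[X in measurable X]setTI; exact: (ms measurableT _ mA).
transitivity (\int[leb2]_q (\1_A q)%:E).
  by rewrite integral_indic// setIT.
rewrite (integral_scale k0); [|exact/measurable_EFinP/measurable_indic|by move=> q; rewrite lee_fin].
congr (_ * _); transitivity (\int[leb2]_q (\1_[set q : R * R | A (k * q.1, k * q.2)%R] q)%:E).
  by apply: eq_integral => q _; rewrite !indicE; congr (_%:R%:E); apply/idP/idP; rewrite !inE.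
by rewrite integral_indic// setIT.
Qed.

(** A cone whose vertical slice at abscissa r has length r: Fubini on it produces the density r dr
    with no trigonometric change of variables. *)
Definition triangle : set (R * R) := [set q | (0 <= q.1 < 1)%R /\ (0 <= q.2 < q.1)%R].

Lemma measurable_triangle : measurable triangle.
Proof.
rewrite (_ : triangle = ((fun q : R * R => q.1) @^-1` `[0%R, 1%R[) `&`
   (((fun q : R * R => q.2) @^-1` `[0%R, +oo[) `&` ((fun q : R * R => q.2 - q.1)%R @^-1` `]-oo, 0%R[))); last first.
  apply/seteqP; split => q; rewrite /triangle /= !in_itv/= ?andbT subr_lt0.
    by move=> [-> /andP[-> ->]].
  by move=> [-> [-> ->]].
apply: measurableI; [|apply: measurableI]; rewrite -[X in measurable X]setTI.
- exact: (@measurable_fst _ _ R R).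
- exact: (@measurable_snd _ _ R R).
- by apply: measurable_funB => //.
Qed.

Lemma leb2_rect (a b c d : R) : (a < b)%R -> (c < d)%R ->
  leb2 (`[a, b] `*` `[c, d]) = ((b - a) * (d - c))%:E.
Proof.
move=> ab cd; have l (u v : R) : (u < v)%R -> leb `[u, v] = (v - u)%:E.
  by move=> uv; rewrite lebesgue_measure_itv/= lte_fin uv.
transitivity (leb `[a, b] * leb `[c, d]); first exact: product_measure1E.
by rewrite !l// -EFinM.
Qed.


Lemma le_leb2 (A B : set (R * R)) : measurable A -> measurable B -> A `<=` B -> leb2 A <= leb2 B.
Proof. by move=> mA mB AB; apply: le_measure; rewrite ?inE. Qed.

Lemma leb2_disc : 0 < leb2 D < +oo.
Proof.
apply/andP; split.
- apply: (@lt_le_trans _ _ (leb2 (`[0, 3^-1] `*` `[0, 3^-1])%R)).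
    by rewrite leb2_rect ?invr_gt0// lte_fin subr0 mulr_gt0 ?invr_gt0.
  apply: le_leb2; [exact: measurableX|exact: measurable_disc|].
  move=> [x y] []/=; rewrite !in_itv/= => /andP[x0 x1] /andP[y0 y1].
  rewrite /disc/= (le_lt_trans (cabs_le_ReIm _))//= !ger0_norm//.
  by clear -x1 y1; lra.
- apply: (@le_lt_trans _ _ (leb2 (`[-1, 1] `*` `[-1, 1])%R)).
    apply: le_leb2; [exact: measurable_disc|exact: measurableX|].
    move=> [x y]; rewrite /disc /= => xy1; rewrite !in_itv/= -!ler_norml.
    have := Re_le_cabs (cplx (x, y)); have := Im_le_cabs (cplx (x, y)) => /= h1 h2.
    by rewrite !(le_trans _ (ltW xy1)).
  by rewrite leb2_rect ?ltry//; lra.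
Qed.

Lemma leb2_triangle : 0 < leb2 triangle < +oo.
Proof.
apply/andP; split.
- apply: (@lt_le_trans _ _ (leb2 (`[2^-1, 2^-1 + 3^-1] `*` `[0, 3^-1])%R)).
    by rewrite leb2_rect ?ltrDl ?invr_gt0// lte_fin subr0 addrAC subrr add0r mulr_gt0 ?invr_gt0.
  apply: le_leb2; [exact: measurableX|exact: measurable_triangle|].
  move=> [x y] []/=; rewrite !in_itv/= => /andP[x0 x1] /andP[y0 y1].
  by rewrite /triangle/=; clear -x0 x1 y0 y1; split; lra.
- apply: (@le_lt_trans _ _ (leb2 (`[0, 1] `*` `[0, 1])%R)).
    apply: le_leb2; [exact: measurable_triangle|exact: measurableX|].
    move=> [x y]; rewrite /triangle /= => -[/andP[x0 x1] /andP[y0 yx]]; rewrite !in_itv/=.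
    by clear -x0 x1 y0 yx; split; lra.
  by rewrite leb2_rect ?ltry//; lra.
Qed.

(* The disc with [rad] and the triangle with the first coordinate are both cones on
   which [phi < x] scales to measure [x ^ 2]; hence integrals of [h \o phi] over the
   two are proportional, and Fubini computes them on the triangle. *)
Definition conical (phi : R * R -> R) (E : set (R * R)) :=
  [/\ measurable E, measurable_fun setT phi, leb2 E < +oo,
     (forall q, E q -> (0 <= phi q < 1)%R) &
     (forall (x : R) q, (0 < x <= 1)%R ->
        (E (x * q.1, x * q.2)%R /\ (phi (x * q.1, x * q.2) < x)%R) <-> E q)].

Lemma conical_disc : conical (@rad R) D.
Proof.
split; [exact: measurable_disc|exact: measurable_cplx_cabs|by case/andP: leb2_disc| |].
- by move=> q; rewrite /disc/= => q1; rewrite cabs_ge0.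
- move=> x q /andP[x0 x1].
  have xq : cabs (cplx (x * q.1, x * q.2)%R) = (x * cabs (cplx q))%R.
    rewrite -[x in RHS](ger0_norm (ltW x0)) -cabs_real -cabsM; congr cabs.
    by apply: complex_ext; rewrite ?ReM ?ImM/=; ring.
  rewrite /disc/= /rad xq; split=> [[_]|q1]; first by rewrite gtr_pMr.
  have q0 := cabs_ge0 (cplx q).
  have h : (x * cabs (cplx q) < x)%R by rewrite gtr_pMr.
  by split => //; exact: lt_le_trans h x1.
Qed.

Lemma conical_triangle : conical (fun q => q.1) triangle.
Proof.
split; [exact: measurable_triangle|exact: (@measurable_fst _ _ R R)|by case/andP: leb2_triangle|by move=> q []|].
move=> x q /andP[x0 x1]; rewrite /triangle/= ltr_pM2l// !pmulr_rge0// gtr_pMr//.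
split=> [[[/andP[-> _] ->] ->]//|[/andP[-> q1] ->]].
rewrite q1; split=> //; split=> //=.
by apply: lt_le_trans x1; rewrite gtr_pMr.
Qed.

(** For 0 < x <= 1 the set is the x-dilate of E, whence the square; it is empty for x <= 0 and all
    of E for x > 1, which the clamping of x records. *)
Lemma conical_ray (phi : R * R -> R) (E : set (R * R)) (x : R) : conical phi E ->
  leb2 (phi @^-1` `]-oo, x[ `&` E) = ((Num.min 1 (Num.max 0 x)) ^+ 2)%:E * leb2 E.
Proof.
move=> [mE mphi Eoo phi01 hE].
have mr (y : R) : measurable (phi @^-1` `]-oo, y[ `&` E).
  by apply: measurableI => //; rewrite -[X in measurable X]setTI; exact: mphi.
have [x0|x0] := leP x 0%R.
  rewrite min_r// expr0n/= mul0e.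
  rewrite (_ : _ `&` _ = set0) ?measure0//; apply/seteqP; split => q//= -[].
  by rewrite in_itv/= => h /phi01/andP[h' _]; move: (le_lt_trans h' h); rewrite ltNge x0.
have [x1|x1] := leP x 1%R; last first.
  rewrite expr1n mul1e; congr (leb2 _).
  apply/seteqP; split => q /=; first by case.
  by move=> Eq; split => //; rewrite in_itv/=; case/andP: (phi01 _ Eq) => _ /lt_trans; exact.
rewrite (leb2_scale x0 (mr x)); congr (_ * leb2 _).
apply/seteqP; split => q /=; rewrite in_itv/=.
  by move=> [h1 h2]; apply/(hE x); rewrite ?x0.
by move=> Eq; have /(hE x)[] : E q; rewrite ?x0.
Qed.

(** The crossed factors [leb2 E2] and [leb2 E1] make the two rescaled distributions agree on rays,
    hence on all Borel sets. *)
Lemma conical_integral (phi1 phi2 : R * R -> R) (E1 E2 : set (R * R)) (h : R -> \bar R) :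
  conical phi1 E1 -> conical phi2 E2 -> measurable_fun setT h -> (forall r, 0 <= h r) ->
  leb2 E2 * \int[leb2]_(q in E1) h (phi1 q) = leb2 E1 * \int[leb2]_(q in E2) h (phi2 q).
Proof.
move=> c1 c2 mh h0; have [mE1 mphi1 Eoo1 _ _] := c1; have [mE2 mphi2 Eoo2 _ _] := c2.
have f1 : leb2 E1 \is a fin_num by rewrite ge0_fin_numE.
have f2 : leb2 E2 \is a fin_num by rewrite ge0_fin_numE.
have k1 : (0 <= fine (leb2 E1))%R by rewrite fine_ge0.
have k2 : (0 <= fine (leb2 E2))%R by rewrite fine_ge0.
pose m1 : {measure set (measurableTypeR R) -> \bar R} := mscale (NngNum k2) (push_restr leb2 mE1 mphi1).
pose m2 : {measure set (measurableTypeR R) -> \bar R} := mscale (NngNum k1) (push_restr leb2 mE2 mphi2).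
have e1 B : m1 B = leb2 E2 * leb2 (phi1 @^-1` B `&` E1) by rewrite /m1 /= /mscale/= fineK.
have e2 B : m2 B = leb2 E1 * leb2 (phi2 @^-1` B `&` E2) by rewrite /m2 /= /mscale/= fineK.
have := @integral_push_restr R _ _ leb2 _ mE1 _ mphi1 h mh h0.
have := @integral_push_restr R _ _ leb2 _ mE2 _ mphi2 h mh h0.
move=> <- <-.
transitivity (\int[m1]_r h r); first by rewrite /m1 ge0_integral_mscale//= fineK.
transitivity (\int[m2]_r h r); last by rewrite /m2 ge0_integral_mscale//= fineK.
have mm : forall A, measurable A -> m1 A = m2 A; last first.
  by apply: (@eq_measure_integral _ _ R setT m2 m1 h) => A mA _; exact: mm.
clearbody m1 m2; apply: measure_unique_rays => x.
- by rewrite e1 e2 (conical_ray x c1) (conical_ray x c2) muleCA [RHS]muleCA [leb2 E1 * _]muleC.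
- rewrite e1 (conical_ray x c1).
  by rewrite !lte_mul_pinfty ?mule_ge0 ?lee_fin ?sqr_ge0 ?ltry// fin_numM.
Qed.

Lemma integral_triangle (h : R -> \bar R) : measurable_fun setT h -> (forall r, 0 <= h r) ->
  \int[leb2]_(q in triangle) h q.1 = \int[leb]_(r in `[0%R, 1%R[) (h r * r%:E).
Proof.
move=> mh h0.
have mh1 : measurable_fun setT (fun q : R * R => h q.1).
  exact: measurableT_comp mh (@measurable_fst _ _ R R).
rewrite integral_mkcond /leb2 fubini_tonelli1//; last 2 first.
- exact: (measurable_restrictT _ measurable_triangle).1 (measurable_funTS mh1).
- by move=> q; rewrite patchE; case: ifPn.
rewrite [RHS]integral_mkcond; apply: eq_integral => x _; rewrite /fubini_F patchE.
case: ifPn => [|/negP xn].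
  rewrite inE/= in_itv/= => /andP[x0 x1].
  transitivity (\int[leb]_(y in `[0%R, x[) h x).
    rewrite [RHS]integral_mkcond; apply: eq_integral => y _; rewrite !patchE.
    congr (if _ then _ else _); apply/idP/idP; rewrite !inE /triangle/= in_itv/= x0 x1.
      by case.
    by move=> ->.
  rewrite integral_cst//= lebesgue_measure_itv/= lte_fin sube0.
  by case: ltgtP x0 => // <- _; rewrite mule0.
apply: integral0_eq => y _; rewrite patchE; case: ifPn => // /[!inE] -[/= x01 _].
by exfalso; apply: xn; rewrite inE/= in_itv.
Qed.

Lemma polar : exists2 k : R, (0 < k)%R & forall h : R -> \bar R,
  measurable_fun `[(0 : R)%R, 1%R[ h -> (forall r, (0 <= r < 1)%R -> 0 <= h r) ->
  \int[leb2]_(q in D) h (rad q) = k%:E * \int[leb]_(r in `[0%R, 1%R[) (h r * r%:E).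
Proof.
have /andP[d0 doo] := leb2_disc; have /andP[t0 too] := leb2_triangle.
have fd : leb2 D \is a fin_num by rewrite ge0_fin_numE.
have ft : leb2 triangle \is a fin_num by rewrite ge0_fin_numE.
have d0' : (0 < fine (leb2 D))%R by rewrite fine_gt0// d0.
have t0' : (0 < fine (leb2 triangle))%R by rewrite fine_gt0// t0.
(* The ratio of the two areas is left uncomputed; it is absorbed later in [kap]. *)
exists (fine (leb2 D) / fine (leb2 triangle))%R; first by rewrite divr_gt0.
move=> h mh h0; pose g := h \_ `[0%R, 1%R[.
have mI : measurable (`[(0 : R)%R, 1%R[%classic : set R) by exact: measurable_itv.
have mg : measurable_fun setT g := (measurable_restrictT h mI).1 mh.
have g0 r : 0 <= g r by rewrite /g patchE; case: ifPn => // /[!inE]/=; rewrite in_itv/=; exact: h0.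
have gh r : (0 <= r < 1)%R -> g r = h r by move=> r01; rewrite /g patchE mem_set//= in_itv.
have := conical_integral conical_disc conical_triangle mg g0.
rewrite integral_triangle// => e.
have -> : \int[leb2]_(q in D) h (rad q) = \int[leb2]_(q in D) g (rad q).
  apply: eq_integral => q /[!inE] qD; rewrite gh// /rad cabs_ge0/=.
  exact: qD.
have -> : \int[leb]_(r in `[0%R, 1%R[) (h r * r%:E) = \int[leb]_(r in `[0%R, 1%R[) (g r * r%:E).
  by apply: eq_integral => r; rewrite inE/= in_itv/= => r01; rewrite gh.
move: e; rewrite -(fineK ft) -(fineK fd) => e.
rewrite mulrC EFinM -muleA -e muleA -EFinM mulVf ?gt_eqF// mul1e.
by [].
Qed.

End PolarIntegral.

(** * Fejer means *)

Section FejerMeans.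
Variable R : realType.
Implicit Types (a : nat -> R[i]) (z x : R[i]).

(** [X^n - 1] splits over the algebraically closed field [R[i]] and is separable; its n distinct
    roots include a primitive one. *)
Lemma primitive_root_exists n : (0 < n)%N -> exists x : R[i], n.-primitive_root x.
Proof.
move=> n0; pose p : {poly R[i]} := ('X^n - 1)%R.
have [r Dp] := closed_field_poly_normal p.
rewrite (monicP _) ?monicXnsubC// scale1r in Dp.
have rn1 : all n.-unity_root r by apply/allP => z; rewrite -root_prod_XsubC -Dp.
have sr : (n < (size r).+1)%N by rewrite -(size_prod_XsubC r id) -Dp size_XnsubC.
have [|z _ hz] := hasP (has_prim_root n0 rn1 _ sr); last by exists z.
by rewrite -separable_prod_XsubC -Dp separable_Xn_sub_1// pnatr_eq0 -lt0n.
Qed.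

Lemma cabs_prim_root n x : n.-primitive_root x -> cabs x = 1.
Proof.
move=> hx; have n0 := prim_order_gt0 hx.
have := congr1 (@cabs R) (prim_expr_order hx); rewrite cabsX cabs1 => /eqP.
by rewrite pexpr_eq1 ?cabs_ge0// => /eqP.
Qed.

Lemma prim_root_conj n x : n.-primitive_root x -> conjc x = x ^+ n.-1.
Proof.
move=> hx; have n0 := prim_order_gt0 hx.
have x0 : x != 0 by rewrite -cabs_gt0 (cabs_prim_root hx).
apply: (mulfI x0); rewrite mul_conjc (cabs_prim_root hx) expr1n -exprS prednK//.
by rewrite (prim_expr_order hx).
Qed.

Lemma prim_root_sum n x j : n.-primitive_root x ->
  \sum_(k < n) (x ^+ k) ^+ j = if (n %| j)%N then n%:R else 0.
Proof.
move=> hx; rewrite (prim_order_dvd hx).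
under eq_bigr do rewrite exprAC.
case: eqP => [->|/eqP h].
  by under eq_bigr do rewrite expr1n; rewrite sumr_const card_ord.
have := subrX1 (x ^+ j) n; rewrite exprAC (prim_expr_order hx) expr1n subrr => /esym/eqP.
by rewrite mulf_eq0 subr_eq0 (negbTE h) => /eqP.
Qed.

(* [fejw N m = 1 - m / N] (truncated at [0]) is the multiplier of the N-th Fejer
   mean; [fejl M N x k] is the Fejer kernel at the root of unity [x ^ k], divided by [M]. *)
Definition fejw (n : nat) (m : nat) : R := (n - m)%:R / n%:R.

Lemma fejw_ge0 n m : 0 <= fejw n m.
Proof. by rewrite divr_ge0. Qed.

Lemma fejw_le1 n m : fejw n m <= 1.
Proof.
case: n => [|n]; first by rewrite /fejw mul0r.
by rewrite ler_pdivrMr ?ltr0n// mul1r ler_nat leq_subr.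
Qed.

Definition fejl (M N : nat) x (k : nat) : R :=
  (M%:R * N%:R)^-1 * cabs (\sum_(j < N) (x ^+ k) ^+ j) ^+ 2.

Lemma fejl_ge0 M N x k : 0 <= fejl M N x k.
Proof. by rewrite mulr_ge0 ?sqr_ge0// invr_ge0 mulr_ge0. Qed.

(** Expanding the square, orthogonality of the M-th roots of unity keeps the pairs with j + n = l
    modulo M. The condition n + N <= M excludes wrap-around, and exactly N - n pairs remain. *)
Lemma fejl_sum M N x n : M.-primitive_root x -> (0 < N)%N -> (n + N <= M)%N ->
  \sum_(k < M) ((fejl M N x k)%:C)%C * (x ^+ k) ^+ n = ((fejw N n)%:C)%C.
Proof.
move=> hx N0 nNM; have M0 := prim_order_gt0 hx.
have e1 (k : nat) : ((fejl M N x k)%:C)%C * (x ^+ k) ^+ n =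
  (M%:R * N%:R)^-1 * \sum_(j < N) \sum_(l < N) (x ^+ k) ^+ (j + n + M.-1 * l)%N.
  rewrite /fejl rmorphM/= -mul_conjc fmorphV rmorphM/= !rmorph_nat -mulrA; congr (_ * _).
  rewrite mulr_suml mulr_suml; apply: eq_bigr => j _.
  rewrite rmorph_sum mulr_sumr mulr_suml; apply: eq_bigr => l _.
  rewrite !rmorphXn/= (prim_root_conj hx) !exprD mulrAC; congr (_ * _).
  by rewrite exprM [x ^+ M.-1 ^+ k]exprAC.
under eq_bigr do rewrite e1.
rewrite -mulr_sumr exchange_big/=; under eq_bigr do rewrite exchange_big/=.
under eq_bigr do under eq_bigr do rewrite (prim_root_sum _ hx).
have e2 (j l : 'I_N) : (M %| j + n + M.-1 * l)%N = (j + n == l)%N.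
  rewrite /dvdn -(mod0n M) -(eqn_modDr l) add0n -addnA -mulSnr prednK//.
  rewrite addnC mulnC modnMDl.
  by rewrite !modn_small// (leq_trans _ nNM)// ?(leq_trans (ltn_ord l))// ?leq_addl// addnC ltn_add2l.
under eq_bigr do under eq_bigr do rewrite e2.
have e3 (j : 'I_N) : \sum_(l < N) (if (j + n == l)%N then M%:R else 0 : R[i]) =
    if (j < N - n)%N then M%:R else 0.
  rewrite -big_mkcond/= ltn_subRL addnC; case: ifPn => jn.
    by rewrite (big_pred1 (Ordinal jn))// => l; rewrite -val_eqE/= eq_sym addnC.
  rewrite big_pred0// => l; apply/eqP => h; move: jn; rewrite h.
  by rewrite ltn_ord.
under eq_bigr do rewrite e3.
rewrite -big_mkcond/= (big_ord_narrow (leq_subr n N))/= sumr_const card_ord.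
have M0' : M%:R != 0 :> R[i] by rewrite pnatr_eq0 -lt0n.
have N0' : N%:R != 0 :> R[i] by rewrite pnatr_eq0 -lt0n.
rewrite /fejw rmorphM/= fmorphV/= !rmorph_nat -mulr_natr.
by field; rewrite M0' N0'.
Qed.

Lemma fejl_sum1 M N x : M.-primitive_root x -> (0 < N)%N -> (N <= M)%N ->
  \sum_(k < M) fejl M N x k = 1.
Proof.
move=> hx N0 NM; apply: (@complexI R).
have := fejl_sum (n := 0) hx N0 NM.
under eq_bigr do rewrite expr0 mulr1.
by rewrite rmorph_sum => ->; rewrite /fejw subn0 divff// pnatr_eq0 -lt0n.
Qed.

Definition fejS a N z : R[i] := \sum_(0 <= n < N) ((fejw N n)%:C)%C * (a n * z ^+ n).

Definition proot (M : nat) : R[i] := if pselect (0 < M)%N is left h then projT1 (cid (primitive_root_exists h)) else 1.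

Lemma prootP M : (0 < M)%N -> M.-primitive_root (proot M).
Proof. by move=> M0; rewrite /proot; case: pselect => // h; case: cid. Qed.

(** The Fejer mean discretized on the M-th roots of unity: a finite convex combination of rotations,
    to which Jensen's inequality for sums applies. Frequencies are identified modulo M, so it
    matches [fejS] only in the limit of large M. *)
Definition fejD a N M z : R[i] := \sum_(k < M) ((fejl M N (proot M) k)%:C)%C * ps a (proot M ^+ k * z).

Lemma tannery (b : nat -> nat -> R[i]) (c : nat -> R[i]) (M : nat -> R) :
  (forall N n, cabs (b N n) <= M n) -> cvgn (series M) ->
  (forall n, ccvg (b^~ n) (c n)) -> ccvg (fun N => cser (b N)) (cser c).
Proof.
move=> bM sM bc.
have cM n : cabs (c n) <= M n.
  apply: (@ler_cvg_to _ _ _ _ (fun N => cabs (b N n)) (fun=> M n)) (ccvg_cabs (bc n)) _ _.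
    exact: cvg_cst.
  exact: nearW.
have sc := cabs_summable_le cM sM; have sb N := cabs_summable_le (bM N) sM.
have sc' := @cabs_summableZ _ _ (-1) sc.
pose d N n := b N n + (-1) * c n.
have sd N : cabs_summable (d N) by exact: cabs_summableD (sb N) sc'.
have dE N : cser (b N) - cser c = cser (d N).
  by rewrite (cserD (sb N) sc') (@cserZ _ _ (-1) sc) mulN1r.
have dM N n : cabs (d N n) <= 2 * M n.
  by rewrite (le_trans (cabsD _ _))// mulN1r cabsN mulrDl !mul1r lerD.
have tail N K : cabs (cser (d N) - csums (d N) K) <= 2 * (limn (series M) - series M K).
  have c1 := ccvg_cabs (ccvgD (csums_cvg (sd N)) (ccvg_cst (- csums (d N) K))).
  have c2 : (fun n => 2 * (series M n - series M K)) @ \oo --> 2 * (limn (series M) - series M K).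
    apply: cvgM; first exact: cvg_cst.
    by apply: cvgB; [exact: sM|exact: cvg_cst].
  apply: (ler_cvg_to c1 c2); exists K => // n /= Kn.
  rewrite /csums (@big_cat_nat _ _ _ K 0 n)//= addrAC subrr add0r.
  rewrite /series /= [X in _ <= 2 * (X - _)](@big_cat_nat _ _ _ K 0 n)//= [X in _ <= 2 * X]addrAC subrr add0r mulr_sumr.
  by rewrite (le_trans (cabs_sum _ _ _))// ler_sum.
apply/ccvgP/cvgrPdist_le => e e0.
have e40 : 0 < e / 4 by rewrite divr_gt0.
have /cvgrPdist_le/(_ _ e40)[K _ /(_ K (leqnn K)) hK] := sM.
have hs : ccvg (fun N => csums (d N) K) 0.
  have -> : 0 = \sum_(0 <= n < K) (0 : R[i]) by rewrite big1.
  apply: ccvg_sum => n; rewrite -(subrr (c n)); apply: ccvgD (bc n) _.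
  by rewrite mulN1r; exact: ccvg_cst.
have e20 : 0 < e / 2 by rewrite divr_gt0.
have /ccvgP/cvgrPdist_le/(_ _ e20) := hs.
apply: filterS => N; rewrite subr0 !sub0r !normrN !ger0_norm ?cabs_ge0// => hN.
rewrite dE -(subrK (csums (d N) K) (cser (d N))) (le_trans (cabsD _ _))// [e]splitr lerD//.
rewrite (le_trans (tail N K))// (le_trans (ler_wpM2l _ (ler_norm _)))//.
by rewrite (le_trans (ler_wpM2l _ hK))//; lra.
Qed.

(** With roots of order M + N, the n-th multiplier is exactly [fejw N n] as soon as n <= M, and all
    multipliers have modulus at most 1; Tannery's theorem then passes to the limit in the series. *)
Lemma fejD_cvg a N z : rad1 a -> (0 < N)%N -> cabs z < 1 ->
  ccvg (fun M => fejD a N (M + N) z) (fejS a N z).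
Proof.
move=> ha N0 z1.
have sz := rad1_summable ha z1.
pose c n := a n * z ^+ n.
pose m M n : R[i] := \sum_(k < M + N) ((fejl (M + N) N (proot (M + N)) k)%:C)%C * (proot (M + N) ^+ k) ^+ n.
have M0 M : (0 < M + N)%N by rewrite addn_gt0 N0 orbT.
have mle M n : cabs (m M n) <= 1.
  have hx := prootP (M0 M).
  rewrite (le_trans (cabs_sum _ _ _))// -[leRHS](fejl_sum1 hx N0 (leq_addl _ _)).
  apply: ler_sum => k _; rewrite cabsM !cabsX (cabs_prim_root hx) !expr1n mulr1 cabs_real ger0_norm//.
  exact: fejl_ge0.
have -> : (fun M => fejD a N (M + N) z) = fun M => cser (fun n => m M n * c n).
  apply/funext => M; have hx := prootP (M0 M).
  rewrite /fejD /m; set x := proot (M + N) in hx *.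
  have cxk k : cabs (x ^+ k * z) < 1 by rewrite cabsM cabsX (cabs_prim_root hx) expr1n mul1r.
  have sk k : cabs_summable (fun n => ((fejl (M + N) N x k)%:C)%C * (a n * (x ^+ k * z) ^+ n)).
    by apply: cabs_summableZ; exact: rad1_summable.
  have [sD eD] := cser_sum (index_enum 'I_(M + N)) (fun k : 'I_(M + N) => sk k).
  transitivity (\sum_(k < M + N) cser (fun n => ((fejl (M + N) N x k)%:C)%C * (a n * (x ^+ k * z) ^+ n))).
    by apply: eq_bigr => k _; exact: esym (cserZ _ (rad1_summable ha (cxk k))).
  rewrite -eD; congr cser; apply/funext => n; rewrite mulr_suml; apply: eq_bigr => k _.
  by rewrite exprMn /c; ring.
have [sf ef] := @cser_finite R (fun n => ((fejw N n)%:C)%C * c n) N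
    (fun n Nn => ltac:(by rewrite /fejw (eqP (Nn : (N - n == 0)%N)) mul0r mul0r)).
rewrite (_ : fejS a N z = cser (fun n => ((fejw N n)%:C)%C * c n)); last by rewrite ef.
apply: (tannery _ sz) => [M n|n].
  by rewrite cabsM -[leRHS]mul1r ler_wpM2r ?cabs_ge0.
apply: ccvgM; last exact: ccvg_cst.
apply/ccvgP/cvgrPdist_le => e e0; exists n => // M /= nM.
by rewrite /m (fejl_sum (prootP (M0 M)) N0) ?leq_add2r// subrr cabs0 subrr normr0 ltW.
Qed.

Lemma fejw_cvg n : (fun N => fejw N n) @ \oo --> (1 : R).
Proof.
have h : (fun N => 1 - n%:R * (N.+1%:R)^-1 : R) @ \oo --> (1 : R).
  rewrite -[X in _ --> X]subr0; apply: cvgB; first exact: cvg_cst.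
  rewrite -[X in _ --> X](mulr0 (n%:R : R)); apply: cvgM; first exact: cvg_cst.
  exact: cvg_harmonic.
rewrite -(cvg_shiftS (fun N => fejw N n)); apply: cvg_trans h.
apply: near_eq_cvg; exists n => // N /= nN.
by rewrite /fejw natrB ?mulrBl ?divff ?pnatr_eq0// leqW.
Qed.

Lemma fejS_cvg a z : rad1 a -> cabs z < 1 -> ccvg (fun N => fejS a N z) (ps a z).
Proof.
move=> ha z1; have sz := rad1_summable ha z1.
rewrite (_ : (fun N => fejS a N z) = fun N => cser (fun n => ((fejw N n)%:C)%C * (a n * z ^+ n))); last first.
  apply/funext => N.
  have [sf ef] := @cser_finite R (fun n => ((fejw N n)%:C)%C * (a n * z ^+ n)) N
    (fun n Nn => ltac:(by rewrite /fejw (eqP (Nn : (N - n == 0)%N)) mul0r mul0r)).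
  by rewrite ef.
apply: (tannery _ sz) => [N n|n].
  by rewrite cabsM cabs_real ger0_norm ?fejw_ge0// -[leRHS]mul1r ler_wpM2r ?cabs_ge0 ?fejw_le1.
rewrite -[X in ccvg _ X]mul1r; apply: ccvgM; last exact: ccvg_cst.
by split => /=; [exact: fejw_cvg|exact: cvg_cst].
Qed.

End FejerMeans.

(** * Integration over the disc *)

Section DiscIntegral.
Variable R : realType.
Local Notation D := (@disc R).
Local Notation leb2 := (@leb2 R).
Implicit Types (F G : R * R -> R[i]) (f g : R[i] -> R[i]) (p : R).

Let mD : measurable D := @measurable_disc R.

Definition cmeas F := measurable_fun D (fun q => complex.Re (F q)) /\ measurable_fun D (fun q => complex.Im (F q)).

Lemma cmeas_cst k : cmeas (fun=> k).
Proof. by split; exact: measurable_cst. Qed.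

Lemma cmeas_cplx : cmeas (@cplx R).
Proof. by split; [exact: measurable_funTS (@measurable_fst _ _ R R)|exact: measurable_funTS (@measurable_snd _ _ R R)]. Qed.

Lemma cmeasD F G : cmeas F -> cmeas G -> cmeas (fun q => F q + G q).
Proof.
move=> [f1 f2] [g1 g2]; split.
- by under eq_fun do rewrite ReD; exact: measurable_funD.
- by under eq_fun do rewrite ImD; exact: measurable_funD.
Qed.

Lemma cmeasM F G : cmeas F -> cmeas G -> cmeas (fun q => F q * G q).
Proof.
move=> [f1 f2] [g1 g2]; split.
- by under eq_fun do rewrite ReM; apply: measurable_funB; exact: measurable_funM.
- by under eq_fun do rewrite ImM; apply: measurable_funD; exact: measurable_funM.
Qed.

Lemma cmeasX F n : cmeas F -> cmeas (fun q => F q ^+ n).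
Proof.
move=> hF; elim: n => [|n ih]; first exact: cmeas_cst.
by under eq_fun do rewrite exprS; exact: cmeasM.
Qed.

Lemma cmeas_conj F : cmeas F -> cmeas (fun q => conjc (F q)).
Proof.
move=> [f1 f2]; split.
- by rewrite (_ : (fun q => _) = (fun q => complex.Re (F q)))//; apply/funext => q; case: (F q).
- rewrite (_ : (fun q => _) = (fun q => - complex.Im (F q))); first exact: measurable_funN.
  by apply/funext => q; case: (F q).
Qed.

Lemma cmeas_real (h : R * R -> R) : measurable_fun D h -> cmeas (fun q => ((h q)%:C)%C).
Proof. by move=> mh; split => //=; exact: measurable_cst. Qed.

Lemma cmeas_sum (I : Type) (s : seq I) (H : I -> R * R -> R[i]) : (forall i, cmeas (H i)) ->
  cmeas (fun q => \sum_(i <- s) H i q).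
Proof.
move=> h; elim: s => [|i s ih].
  by under eq_fun do rewrite big_nil; exact: cmeas_cst.
by under eq_fun do rewrite big_cons; exact: cmeasD.
Qed.

Lemma cmeas_cabs F : cmeas F -> measurable_fun D (fun q => cabs (F q)).
Proof.
move=> [f1 f2]; rewrite /cabs; apply: (@measurableT_comp _ _ _ _ _ _ (@Num.sqrt R)).
  by apply: continuous_measurable_fun; exact: sqrt_continuous.
by apply: measurable_funD; apply: (@measurable_funX _ _ _ _ _ 2).
Qed.

Lemma cmeas_eq F G : (forall q, D q -> F q = G q) -> cmeas F -> cmeas G.
Proof.
move=> FG [f1 f2]; split.
- by apply: eq_measurable_fun f1 => q /[!inE] qD; rewrite FG.
- by apply: eq_measurable_fun f2 => q /[!inE] qD; rewrite FG.
Qed.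

Lemma cmeas_cvg (Fn : nat -> R * R -> R[i]) F : (forall n, cmeas (Fn n)) ->
  (forall q, D q -> ccvg (fun n => Fn n q) (F q)) -> cmeas F.
Proof.
move=> h c; split.
- apply: (@measurable_fun_cvg _ _ _ _ (fun n q => complex.Re (Fn n q))) => [n|q /c[]//].
  by case: (h n).
- apply: (@measurable_fun_cvg _ _ _ _ (fun n q => complex.Im (Fn n q))) => [n|q /c[]//].
  by case: (h n).
Qed.

Lemma cmeas_rot (c : R[i]) F : cabs c = 1 -> cmeas F -> cmeas (fun q => F (rot c q)).
Proof.
move=> c1 [f1 f2].
have h (g : R * R -> R) : measurable_fun D g -> measurable_fun D (fun q => g (rot c q)).
  move=> mg; apply: (@measurable_comp _ _ _ _ _ _ D) => //.
    by move=> _ [q qD <-]; rewrite rot_disc.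
  exact: measurable_funTS (@measurable_rot R c).
by split; [exact: (h (fun q => complex.Re (F q)))|exact: (h (fun q => complex.Im (F q)))].
Qed.

Lemma cmeas_ps (a : nat -> R[i]) : rad1 a -> cmeas (fun q => ps a (cplx q)).
Proof.
move=> ha; apply: (@cmeas_cvg (fun n q => csums (fun n => a n * cplx q ^+ n) n)).
  move=> n; rewrite /csums; apply: cmeas_sum => i; apply: cmeasM; first exact: cmeas_cst.
  by apply: cmeasX; exact: cmeas_cplx.
by move=> q qD; exact: ps_cvg.
Qed.

Lemma cmeas_fejS (a : nat -> R[i]) N : cmeas (fun q => fejS a N (cplx q)).
Proof.
apply: cmeas_sum => i; apply: cmeasM; first exact: cmeas_cst.
by apply: cmeasM; [exact: cmeas_cst|apply: cmeasX; exact: cmeas_cplx].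
Qed.

Local Open Scope ereal_scope.


Let ipi0 : (0 <= (pi : R)^-1)%R. Proof. by rewrite invr_ge0 pi_ge0. Qed.

Lemma dAint_ge0 (h : R * R -> \bar R) : (forall q, D q -> 0 <= h q) -> 0 <= dAint h.
Proof. by move=> h0; rewrite /dAint mule_ge0 ?lee_fin// integral_ge0. Qed.

Lemma eq_dAint (h k : R * R -> \bar R) : (forall q, D q -> h q = k q) -> dAint h = dAint k.
Proof.
by move=> hk; rewrite /dAint; congr (_ * _); apply: eq_integral => q /[!inE]; exact: hk.
Qed.

Lemma le_dAint (h k : R * R -> \bar R) : measurable_fun D h -> measurable_fun D k ->
  (forall q, D q -> 0 <= h q) -> (forall q, D q -> h q <= k q) -> dAint h <= dAint k.
Proof.
move=> mh mk h0 hk; rewrite /dAint lee_wpmul2l ?lee_fin//; exact: ge0_le_integral.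
Qed.

Lemma dAintD (h k : R * R -> \bar R) : measurable_fun D h -> measurable_fun D k ->
  (forall q, D q -> 0 <= h q) -> (forall q, D q -> 0 <= k q) ->
  dAint (fun q => h q + k q) = dAint h + dAint k.
Proof.
move=> mh mk h0 k0; rewrite /dAint ge0_integralD// ge0_muleDr//; exact: integral_ge0.
Qed.

Lemma dAintZ (c : R) (h : R * R -> \bar R) : measurable_fun D h -> (0 <= c)%R ->
  (forall q, D q -> 0 <= h q) -> dAint (fun q => c%:E * h q) = c%:E * dAint h.
Proof.
move=> mh c0 h0; by rewrite /dAint ge0_integralZl// muleCA.
Qed.

Lemma dAint_sum (I : Type) (s : seq I) (h : I -> R * R -> \bar R) :
  (forall i, measurable_fun D (h i)) -> (forall i q, D q -> 0 <= h i q) ->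
  dAint (fun q => \sum_(i <- s) h i q) = \sum_(i <- s) dAint (h i).
Proof.
move=> mh h0; rewrite /dAint ge0_integral_sum// ge0_sume_distrr// => i _.
by apply: integral_ge0 => q; exact: h0.
Qed.

Lemma dAint_rot (c : R[i]) (h : R * R -> \bar R) : cabs c = 1%R -> measurable_fun D h ->
  (forall q, D q -> 0 <= h q) -> dAint (fun q => h (rot c q)) = dAint h.
Proof. by move=> c1 mh h0; rewrite /dAint integral_disc_rot. Qed.

Lemma limn_einf_le (u : nat -> \bar R) C : (forall n, u n <= C) -> limn_einf u <= C.
Proof.
move=> uC; rewrite limn_einf_lim; apply: lime_le; first exact: is_cvg_einfs.
apply: nearW => n; apply: le_trans (uC n).
by apply: ereal_inf_lbound; exists n => /=.
Qed.

Lemma dAint_fatou (hn : nat -> R * R -> \bar R) (h : R * R -> \bar R) C :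
  (forall n, measurable_fun D (hn n)) -> (forall n q, D q -> 0 <= hn n q) ->
  (forall q, D q -> hn n q @[n --> \oo] --> h q) ->
  (forall n, dAint (hn n) <= C) -> dAint h <= C.
Proof.
move=> mh h0 hc hC.
have -> : dAint h = dAint (fun q => limn_einf (hn^~ q)).
  apply: eq_dAint => q qD; have c := hc q qD.
  by rewrite is_cvg_limn_einfE ?(cvg_lim _ c)//; exact: cvgP c.
have pi0 : (0 < (pi : R)^-1)%R by rewrite invr_gt0 pi_gt0.
rewrite /dAint lee_pdivrMl ?pi_gt0// (le_trans (fatou leb2 mD mh h0))//.
by apply: limn_einf_le => n; rewrite -lee_pdivrMl ?pi_gt0//; exact: hC.
Qed.

Lemma dAint_cst (c : R) : (0 <= c)%R -> dAint (fun=> c%:E) < +oo.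
Proof.
move=> c0; have /andP[_ h] := @leb2_disc R.
rewrite /dAint integral_cst// !lte_mul_pinfty ?mule_ge0 ?lee_fin//.
Qed.

End DiscIntegral.

(** * Complex-valued integrals over the disc *)

Section ComplexDiscIntegral.
Variable R : realType.
Local Notation D := (@disc R).
Local Notation leb2 := (@leb2 R).
Implicit Types (F G : R * R -> R[i]) (f g : R[i] -> R[i]) (p : R).
Local Open Scope ereal_scope.

Let mD : measurable D := @measurable_disc R.

Definition absint F := dAint (fun q => (cabs (F q))%:E).

Lemma dAint_lty (h : R * R -> \bar R) : (dAint h < +oo) = (\int[leb2]_(q in D) h q < +oo).
Proof. by rewrite /dAint lte_pdivrMl ?pi_gt0// gt0_muley// lte_fin pi_gt0. Qed.

Lemma meas_cabsE F : cmeas F -> measurable_fun D (fun q => (cabs (F q))%:E).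
Proof. by move=> /cmeas_cabs h; exact/measurable_EFinP. Qed.

Lemma cintegrableP F : cmeas F -> absint F < +oo -> cintegrable F.
Proof.
move=> mF; rewrite /absint dAint_lty => h; have [f1 f2] := mF.
have ic : leb2.-integrable D (fun q => (cabs (F q))%:E).
  apply/integrableP; split; first exact: meas_cabsE.
  apply: le_lt_trans h; rewrite le_eqVlt; apply/orP; left; apply/eqP.
  by apply: eq_integral => q _; rewrite gee0_abs// lee_fin cabs_ge0.
split.
- apply: (@le_integrable _ _ _ leb2 D mD _ _ _ _ ic); first exact/measurable_EFinP.
  by move=> q _; rewrite /= lee_fin (ger0_norm (cabs_ge0 _)) Re_le_cabs.
- apply: (@le_integrable _ _ _ leb2 D mD _ _ _ _ ic); first exact/measurable_EFinP.
  by move=> q _; rewrite /= lee_fin (ger0_norm (cabs_ge0 _)) Im_le_cabs.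
Qed.

Lemma cintegrable_meas F : cintegrable F -> cmeas F.
Proof.
by move=> [h1 h2]; split; apply/measurable_EFinP; [exact: measurable_int h1|exact: measurable_int h2].
Qed.

Lemma cint_eq F G : (forall q, D q -> F q = G q) -> cint F = cint G.
Proof.
move=> FG; rewrite /cint; congr Complex; congr (_ * _)%R; apply: eq_Rintegral => q /[!inE] qD;
by rewrite FG.
Qed.

Lemma cintD F G : cintegrable F -> cintegrable G -> cint (fun q => F q + G q)%R = (cint F + cint G)%R.
Proof.
move=> [f1 f2] [g1 g2]; apply: complex_ext; rewrite ?ReD ?ImD /=.
- under eq_Rintegral do rewrite ReD.
  by rewrite RintegralD// mulrDr.
- under eq_Rintegral do rewrite ImD.
  by rewrite RintegralD// mulrDr.
Qed.

Lemma cintegrableD F G : cintegrable F -> cintegrable G -> cintegrable (fun q => F q + G q)%R.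
Proof.
move=> [f1 f2] [g1 g2]; split.
- under eq_fun do rewrite ReD EFinD; exact: integrableD.
- under eq_fun do rewrite ImD EFinD; exact: integrableD.
Qed.

Lemma cintegrableZ (k : R[i]) F : cintegrable F -> cintegrable (fun q => k * F q)%R.
Proof.
move=> [f1 f2]; split.
- under eq_fun do rewrite ReM EFinB !EFinM; apply: integrableB => //; exact: integrableZl.
- under eq_fun do rewrite ImM EFinD !EFinM; apply: integrableD => //; exact: integrableZl.
Qed.

Lemma cintZ (k : R[i]) F : cintegrable F -> cint (fun q => k * F q)%R = (k * cint F)%R.
Proof.
move=> [f1 f2]; have iZ (c : R) (h : R * R -> R) : leb2.-integrable D (EFin \o h) ->
    leb2.-integrable D (EFin \o (fun q => c * h q)%R).
  move=> ih; rewrite (_ : EFin \o _ = (fun q => c%:E * (EFin \o h) q)).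
    exact: integrableZl.
  by apply/funext => q; rewrite /= EFinM.
have e1 : (\int[leb2]_(q in D) (complex.Re (k * F q)) = complex.Re k * (\int[leb2]_(q in D) (complex.Re (F q)))
    - complex.Im k * (\int[leb2]_(q in D) (complex.Im (F q))))%R.
  under eq_Rintegral do rewrite ReM.
  by rewrite RintegralB ?RintegralZl//; [exact: iZ|exact: iZ].
have e2 : (\int[leb2]_(q in D) (complex.Im (k * F q)) = complex.Re k * (\int[leb2]_(q in D) (complex.Im (F q)))
    + complex.Im k * (\int[leb2]_(q in D) (complex.Re (F q))))%R.
  under eq_Rintegral do rewrite ImM.
  by rewrite RintegralD ?RintegralZl//; [exact: iZ|exact: iZ].
by apply: complex_ext; rewrite ?ReM ?ImM /= ?e1 ?e2; ring.
Qed.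

Lemma cintegrable0 : cintegrable (fun=> 0%R : R[i]).
Proof. by split; exact: integrable0. Qed.

Lemma cint0 : cint (fun=> 0%R : R[i]) = 0%R.
Proof. by rewrite /cint /= !Rintegral_cst// !mul0r mulr0. Qed.

Lemma cint_sum (I : Type) (s : seq I) (H : I -> R * R -> R[i]) : (forall i, cintegrable (H i)) ->
  cintegrable (fun q => \sum_(i <- s) H i q)%R /\
  cint (fun q => \sum_(i <- s) H i q)%R = (\sum_(i <- s) cint (H i))%R.
Proof.
move=> h; elim: s => [|i s [ih1 ih2]].
  rewrite big_nil; under eq_fun do rewrite big_nil.
  by split; [exact: cintegrable0|exact: cint0].
rewrite big_cons; under eq_fun do rewrite big_cons.
by rewrite -ih2; split; [exact: cintegrableD|exact: cintD].
Qed.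

(** Real and imaginary parts are estimated one at a time; the resulting 2 is the constant in [Tg_le]
    and in the bounds derived from it. *)
Lemma cint_bound F : cmeas F -> (cabs (cint F))%:E <= 2%:E * absint F.
Proof.
move=> mF; have [l|] := ltP (absint F) +oo; last first.
  by rewrite leye_eq => /eqP ->; rewrite gt0_muley ?leey ?lte_fin.
have [i1 i2] := cintegrableP mF l.
have piV : (0 <= (pi : R)^-1)%R by rewrite invr_ge0 pi_ge0.
have a0 : 0 <= absint F by apply: dAint_ge0 => q _; rewrite lee_fin cabs_ge0.
have b (h : R * R -> R) : leb2.-integrable D (EFin \o h) -> (forall q, `|h q| <= cabs (F q))%R ->
    (`|pi^-1 * \int[leb2]_(q in D) h q|%R)%:E <= absint F.
  move=> ih hF; rewrite normrM (ger0_norm piV) EFinM /absint /dAint.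
  rewrite lee_wpmul2l ?lee_fin//.
  rewrite EFin_normr_Rintegral// (le_trans (le_abse_integral _ _ _))//; first exact: measurable_int ih.
  apply: ge0_le_integral => //.
  - by apply: measurableT_comp => //; exact: measurable_int ih.
  - exact: meas_cabsE.
  - by move=> q _; rewrite /= lee_fin.
rewrite (@le_trans _ _ (`|complex.Re (cint F)| + `|complex.Im (cint F)|)%:E)//.
  by rewrite lee_fin cabs_le_ReIm.
rewrite EFinD (_ : 2%:E * absint F = absint F + absint F); last first.
  by rewrite -mule2n -mule_natl.
rewrite leeD//; apply: b => // q; [exact: Re_le_cabs|exact: Im_le_cabs].
Qed.

Lemma cint_dominated (Fn : nat -> R * R -> R[i]) F (g : R * R -> R) : (forall n, cmeas (Fn n)) ->
  measurable_fun D g -> dAint (fun q => (g q)%:E) < +oo ->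
  (forall n q, D q -> cabs (Fn n q) <= g q)%R ->
  (forall q, D q -> ccvg (fun n => Fn n q) (F q)) ->
  ccvg (fun n => cint (Fn n)) (cint F).
Proof.
move=> mFn mg ig Fg c; have mF : cmeas F by exact: cmeas_cvg mFn c.
have g0 q : D q -> (0 <= g q)%R by move=> qD; rewrite (le_trans (cabs_ge0 _) (Fg 0%N q qD)).
have ig' : leb2.-integrable D (EFin \o g).
  apply/integrableP; split; first exact/measurable_EFinP.
  move: ig; rewrite dAint_lty; apply: le_lt_trans; rewrite le_eqVlt; apply/orP; left; apply/eqP.
  by apply: eq_integral => q /[!inE] qD; rewrite gee0_abs// lee_fin g0.
have key (h : nat -> R * R -> R) (k : R * R -> R) : (forall n, measurable_fun D (h n)) ->
    measurable_fun D k -> (forall n q, D q -> `|h n q| <= g q)%R ->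
    (forall q, D q -> h n q @[n --> \oo] --> k q)%R ->
    (pi^-1 * \int[leb2]_(q in D) h n q)%R @[n --> \oo] --> (pi^-1 * \int[leb2]_(q in D) k q)%R.
  move=> mh mk hg hk; apply: cvgM; first exact: cvg_cst.
  have ae1 : {ae leb2, forall q, D q -> (EFin \o h n) q @[n --> \oo] --> (EFin \o k) q}.
    by apply: aeW => q qD; apply/fine_cvgP; split; [exact: nearW|exact: hk].
  have ae2 : {ae leb2, forall q n, D q -> `|(EFin \o h n) q| <= (EFin \o g) q}.
    by apply: aeW => q n qD; exact: hg.
  have [ik _ cv] := @dominated_convergence _ _ _ leb2 D mD (fun n => EFin \o h n) (EFin \o k) (EFin \o g)
    (fun n => (measurable_EFinP _ _).2 (mh n)) ((measurable_EFinP _ _).2 mk)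
    ae1 ig' ae2.
  by apply: fine_cvg; rewrite fineK ?integrable_fin_num.
split => /=.
- apply: (key (fun n q => complex.Re (Fn n q)) (fun q => complex.Re (F q))).
  + by move=> n; case: (mFn n).
  + by case: mF.
  + by move=> n q qD; rewrite (le_trans (Re_le_cabs _))// Fg.
  + by move=> q /c[].
- apply: (key (fun n q => complex.Im (Fn n q)) (fun q => complex.Im (F q))).
  + by move=> n; case: (mFn n).
  + by case: mF.
  + by move=> n q qD; rewrite (le_trans (Im_le_cabs _))// Fg.
  + by move=> q /c[].
Qed.

Lemma cint_rot (c : R[i]) F : cabs c = 1%R -> cintegrable F -> cint (fun q => F (rot c q)) = cint F.
Proof.
move=> c1 iF; have key (h : R * R -> R) : leb2.-integrable D (EFin \o h) ->
    (\int[leb2]_(q in D) h (rot c q) = \int[leb2]_(q in D) h q)%R.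
  move=> ih; congr fine; rewrite integralE [RHS]integralE.
  have mh := measurable_int _ ih.
  have e1 := integral_disc_rot c1 (measurable_funepos mh) (fun q _ => funepos_ge0 (EFin \o h) q).
  have e2 := integral_disc_rot c1 (measurable_funeneg mh) (fun q _ => funeneg_ge0 (EFin \o h) q).
  congr (_ - _).
  - transitivity (\int[leb2]_(q in D) (EFin \o h)^\+ (rot c q)); last exact: e1.
    by apply: eq_integral => q _; rewrite !funeposE.
  - transitivity (\int[leb2]_(q in D) (EFin \o h)^\- (rot c q)); last exact: e2.
    by apply: eq_integral => q _; rewrite !funenegE.
by case: iF => i1 i2; rewrite /cint; congr Complex; congr (_ * _)%R;
  [exact: (key (fun q => complex.Re (F q)))|exact: (key (fun q => complex.Im (F q)))].
Qed.

End ComplexDiscIntegral.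

(** * Contractivity and convergence of Fejer means in weighted spaces *)

Section PowR.
Variable R : realType.
Implicit Types (p x y : R).

(** Young's inequality for the product of x and 1 with exponents p and p / (p - 1), solved for x^p;
    this is the tangent line of x^p at 1. *)
Lemma powR_bernoulli p x : 1 <= p -> 0 <= x -> 1 + p * (x - 1) <= x `^ p.
Proof.
move=> p1 x0; have p0 : 0 < p by lra.
have [pe|pn] := eqVneq p 1; first by rewrite pe powRr1//; lra.
have q0 : 0 < p - 1 by rewrite subr_gt0 lt_neqAle eq_sym pn.
have := @conjugate_powR _ x 1 p (p / (p - 1)) x0 ler01 p0 (divr_gt0 p0 q0).
have p0' : p != 0 by rewrite gt_eqF.
have q0' : p - 1 != 0 by rewrite gt_eqF.
move=> /(_ _)/[!powR1]; rewrite mulr1 div1r => h.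
have h1 : x <= x `^ p / p + (p / (p - 1))^-1 by apply: h; rewrite invf_div; field; rewrite ?p0' ?q0'.
have h2 := ler_wpM2r (ltW p0) h1.
have e : (x `^ p / p + (p / (p - 1))^-1) * p = x `^ p + (p - 1) by rewrite invf_div; field; rewrite ?p0' ?q0'.
by rewrite e in h2; lra.
Qed.

(** The tangent-line bound [powR_bernoulli] at x_i / m, where m is the mean, averaged with the
    weights l_i: the linear terms cancel. *)
Lemma powR_jensen p (I : Type) (s : seq I) (l x : I -> R) : 1 <= p ->
  (forall i, 0 <= l i) -> (forall i, 0 <= x i) -> \sum_(i <- s) l i = 1 ->
  (\sum_(i <- s) l i * x i) `^ p <= \sum_(i <- s) l i * x i `^ p.
Proof.
move=> p1 l0 x0 l1; set m := \sum_(i <- s) l i * x i.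
have p0 : 0 < p by lra.
have m0 : 0 <= m by apply: sumr_ge0 => i _; exact: mulr_ge0.
have [me|mn] := eqVneq m 0.
  by rewrite me powR0 ?gt_eqF// sumr_ge0// => i _; rewrite mulr_ge0 ?powR_ge0.
have mp : 0 < m by rewrite lt_neqAle eq_sym mn.
have mpp : 0 < m `^ p by exact: powR_gt0.
rewrite (@le_trans _ _ (\sum_(i <- s) l i * (m `^ p * (1 + p * (x i / m - 1)))))//; last first.
  apply: ler_sum => i _; apply: ler_wpM2l => //.
  have -> : x i `^ p = m `^ p * (x i / m) `^ p.
    by rewrite -powRM ?divr_ge0// mulrC divfK.
  by rewrite ler_pM2l// powR_bernoulli// divr_ge0.
rewrite (eq_bigr (fun i => m `^ p * (1 - p) * l i + m `^ p * p / m * (l i * x i))); last by move=> i _; ring.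
rewrite big_split /= -!mulr_sumr l1 -/m.
by rewrite (_ : _ + _ = m `^ p)//; field.
Qed.

Lemma powRD_le p x y : 0 < p -> 0 <= x -> 0 <= y -> (x + y) `^ p <= 2 `^ p * (x `^ p + y `^ p).
Proof.
move=> p0 x0 y0; wlog xy : x y x0 y0 / x <= y.
  move=> H; have [xy|/ltW yx] := leP x y; first exact: H.
  by rewrite addrC [x `^ p + _]addrC; exact: H.
rewrite (@le_trans _ _ ((2 * y) `^ p))//.
  by apply: ge0_ler_powR; rewrite ?nnegrE ?addr_ge0 ?mulr_ge0 ?(ltW p0)//; lra.
by rewrite powRM// ler_pM2l ?powR_gt0// lerDr powR_ge0.
Qed.

Lemma cvg_powR p (u : nat -> R) x : 0 < p -> (forall n, 0 <= u n) ->
  u n @[n --> \oo] --> x -> u n `^ p @[n --> \oo] --> x `^ p.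
Proof.
move=> p0 u0 ux.
have x0 : 0 <= x by rewrite -(cvg_lim _ ux)//; apply: limr_ge; [exact: cvgP ux|exact: nearW].
have [xe|xn] := eqVneq x 0; last first.
  have xp : 0 < x by rewrite lt_neqAle eq_sym xn.
  have : {for x, continuous ((@powR R)^~ p)}.
    apply: differentiable_continuous; apply/derivable1_diffP.
    by apply: derivable_powR; rewrite in_itv /= xp.
  by move=> c; exact: (cvg_comp u _ ux c).
(* The derivative argument needs a positive limit, so continuity at 0 is checked directly with
   threshold e^(1/p). *)
rewrite xe powR0 ?gt_eqF//; apply/cvgrPdist_lt => e e0.
have e' : 0 < e `^ p^-1 by exact: powR_gt0.
move: ux => /cvgrPdist_lt/(_ _ e'); rewrite xe; apply: filterS => n.
rewrite !sub0r !normrN (ger0_norm (u0 n)) (ger0_norm (powR_ge0 _ _)) => h.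
have -> : e = (e `^ p^-1) `^ p by rewrite -powRrM mulVf ?gt_eqF// powRr1// ltW.
by apply: gt0_ltr_powR => //; rewrite nnegrE// ltW.
Qed.

End PowR.

Section Contraction.
Variable R : realType.
Local Notation D := (@disc R).
Local Notation rad := (@rad R).
Variables (p : R) (eta : R -> R).
Hypothesis p1 : 1 <= p.
Hypothesis eta0 : forall r, 0 <= r < 1 -> 0 <= eta r.
Hypothesis meta : measurable_fun D (fun q => eta (rad q)).
Implicit Types (F G : R * R -> R[i]) (a : nat -> R[i]).

Let p0 : 0 < p. Proof. exact: lt_le_trans ltr01 p1. Qed.

Definition wfun F q : \bar R := (cabs (F q) `^ p * eta (rad q))%:E.

Definition wint F : \bar R := dAint (wfun F).

Lemma eta_rad_ge0 q : D q -> 0 <= eta (rad q).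
Proof. by move=> qD; apply: eta0; rewrite cabs_ge0. Qed.

Lemma wfun_ge0 F q : D q -> (0 <= wfun F q)%E.
Proof. by move=> qD; rewrite lee_fin mulr_ge0 ?powR_ge0 ?eta_rad_ge0. Qed.

Lemma measurable_cabs_powR F : cmeas F -> measurable_fun D (fun q => cabs (F q) `^ p).
Proof.
by move=> /cmeas_cabs mF; apply: (@measurableT_comp _ _ _ _ _ _ (fun x => x `^ p)) => //; exact: measurable_powR.
Qed.

Lemma wint_ge0 F : (0 <= wint F)%E.
Proof. by apply: dAint_ge0 => q; exact: wfun_ge0. Qed.

Lemma wint_meas F : cmeas F -> measurable_fun D (wfun F).
Proof.
by move=> mF; apply/measurable_EFinP; apply: measurable_funM => //; exact: measurable_cabs_powR.
Qed.

Lemma wint_rot (c : R[i]) F : cabs c = 1 -> cmeas F -> wint (fun q => F (rot c q)) = wint F.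
Proof.
move=> c1 mF; rewrite /wint -[RHS](dAint_rot c1 (wint_meas mF) (@wfun_ge0 F)).
by apply: eq_dAint => q _; rewrite /wfun rad_rot.
Qed.

(** Pointwise Jensen with the weights [fejl], whose sum is 1, followed by rotation invariance: every
    rotated copy has the same weighted integral. *)
Lemma wint_fejD a N M : rad1 a -> (0 < N)%N ->
  (wint (fun q => fejD a N (M + N) (cplx q)) <= wint (fun q => ps a (cplx q)))%E.
Proof.
move=> ha N0; set K := (M + N)%N; set P := fun q => ps a (cplx q).
have K0 : (0 < K)%N by rewrite addn_gt0 N0 orbT.
have hx := prootP R K0.
pose l k := fejl K N (proot R K) k.
have l0 k : 0 <= l k by exact: fejl_ge0.
have l1 : \sum_(k < K) l k = 1 by apply: fejl_sum1 => //; exact: leq_addl.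
have c1 k : cabs (proot R K ^+ k) = 1 by rewrite cabsX (cabs_prim_root hx) ?expr1n.
have mP : cmeas P by exact: cmeas_ps.
pose Pr k q := P (rot (proot R K ^+ k) q).
have mPr k : cmeas (Pr k) by exact: cmeas_rot.
have mZ k : measurable_fun D (fun q => ((l k)%:E * wfun (Pr k) q)%E).
  by apply: measurable_funeM; exact: (wint_meas (mPr k)).
suff : (wint (fun q => fejD a N K (cplx q)) <= dAint (fun q => \sum_(k < K) (l k)%:E * wfun (Pr k) q))%E.
  move=> /le_trans; apply.
  rewrite dAint_sum; last 2 first.
  - by move=> k; exact: mZ.
  - by move=> k q qD; apply: mule_ge0; [rewrite lee_fin|exact: wfun_ge0].
  under eq_bigr => k _.
    rewrite dAintZ//; last 2 first.
    - exact: (wint_meas (mPr k)).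
    - exact: wfun_ge0.
    rewrite (_ : dAint _ = wint P); last exact: (@wint_rot _ P).
    over.
  rewrite -ge0_sume_distrl; last by move=> k _; rewrite lee_fin.
  by rewrite sumEFin l1 mul1e.
apply: le_dAint.
- apply: wint_meas; apply: cmeas_sum => k; apply: cmeasM; first exact: cmeas_cst.
  apply: cmeas_eq (mPr k) => q _; by rewrite /Pr /P cplx_rot.
- exact: (@emeasurable_sum _ _ R D _ _ (fun (k : 'I_K) q => (l k)%:E * wfun (Pr k) q)%E).
- exact: wfun_ge0.
- move=> q qD; rewrite /wfun sumEFin lee_fin.
  under eq_bigr do rewrite mulrA.
  rewrite -mulr_suml ler_wpM2r ?eta_rad_ge0//.
  rewrite (le_trans _ (@powR_jensen _ p _ _ (fun k : 'I_K => l k) (fun k : 'I_K => cabs (Pr k q)) p1 _ _ _))//; last by move=> k; exact: cabs_ge0.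
  apply: ge0_ler_powR; rewrite ?nnegrE ?cabs_ge0 ?(ltW p0) ?sumr_ge0//.
    by move=> k _; rewrite mulr_ge0 ?cabs_ge0.
  rewrite (le_trans (cabs_sum _ _ _))//; apply: ler_sum => k _.
  by rewrite cabsM cabs_real (ger0_norm (l0 k)) /Pr /P cplx_rot.
Qed.

(** Fatou's lemma as the order of the roots of unity grows. The constant 1 makes all later estimates
    uniform in N. *)
Lemma wint_fejS a N : rad1 a -> (0 < N)%N ->
  (wint (fun q => fejS a N (cplx q)) <= wint (fun q => ps a (cplx q)))%E.
Proof.
move=> ha N0.
apply: (@dAint_fatou _ (fun M => wfun (fun q => fejD a N (M + N) (cplx q)))).
- move=> M; apply: wint_meas; apply: cmeas_sum => k; apply: cmeasM; first exact: cmeas_cst.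
  have hx := prootP R (ltn_addl M N0).
  have c1 : cabs (proot R (M + N) ^+ k) = 1 by rewrite cabsX (cabs_prim_root hx) ?ltn_addl// expr1n.
  by apply: cmeas_eq (cmeas_rot c1 (cmeas_ps ha)) => q _; rewrite cplx_rot.
- by move=> M q; exact: wfun_ge0.
- move=> q qD; apply: cvg_EFin; first exact: nearW.
  apply: cvgM; last exact: cvg_cst.
  apply: cvg_powR => //; first by move=> n; exact: cabs_ge0.
  by apply: ccvg_cabs; exact: fejD_cvg.
- by move=> M; exact: wint_fejD.
Qed.

Lemma fejS1 a z : fejS a 1 z = a 0%N.
Proof. by rewrite /fejS big_nat1 /fejw subn0 divr1 expr0 mulr1 mul1r. Qed.

(** The first Fejer mean is the constant a_0, so contractivity for N = 1 is already the
    sub-mean-value inequality. *)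
Lemma wint_coef0 a : rad1 a ->
  ((cabs (a 0%N) `^ p)%:E * dAint (fun q => (eta (rad q))%:E) <= wint (fun q => ps a (cplx q)))%E.
Proof.
move=> ha; apply: le_trans (wint_fejS ha (ltn0Sn 0)).
have me : measurable_fun D (fun q => (eta (rad q))%:E) by exact/measurable_EFinP.
have e0 q : D q -> (0 <= (eta (rad q))%:E)%E by move=> qD; rewrite lee_fin eta_rad_ge0.
rewrite -(dAintZ me (powR_ge0 (cabs (a 0%N)) p) e0) /wint le_eqVlt; apply/orP; left; apply/eqP.
by apply: eq_dAint => q _; rewrite /wfun fejS1 EFinM.
Qed.

(** The Riesz-Scheffe argument: pointwise convergence plus control of the norms. If the distance
    stayed at least e beyond N0, the nonnegative functions 2^p (|S|^p + |f|^p) eta - |S - f|^p eta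
    would have integrals at most K - e, whereas Fatou gives at least K for their limit. *)
Lemma wint_cvg a : rad1 a -> (wint (fun q => ps a (cplx q)) < +oo)%E ->
  forall (e : R) N0, 0 < e -> exists2 N, (N0 < N)%N &
  (wint (fun q => (fejS a N (cplx q) - ps a (cplx q))%R) < e%:E)%E.
Proof.
move=> ha If e N0 e0; apply: contrapT => hN.
pose P q := ps a (cplx q); pose S N q := fejS a N (cplx q).
have mP : cmeas P by exact: cmeas_ps.
have mS N : cmeas (S N) by exact: cmeas_fejS.
have mSP N : cmeas (fun q => S N q - P q).
  apply: cmeasD => //; apply: cmeas_eq (cmeasM (cmeas_cst (-1)) mP) => q _; by rewrite mulN1r.
have fP : (wint P \is a fin_num)%E by by rewrite ge0_fin_numE ?wint_ge0.
pose Nn n := (n + N0).+1.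
pose dS n q := S (Nn n) q - P q.
pose h n q := ((2 `^ p)%:E * (wfun (S (Nn n)) q + wfun P q))%E.
pose H n q := (h n q - wfun (dS n) q)%E.
have HE n q : H n q = (2 `^ p * (cabs (S (Nn n) q) `^ p * eta (rad q) + cabs (P q) `^ p * eta (rad q))
    - cabs (dS n q) `^ p * eta (rad q))%:E by rewrite EFinB EFinM EFinD.
have h0 n q : D q -> (0 <= h n q)%E.
  by move=> qD; apply: mule_ge0; [rewrite lee_fin powR_ge0|apply: adde_ge0; exact: wfun_ge0].
have mh n : measurable_fun D (h n).
  by apply: measurable_funeM; apply: emeasurable_funD; exact: wint_meas.
have mH n : measurable_fun D (H n).
  by apply: emeasurable_funB; [exact: mh|exact: (wint_meas (mSP (Nn n)))].
have H0 n q : D q -> (0 <= H n q)%E.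
  move=> qD; rewrite HE lee_fin subr_ge0 -mulrDl mulrA.
  rewrite ler_wpM2r ?eta_rad_ge0// (le_trans _ (powRD_le p0 (cabs_ge0 _) (cabs_ge0 _)))//.
  by apply: ge0_ler_powR; rewrite ?nnegrE ?addr_ge0 ?cabs_ge0 ?(ltW p0)// (le_trans (cabsD _ _))// cabsN.
have hH n : (dAint (H n) + wint (dS n) = dAint (h n))%E.
  rewrite -dAintD//; [|exact: (wint_meas (mSP (Nn n)))|by move=> q; exact: H0|exact: wfun_ge0].
  by apply: eq_dAint => q _; rewrite /H subeK.
have hh n : (dAint (h n) <= (2 `^ p)%:E * (wint P + wint P))%E.
  rewrite dAintZ ?powR_ge0//; last 2 first.
  - by apply: emeasurable_funD; exact: wint_meas.
  - by move=> q qD; rewrite adde_ge0 ?wfun_ge0.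
  rewrite lee_wpmul2l ?lee_fin ?powR_ge0// dAintD; [|exact: wint_meas|exact: wint_meas|exact: wfun_ge0|exact: wfun_ge0].
  exact: leeD2r _ (wint_fejS ha (ltn0Sn _)).
have eS n : (e%:E <= wint (dS n))%E.
  by rewrite leNgt; apply/negP => l; apply: hN; exists (Nn n) => //; rewrite ltnS leq_addl.
set K := ((2 `^ p)%:E * (wint P + wint P))%E.
have fK : K \is a fin_num by rewrite /K fin_numM// fin_numD fP.
have HK n : (dAint (H n) <= K - e%:E)%E.
  rewrite leeBrDr//; apply: le_trans (hh n); rewrite -hH; exact: leeD2l.
have := @dAint_fatou _ H (fun q => (2 `^ p)%:E * (wfun P q + wfun P q))%E (K - e%:E)%E mH H0 _ HK.
rewrite dAintZ ?powR_ge0//; last 2 first.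
- by apply: emeasurable_funD; exact: wint_meas.
- by move=> q qD; rewrite adde_ge0 ?wfun_ge0.
rewrite dAintD; [|exact: wint_meas|exact: wint_meas|exact: wfun_ge0|exact: wfun_ge0].
have cH q : D q -> (H n q @[n --> \oo] --> (2 `^ p)%:E * (wfun P q + wfun P q))%E.
  move=> qD; have cS := ccvg_shift N0.+1 (fejS_cvg ha qD).
  have cS' : (fun n => cabs (S (Nn n) q)) @ \oo --> cabs (P q).
    by have := ccvg_cabs cS; under eq_fun do rewrite addnS.
  have cd : (fun n => cabs (dS n q)) @ \oo --> (0 : R).
    by have := (ccvgP _ _).1 cS; under eq_fun do rewrite addnS.
  have k1 := cvg_powR p0 (fun n => cabs_ge0 _) cS'.
  have k2 := cvg_powR p0 (fun n => cabs_ge0 _) cd.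
  rewrite powR0 ?gt_eqF// in k2.
  under eq_fun do rewrite HE.
  rewrite /wfun -EFinD -EFinM; apply: cvg_EFin; first exact: nearW.
  rewrite -[X in _ --> X]subr0 -[X in _ - X](mul0r (eta (rad q))).
  apply: cvgB; last by apply: cvgM; [exact: k2|exact: cvg_cst].
  apply: cvgM; first exact: cvg_cst.
  apply: cvgD; last exact: cvg_cst.
  by apply: cvgM; [exact: k1|exact: cvg_cst].
rewrite -/K => /(_ cH).
by rewrite leeBrDr// -{2}(adde0 K) leeD2lE// lee_fin leNgt e0.
Qed.

End Contraction.

(** * Radial weights, moments and the Bergman projection *)

Section RadialWeights.
Variable R : realType.
Local Notation D := (@disc R).
Local Notation rad := (@rad R).
Local Notation leb := (@lebesgue_measure R).
Local Notation I01 := (`[(0 : R), 1[%classic : set R).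
Implicit Types (w : R -> R).

Let mI : measurable I01. Proof. exact: measurable_itv. Qed.

Lemma rad_in01 q : D q -> 0 <= rad q < 1.
Proof. by move=> qD; rewrite cabs_ge0. Qed.

Lemma measurable_radial d (T : measurableType d) (h : R -> T) :
  measurable_fun I01 h -> measurable_fun D (fun q => h (rad q)).
Proof.
move=> mh; apply: (@measurable_comp _ _ _ _ _ _ I01) => //.
  by move=> _ [q qD <-] /=; rewrite in_itv/= rad_in01.
exact: measurable_funTS (@measurable_cplx_cabs R).
Qed.

Lemma dAint_radial_ex : exists2 k : R, 0 < k & forall h : R -> \bar R,
  measurable_fun I01 h -> (forall r, 0 <= r < 1 -> (0 <= h r)%E) ->
  dAint (fun q => h (rad q)) = ((2 * k)%:E * \int[leb]_(r in I01) (h r * r%:E))%E.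
Proof.
have [k k0 hk] := polar R.
exists (pi^-1 * k / 2); first by rewrite divr_gt0// mulr_gt0// invr_gt0 pi_gt0.
move=> h mh h0; rewrite /dAint hk// muleA -EFinM.
by rewrite [2 * _]mulrC divfK.
Qed.

(* The area of the disc for dA; it equals 1, but its value is never needed. *)
Definition kap : R := sval (cid2 dAint_radial_ex).

Lemma kap_gt0 : 0 < kap.
Proof. by rewrite /kap; case: cid2. Qed.

Lemma dAint_radial (h : R -> \bar R) :
  measurable_fun I01 h -> (forall r, 0 <= r < 1 -> (0 <= h r)%E) ->
  dAint (fun q => h (rad q)) = ((2 * kap)%:E * \int[leb]_(r in I01) (h r * r%:E))%E.
Proof. by rewrite /kap; case: cid2 => /= k _ H; exact: H. Qed.

Lemma radial_weight_ge0 w r : radial_weight w -> 0 <= r < 1 -> 0 <= w r.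
Proof. by move=> [w0 _]; exact: w0. Qed.

Lemma radial_weight_meas w : radial_weight w -> measurable_fun I01 w.
Proof. by move=> [_ [/measurable_int/measurable_EFinP]]. Qed.

Lemma radial_weight_measD w : radial_weight w -> measurable_fun D (fun q => w (rad q)).
Proof. by move=> /radial_weight_meas; exact: measurable_radial. Qed.

Lemma radial_weight_int w : radial_weight w -> (\int[leb]_(r in I01) (w r)%:E < +oo)%E.
Proof.
move=> [w0 [/integrableP[_ iw] _]]; apply: le_lt_trans iw; rewrite le_eqVlt; apply/orP; left; apply/eqP.
by apply: eq_integral => r; rewrite inE/= in_itv/= => r01; rewrite ger0_norm ?w0.
Qed.

Section Moment.
Variable w : R -> R.
Hypothesis rw : radial_weight w.

Let w0 r : 0 <= r < 1 -> 0 <= w r := radial_weight_ge0 rw (r := r).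
Let mw := radial_weight_meas rw.

Lemma moment_meas n : measurable_fun I01 (fun r => (r ^+ n * w r)%:E).
Proof.
apply/measurable_EFinP; apply: measurable_funM => //.
Qed.

Lemma momentE n : (moment w n)%:E = (\int[leb]_(r in I01) (r ^+ n * w r)%:E)%E.
Proof.
rewrite /moment fineK// ge0_fin_numE; last first.
  by apply: integral_ge0 => r /=; rewrite in_itv/= => /andP[r0 r1]; rewrite lee_fin mulr_ge0 ?exprn_ge0// w0// r0.
apply: le_lt_trans (radial_weight_int rw).
apply: ge0_le_integral => //.
- by move=> r /=; rewrite in_itv/= => /andP[r0 r1]; rewrite lee_fin mulr_ge0 ?exprn_ge0// w0// r0.
- exact: moment_meas.
- exact/measurable_EFinP.
- move=> r /=; rewrite in_itv/= => /andP[r0 r1]; rewrite lee_fin ler_piMl ?w0 ?r0//.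
  by rewrite exprn_ile1// ltW.
Qed.

Lemma omegahat_gt0_fin r : 0 <= r < 1 -> exists2 c, 0 < c & omegahat w r = c%:E.
Proof.
move=> r01; have [_ [_ /(_ r r01) h0]] := rw.
have f : omegahat w r \is a fin_num.
  rewrite ge0_fin_numE ?ltW//; apply: le_lt_trans (radial_weight_int rw).
  apply: ge0_subset_integral => //.
  - exact/measurable_EFinP.
  - move=> s /=; rewrite !in_itv/= => /andP[rs s1]; rewrite s1 andbT.
    by case/andP: r01 => r0 _; exact: le_trans rs.
by exists (fine (omegahat w r)); rewrite ?fineK// fine_gt0// h0 -ge0_fin_numE// ltW.
Qed.

Lemma moment_ge n r c : 0 <= r < 1 -> omegahat w r = c%:E -> r ^+ n * c <= moment w n.
Proof.
move=> r01 hc; have /andP[r0 r1] := r01.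
have sub : `[r, 1[ `<=` I01.
  by move=> s /=; rewrite !in_itv/= => /andP[rs ->]; rewrite andbT (le_trans r0).
rewrite -lee_fin momentE EFinM -hc /omegahat -ge0_integralZl//; last 3 first.
- by apply: measurable_funS (mI) sub _; exact/measurable_EFinP.
- by move=> s /sub/=; rewrite in_itv/= => s01; rewrite lee_fin w0.
- exact: exprn_ge0.
apply: (@le_trans _ _ (\int[leb]_(s in `[r, 1%R[) (s ^+ n * w s)%:E)%E).
  apply: ge0_le_integral => //.
  - by move=> s /sub/=; rewrite in_itv/= => s01; rewrite mule_ge0 ?lee_fin ?exprn_ge0 ?w0.
  - apply: measurable_funeM; by apply: measurable_funS (mI) sub _; exact/measurable_EFinP.
  - by apply: measurable_funS (mI) sub _; exact: moment_meas.
  - move=> s /[dup] /sub/=; rewrite !in_itv/= => s01 /andP[rs _]; rewrite -EFinM lee_fin.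
    by rewrite ler_wpM2r ?w0// lerXn2r// nnegrE// (le_trans r0).
apply: ge0_subset_integral => //; first exact: moment_meas.
by move=> s /=; rewrite in_itv/= => /andP[s0 s1]; rewrite lee_fin mulr_ge0 ?exprn_ge0// w0// s0.
Qed.

Lemma moment_gt0 n : 0 < moment w n.
Proof.
have h : 0 <= (2^-1 : R) < 1 by rewrite invr_ge0 ler0n invf_lt1 ?ltr1n.
have [c c0 hc] := omegahat_gt0_fin h.
apply: lt_le_trans (moment_ge n h hc).
by rewrite mulr_gt0 ?exprn_gt0.
Qed.

(** The tail integral c of w beyond s is positive, so w_(2n+1) >= s^(2n+1) c. Choosing s^2 = (1 + r)
    / 2 >= r bounds r^n / w_(2n+1). *)
Lemma rad1_bcoef : rad1 (bcoef w).
Proof.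
apply: rad1_bounded => r /andP[r0 r1].
pose s := Num.sqrt ((1 + r) / 2); have s2 : s ^+ 2 = (1 + r) / 2.
  by rewrite sqr_sqrtr//; lra.
have s0 : 0 < s by rewrite sqrtr_gt0; lra.
have s1 : s < 1 by rewrite -sqrtr1 ltr_sqrt//; lra.
have s01 : 0 <= s < 1 by rewrite s1 ltW.
have [c c0 hc] := omegahat_gt0_fin s01.
exists ((2 * s * c)^-1) => n.
have := moment_ge (2 * n + 1) s01 hc; set m := moment _ _ => hm.
have m0 : 0 < m by exact: moment_gt0.
rewrite /bcoef cabs_real ger0_norm ?invr_ge0 ?mulr_ge0 ?(ltW m0)// -/m.
rewrite -[leRHS]mul1r ler_pdivlMr; last by rewrite !mulr_gt0.
rewrite mulrAC -mulrA mulrC ler_pdivrMr ?mulr_gt0// mul1r.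
rewrite [leLHS](_ : _ = 2 * (r ^+ n * (s * c))); last by ring.
rewrite ler_pM2l// (le_trans _ hm)// addn1 exprSr -!mulrA ler_wpM2r ?mulr_ge0 ?(ltW s0) ?(ltW c0)//.
by rewrite exprM lerXn2r ?nnegrE// s2; lra.
Qed.

Lemma dAint_moment n : dAint (fun q => (rad q ^+ n.*2 * w (rad q))%:E) = (2 * kap * moment w (2 * n + 1))%:E.
Proof.
rewrite (@dAint_radial (fun r => (r ^+ n.*2 * w r)%:E)); last 2 first.
- exact: moment_meas.
- by move=> r /andP[r0 r1]; rewrite lee_fin mulr_ge0 ?exprn_ge0// w0// r0.
rewrite [in RHS]EFinM momentE; congr (_ * _)%E; apply: eq_integral => r _.
by rewrite -EFinM mul2n addn1 exprSr mulrAC.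
Qed.

Lemma dAint_weight_lty : (dAint (fun q => (w (rad q))%:E) < +oo)%E.
Proof.
have := dAint_moment 0; under eq_fun do rewrite mul1r.
by move=> ->; rewrite ltry.
Qed.

Lemma dAint_weight_gt0 : (0 < dAint (fun q => (w (rad q))%:E))%E.
Proof.
have := dAint_moment 0; under eq_fun do rewrite mul1r.
by move=> ->; rewrite lte_fin !mulr_gt0 ?kap_gt0 ?moment_gt0.
Qed.

End Moment.
End RadialWeights.

(** * Coefficients of the Bergman projection *)

Section Coefficients.
Variable R : realType.
Local Notation D := (@disc R).
Local Notation rad := (@rad R).
Local Notation kap := (@kap R).
Variable w : R -> R.
Hypothesis rw : radial_weight w.
Implicit Types (f g : R[i] -> R[i]) (a b : nat -> R[i]).

Let w0 q : D q -> 0 <= w (rad q).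
Proof. by move=> qD; exact: radial_weight_ge0 rw (rad_in01 qD). Qed.

Let mw : measurable_fun D (fun q => w (rad q)) := radial_weight_measD rw.

Lemma conjcM (x y : R[i]) : conjc (x * y) = conjc x * conjc y.
Proof. exact: (rmorphM (@conjc R)). Qed.

Lemma conjcX (x : R[i]) n : conjc (x ^+ n) = conjc x ^+ n.
Proof. exact: (rmorphXn (@conjc R)). Qed.

Lemma conjc_sum (I : Type) (s : seq I) (F : I -> R[i]) :
  conjc (\sum_(i <- s) F i) = \sum_(i <- s) conjc (F i).
Proof. exact: (raddf_sum (@conjc R)). Qed.

Definition mon n : R[i] -> R[i] := fun z => z ^+ n.

Lemma cmeasurable_mon n : cmeasurable (mon n).
Proof. exact: cmeasX (@cmeas_cplx R). Qed.

Lemma cabs_mon n q : D q -> cabs (mon n (cplx q)) <= 1.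
Proof. by move=> qD; rewrite cabsX exprn_ile1 ?cabs_ge0// ltW. Qed.

(** The space L^1_w. Monomials and, for fixed z, the kernel are bounded on the disc, so for these f
    all coefficients and the integral defining P_w f converge. *)
Definition L1w f := cmeasurable f /\ (dAint (fun q => (cabs (f (cplx q)) * w (rad q))%:E) < +oo)%E.

Lemma pair_int_cmeas f g : cmeasurable f -> cmeasurable g -> cmeas (pair_int w g f).
Proof.
move=> mf mg; apply: cmeasM; last exact: cmeas_real.
by apply: cmeasM => //; exact: cmeas_conj.
Qed.

Lemma cabs_pair_int f g q : D q -> cabs (pair_int w g f q) = cabs (f (cplx q)) * cabs (g (cplx q)) * w (rad q).
Proof. by move=> qD; rewrite /pair_int !cabsM cabs_conj cabs_real ger0_norm ?w0. Qed.

Lemma cabs_mul_w_meas f : cmeasurable f -> measurable_fun D (fun q => (cabs (f (cplx q)) * w (rad q))%:E).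
Proof. by move=> mf; apply/measurable_EFinP; apply: measurable_funM => //; exact: (cmeas_cabs mf). Qed.

Lemma pair_absint_le f g (M : R) : cmeasurable f -> cmeasurable g -> 0 <= M ->
  (forall q, D q -> cabs (g (cplx q)) <= M) ->
  (absint (pair_int w g f) <= M%:E * dAint (fun q => (cabs (f (cplx q)) * w (rad q))%:E))%E.
Proof.
move=> mf mg M0 hg; have mfw := cabs_mul_w_meas mf.
have f0 q : D q -> (0 <= (cabs (f (cplx q)) * w (rad q))%:E)%E.
  by move=> qD; rewrite lee_fin mulr_ge0 ?cabs_ge0 ?w0.
rewrite -(dAintZ mfw M0 f0); apply: le_dAint.
- exact: meas_cabsE (pair_int_cmeas mf mg).
- exact: measurable_funeM.
- by move=> q _; rewrite lee_fin cabs_ge0.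
- move=> q qD; rewrite -EFinM lee_fin cabs_pair_int// mulrA ler_wpM2r ?w0//.
  by rewrite mulrC ler_wpM2r ?cabs_ge0 ?hg.
Qed.

Lemma L1w_cintegrable f g (M : R) : L1w f -> cmeasurable g -> 0 <= M ->
  (forall q, D q -> cabs (g (cplx q)) <= M) -> cintegrable (pair_int w g f).
Proof.
move=> [mf If] mg M0 hg; apply: cintegrableP; first exact: pair_int_cmeas.
apply: le_lt_trans (pair_absint_le mf mg M0 hg) _.
by rewrite lte_mul_pinfty ?lee_fin.
Qed.

Lemma L1w_bounded f (M : R) : cmeasurable f -> 0 <= M -> (forall q, D q -> cabs (f (cplx q)) <= M) -> L1w f.
Proof.
move=> mf M0 hf; split=> //.
have mwE : measurable_fun D (fun q => (w (rad q))%:E) by exact/measurable_EFinP.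
have w0E q : D q -> (0 <= (w (rad q))%:E)%E by move=> qD; rewrite lee_fin w0.
apply: (@le_lt_trans _ _ (M%:E * dAint (fun q => (w (rad q))%:E))%E); last first.
  by rewrite lte_mul_pinfty ?lee_fin// dAint_weight_lty.
rewrite -(dAintZ mwE M0 w0E); apply: le_dAint.
- exact: cabs_mul_w_meas.
- exact: measurable_funeM.
- by move=> q qD; rewrite lee_fin mulr_ge0 ?cabs_ge0 ?w0.
- by move=> q qD; rewrite -EFinM lee_fin ler_wpM2r ?w0 ?hf.
Qed.

Lemma L1w_mon n : L1w (mon n).
Proof. by apply: (@L1w_bounded _ 1) => //; [exact: cmeasurable_mon|exact: cabs_mon]. Qed.

Lemma mon_pair_int n f : L1w f -> cintegrable (pair_int w (mon n) f).
Proof. by move=> hf; apply: (@L1w_cintegrable f (mon n) 1) => //; [exact: cmeasurable_mon|exact: cabs_mon]. Qed.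

(** Rotating by a primitive root c of order n + m + 1 multiplies the pairing by c^n conj(c^m), which
    is not 1 when n and m differ; rotation invariance then forces 0. *)
Lemma Tg_mon m n : Tg w (mon m) (mon n) = if n == m then ((2 * kap * moment w (2 * m + 1))%:C)%C else 0.
Proof.
have iF := mon_pair_int m (L1w_mon n).
case: eqVneq => [->|nm].
  have e : dAint (fun q => (rad q ^+ m.*2 * w (rad q))%:E) = (2 * kap * moment w (2 * m + 1))%:E := dAint_moment rw m.
  rewrite /Tg /cint (_ : Rintegral _ _ (fun q => complex.Im _) = 0); last first.
    rewrite (_ : (fun q => _) = fun=> 0); first by rewrite Rintegral_cst ?mul0r//; exact: measurable_disc.
    by apply/funext => q; rewrite /pair_int /mon mul_conjc ImM /= mul0r mulr0 addr0.
  rewrite mulr0 /real_complex_def; congr Complex.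
  rewrite -[RHS]/(fine (2 * kap * moment w (2 * m + 1))%:E) -e /dAint.
  rewrite /Rintegral -[X in X * _]/(fine (pi^-1)%:E) -fineM//; last first.
    by case: (mon_pair_int m (L1w_mon m)) => i1 _; apply: integrable_fin_num => //; exact: measurable_disc.
  congr fine; congr (_ * _)%E; apply: eq_integral => q _; congr EFin.
  by rewrite /pair_int /mon mul_conjc ReM /= mulr0 subr0 cabsX -exprM muln2.
pose c := proot R (n + m).+1; have hc : (n + m).+1.-primitive_root c := prootP R (ltn0Sn _).
have c1 : cabs c = 1 by exact: cabs_prim_root hc.
have := cint_rot c1 iF.
pose u := c ^+ n * conjc (c ^+ m).
have -> : cint (fun q => pair_int w (mon m) (mon n) (rot c q)) = u * cint (pair_int w (mon m) (mon n)).
  rewrite -cintZ//; apply: cint_eq => q _.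
  by rewrite /pair_int /mon cplx_rot rad_rot// !exprMn conjcM /u !mulrA; congr (_ * _); rewrite -!mulrA; congr (_ * _); rewrite mulrCA.
rewrite -/(Tg w (mon m) (mon n)) => /eqP; rewrite -subr_eq0 -{2}[Tg _ _ _]mul1r -mulrBl mulf_eq0 => /orP[|/eqP//].
rewrite subr_eq0 => /eqP u1; exfalso.
have : c ^+ n = c ^+ m.
  rewrite -[RHS]mul1r -u1 /u -mulrA [conjc _ * _]mulrC mul_conjc cabsX c1 !expr1n.
  by rewrite mulr1.
move/eqP; rewrite (eq_prim_root_expr hc) !modn_small ?ltnS ?leq_addl ?leq_addr//.
exact/negP.
Qed.

Lemma Tg_fejS a N m : (m < N)%N ->
  Tg w (mon m) (fejS a N) = ((fejw R N m)%:C)%C * (a m * ((2 * kap * moment w (2 * m + 1))%:C)%C).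
Proof.
move=> mN; rewrite /Tg.
pose H n q := (((fejw R N n)%:C)%C * a n) * pair_int w (mon m) (mon n) q.
have iH n : cintegrable (H n) by apply: cintegrableZ; exact: mon_pair_int (L1w_mon n).
rewrite (@cint_eq _ _ (fun q => \sum_(0 <= n < N) H n q)); last first.
  move=> q _; rewrite /pair_int /fejS !mulr_suml; apply: eq_bigr => n _.
  by rewrite /H /pair_int /mon !mulrA.
rewrite (cint_sum _ iH).2 (bigD1_seq m) ?mem_index_iota ?iota_uniq//= big1; last first.
  move=> n nm; rewrite /H cintZ; last exact: mon_pair_int (L1w_mon n).
  by rewrite -/(Tg w (mon m) (mon n)) Tg_mon (negbTE nm) mulr0.
rewrite addr0 /H cintZ; last exact: mon_pair_int (L1w_mon m).
by rewrite -/(Tg w (mon m) (mon m)) Tg_mon eqxx mulrA.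
Qed.

Lemma Tg_bound f m : cmeasurable f ->
  ((cabs (Tg w (mon m) f))%:E <= 2%:E * dAint (fun q => (cabs (f (cplx q)) * w (rad q))%:E))%E.
Proof.
move=> mf; have mp := pair_int_cmeas mf (cmeasurable_mon m).
apply: le_trans (cint_bound mp) _; rewrite lee_wpmul2l ?lee_fin//.
have := pair_absint_le mf (cmeasurable_mon m) ler01 (@cabs_mon m).
by rewrite mul1e.
Qed.

(** The Taylor series of an f in L^1_w need not be dominated up to the boundary. The identity is
    therefore proved for Fejer means, where it is a finite sum, and carried over by their
    convergence in L^1_w, that is [wint_cvg] with exponent 1. *)
Lemma Tg_coef a f m : rad1 a -> (forall z, cdisc z -> f z = ps a z) -> L1w f ->
  Tg w (mon m) f = a m * ((2 * kap * moment w (2 * m + 1))%:C)%C.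
Proof.
move=> ha fa hf; have [mf If] := hf; set K := _ * _.
have eta0 r : 0 <= r < 1 -> 0 <= w r by move=> ?; exact: radial_weight_ge0.
have we (F : R * R -> R[i]) : wint 1 w F = dAint (fun q => (cabs (F q) * w (rad q))%:E).
  by apply: eq_dAint => q _; rewrite /wfun powRr1 ?cabs_ge0.
have If' : (wint 1 w (fun q => ps a (cplx q)) < +oo)%E.
  by rewrite we (@eq_dAint _ _ (fun q => (cabs (f (cplx q)) * w (rad q))%:E))// => q qD; rewrite fa.
have key N (e : R) : (m < N)%N -> (wint 1 w (fun q => (fejS a N (cplx q) - ps a (cplx q))%R) < e%:E)%E ->
    cabs (((fejw R N m)%:C)%C * K - Tg w (mon m) f) <= 2 * e.
  move=> mN he; rewrite -(Tg_fejS a mN).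
  have mS : cmeasurable (fejS a N) := @cmeas_fejS _ a N.
  pose df z := fejS a N z + (-1) * f z.
  have mdf : cmeasurable df by apply: cmeasD => //; apply: cmeasM => //; exact: cmeas_cst.
  have LS : L1w (fejS a N).
    split => //; move: If'; rewrite -we; apply: le_lt_trans.
    apply: wint_fejS => //; exact: leq_ltn_trans mN.
  have -> : Tg w (mon m) (fejS a N) - Tg w (mon m) f = Tg w (mon m) df.
    have i1 := mon_pair_int m hf; have i2 := mon_pair_int m LS.
    have i3 := cintegrableZ (-1) i1.
    rewrite /Tg -[- cint _]mulN1r -(cintZ (-1) i1) -(cintD i2 i3).
    by apply: cint_eq => q _; rewrite /pair_int /df; ring.
  rewrite -lee_fin; apply: le_trans (Tg_bound m mdf) _.
  rewrite EFinM lee_wpmul2l ?lee_fin// -we; apply: le_trans (ltW he).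
  rewrite le_eqVlt; apply/orP; left; apply/eqP; apply: eq_dAint => q qD.
  by rewrite /wfun /df (fa _ qD) mulN1r.
have cK : ccvg (fun N => ((fejw R N m)%:C)%C * K) K.
  rewrite -[X in ccvg _ X]mul1r; apply: ccvgM; last exact: ccvg_cst.
  by split; [exact: fejw_cvg|exact: cvg_cst].
apply/eqP; rewrite -subr_eq0 -cabs_eq0 eq_le cabs_ge0 andbT; apply/ler_addgt0Pr => e e0; rewrite add0r.
have e4 : 0 < e / 4 by rewrite divr_gt0.
have /ccvgP/cvgrPdist_lt/(_ _ e4)[N1 _ hN1] := cK.
have [N hN he] := @wint_cvg _ 1 w (lexx _) eta0 mw a ha If' (e / 4) (m + N1)%N e4.
have h1 := key N _ (leq_ltn_trans (leq_addr _ _) hN) he.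
have := hN1 N (ltnW (leq_ltn_trans (leq_addl _ _) hN)).
rewrite sub0r normrN ger0_norm ?cabs_ge0// => h2.
rewrite cabsB -(subrK ((((fejw R N m)%:C)%C) * K) K) -addrA.
rewrite (le_trans (cabsD _ _))// [X in X + _]cabsB.
have e2 : 2 * (e / 4) = e / 2 by field.
rewrite e2 in h1.
have e3 : e = e / 2 + e / 2 by field.
rewrite e3 addrC; apply: lerD => //.
  by apply: ltW; apply: (lt_trans h2); rewrite ltr_pM2l// ltf_pV2 ?posrE ?ltr_nat.
by rewrite addrC.
Qed.

Definition Pcoef f (n : nat) := Tg w (mon n) f * bcoef w n.

Lemma rad1_Pcoef f : L1w f -> rad1 (Pcoef f).
Proof.
move=> [mf If]; apply: rad1_bounded => r r01.
have [C C0 hC] := rad1_bound (rad1_bcoef rw) r01.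
have r0 : 0 <= r by case/andP: r01.
set I := dAint _ in If; have I0 : (0 <= I)%E.
  by apply: dAint_ge0 => q qD; rewrite lee_fin mulr_ge0 ?cabs_ge0 ?w0.
have fI : I \is a fin_num by rewrite ge0_fin_numE.
exists (2 * fine I * C) => n; rewrite /Pcoef cabsM -mulrA ler_pM ?mulr_ge0 ?exprn_ge0 ?cabs_ge0//.
by rewrite -lee_fin EFinM fineK//; exact: Tg_bound.
Qed.

(** For fixed z the partial sums of the kernel are bounded on the whole disc by K, the sum of |b_n|
    |z|^n, so K |f| w is an integrable majorant and the series may be integrated termwise. *)
Lemma Pw_ps f z : L1w f -> cdisc z -> cintegrable (Pint w f z) /\ Pw w f z = ps (Pcoef f) z.
Proof.
move=> hf z1; have [mf If] := hf.
have cz1 : cabs (conjc z) < 1 by rewrite cabs_conj.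
have hb := rad1_bcoef rw.
have mI : measurable_fun D (fun q => cabs (f (cplx q)) * w (rad q)).
  by apply: measurable_funM => //; exact: cmeas_cabs.
pose T n q := bcoef w n * z ^+ n * pair_int w (mon n) f q.
pose S n q := \sum_(0 <= k < n) T k q.
have iT n : cintegrable (T n) by apply: cintegrableZ; exact: mon_pair_int.
have iS n : cintegrable (S n) by exact: (cint_sum _ iT).1.
have cb n : conjc (bcoef w n) = bcoef w n by rewrite /bcoef /conjc /= oppr0.
have cz q : D q -> cabs (conjc z * cplx q) < 1.
  by move=> qD; rewrite cabsM (le_lt_trans _ cz1)// ler_piMr ?cabs_ge0// ltW.
have SE n q : S n q = f (cplx q) * conjc (csums (fun k => bcoef w k * (conjc z * cplx q) ^+ k) n) * ((w (rad q))%:C)%C.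
  rewrite /S /csums conjc_sum mulr_sumr mulr_suml; apply: eq_bigr => k _.
  rewrite (conjcM (bcoef w k)) cb (conjcX (conjc z * cplx q)) (conjcM (conjc z)) conjcK.
  by rewrite /T /pair_int /mon conjcX exprMn; ring.
have cS q : D q -> ccvg (S ^~ q) (Pint w f z q).
  move=> qD; rewrite /Pint bergman_kernelE ?cz//; under eq_fun do rewrite SE.
  apply: ccvgM; last exact: ccvg_cst.
  by apply: ccvgM; [exact: ccvg_cst|apply: ccvg_conj; apply: ps_cvg; rewrite ?cz].
pose K := limn (series (fun n => cabs (bcoef w n) * cabs z ^+ n)).
have z01 : 0 <= cabs z < 1 by rewrite cabs_ge0.
have cK := hb _ z01.
have Sle n q : D q -> cabs (S n q) <= K * (cabs (f (cplx q)) * w (rad q)).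
  move=> qD; rewrite SE !cabsM cabs_conj cabs_real ger0_norm ?w0// mulrAC mulrC ler_wpM2r ?mulr_ge0 ?cabs_ge0 ?w0//.
  rewrite (le_trans (cabs_sum _ _ _))// (le_trans _ (nondecreasing_cvgn_le _ cK n))//.
    rewrite /series /=; apply: ler_sum => k _; rewrite cabsM ler_wpM2l ?cabs_ge0// cabsX.
    rewrite lerXn2r ?nnegrE ?cabs_ge0// cabsM cabs_conj ler_piMr ?cabs_ge0// ltW//.
  by apply: nondecreasing_series => k _ _; rewrite mulr_ge0 ?exprn_ge0 ?cabs_ge0.
have K0 : 0 <= K.
  apply: limr_ge => //; apply: nearW => n; apply: sumr_ge0 => k _.
  by rewrite mulr_ge0 ?exprn_ge0 ?cabs_ge0.
have mKI : measurable_fun D (fun q => K * (cabs (f (cplx q)) * w (rad q))).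
  by apply: measurable_funM => //; exact: measurable_cst.
have iKI : (dAint (fun q => (K * (cabs (f (cplx q)) * w (rad q)))%:E) < +oo)%E.
  under eq_fun do rewrite EFinM.
  rewrite dAintZ//; first by rewrite lte_mul_pinfty ?lee_fin.
    exact/measurable_EFinP.
  by move=> q qD; rewrite lee_fin mulr_ge0 ?cabs_ge0 ?w0.
have mS n : cmeas (S n) by exact: cintegrable_meas.
have mP : cmeas (Pint w f z) := cmeas_cvg mS cS.
split.
  apply: cintegrableP => //; apply: le_lt_trans iKI; apply: le_dAint.
  - exact: meas_cabsE.
  - exact/measurable_EFinP.
  - by move=> q _; rewrite lee_fin cabs_ge0.
  - move=> q qD; rewrite lee_fin -(cvg_lim _ (ccvg_cabs (cS q qD)))//.
    by apply: limr_le; [exact: cvgP (ccvg_cabs (cS q qD))|apply: nearW => n; exact: Sle].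
have := cint_dominated mS mKI iKI Sle cS.
have -> : (fun n => cint (S n)) = csums (fun n => Pcoef f n * z ^+ n).
  apply/funext => n; rewrite (cint_sum _ iT).2; apply: eq_bigr => k _.
  by rewrite /T (cintZ _ (mon_pair_int k hf)) /Pcoef -/(Tg w (mon k) f); ring.
by move=> h; rewrite /Pw; apply: ccvg_unique h _; apply: ps_cvg => //; exact: rad1_Pcoef.
Qed.

Lemma Pw_analytic f : L1w f -> analytic_in_disc (Pw w f).
Proof.
by move=> hf; apply: (analytic_ps (rad1_Pcoef hf)) => z z1; case: (Pw_ps hf z1).
Qed.

(** Coefficient by coefficient, the moment produced by [Tg_coef] cancels the one in [bcoef] and
    leaves the area constant. *)
Lemma Pw_reproduce a f z : rad1 a -> (forall z, cdisc z -> f z = ps a z) -> L1w f -> cdisc z ->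
  Pw w f z = (kap%:C)%C * f z.
Proof.
move=> ha fa hf z1; rewrite (Pw_ps hf z1).2 fa// /ps -(@cserZ _ _ (kap%:C)%C (rad1_summable ha z1)).
congr cser; apply/funext => n; rewrite /Pcoef (Tg_coef n ha fa hf) /bcoef.
have m0 : moment w (2 * n + 1) != 0 by rewrite gt_eqF// moment_gt0.
rewrite -[a n * _ * _]mulrA -rmorphM /= [X in (X%:C)%C](_ : _ = kap); last by field.
by rewrite [a n * _]mulrC mulrA.
Qed.

End Coefficients.

(** * The dual weight *)

Lemma powRV (R : realType) (x t : R) : 0 <= x -> x^-1 `^ t = (x `^ t)^-1.
Proof. by move=> x0; rewrite -powRN -mulN1r powRrM powR_inv1. Qed.

Section DualWeight.
Variable R : realType.
Local Notation D := (@disc R).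
Local Notation rad := (@rad R).
Local Notation I01 := (`[(0 : R), 1[%classic : set R).
Variables (p : R) (w nu : R -> R).
Hypothesis p1 : 1 < p.
Hypothesis rw : radial_weight w.
Hypothesis rn : radial_weight nu.
Local Notation p' := (conj_exp p).
Local Notation sig := (sigma p w nu).
Local Notation nuE := (fun r => (nu r)%:E).
Implicit Types (f g : R[i] -> R[i]).

Let p0 : 0 < p := lt_trans ltr01 p1.
Let pm1 : 0 < p - 1. Proof. by rewrite subr_gt0. Qed.

Lemma conj_exp_gt0 : 0 < p'.
Proof. exact: divr_gt0. Qed.

Lemma conj_exp_gt1 : 1 < p'.
Proof. by rewrite /conj_exp ltr_pdivlMr// mul1r ltrBlDr ltrDl. Qed.

Lemma conj_exp_inv : p'^-1 + p^-1 = 1.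
Proof. by rewrite /conj_exp invf_div; field; rewrite gt_eqF. Qed.

Lemma conj_expB1 : (p - 1) * p' = p.
Proof. by rewrite /conj_exp mulrC divfK// gt_eqF. Qed.

Lemma conj_expB1' : (p' - 1) * p = p'.
Proof. by rewrite /conj_exp; field; rewrite gt_eqF. Qed.

Lemma sigma0 r : w r = 0 -> sig r = 0%E.
Proof.
move=> wr; rewrite /sigma wr eqxx; case: ifP => // _.
by rewrite mul0r powR0// gt_eqF// conj_exp_gt0.
Qed.

Lemma sigma_infty r : nu r = 0 -> w r != 0 -> sig r = +oo%E.
Proof. by rewrite /sigma => -> /negbTE ->; rewrite eqxx. Qed.

(** The factorization w = s^(1/p') nu^(1/p) is what Young's inequality and the estimate of phi rest
    on; the formula for s^(p-1) serves the test functions built from sigma. *)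
Lemma sigma_pos r : 0 < nu r -> 0 < w r ->
  exists s, [/\ sig r = s%:E, 0 < s, s `^ (p - 1) = w r `^ p / nu r & w r = s `^ p'^-1 * nu r `^ p^-1].
Proof.
move=> n0 w0; have np : 0 < nu r `^ p^-1 by exact: powR_gt0.
pose t := w r / nu r `^ p^-1; have t0 : 0 < t by exact: divr_gt0.
exists (t `^ p'); rewrite /sigma gt_eqF//; split => //.
- exact: powR_gt0.
- rewrite -powRrM mulrC conj_expB1 /t powRM ?invr_ge0 ?ltW//; congr (_ * _).
  by rewrite powRV ?powR_ge0// -powRrM mulVf ?gt_eqF// powRr1// ltW.
- by rewrite -powRrM mulfV ?gt_eqF ?conj_exp_gt0// powRr1 ?(ltW t0)// /t divfK// gt_eqF.
Qed.

Variant sigma_spec r : \bar R -> Type :=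
| SigmaZero of w r = 0 : sigma_spec r 0%E
| SigmaInfty of nu r = 0 & 0 < w r : sigma_spec r +oo%E
| SigmaPos s of 0 < nu r & 0 < w r & 0 < s & s `^ (p - 1) = w r `^ p / nu r &
    w r = s `^ p'^-1 * nu r `^ p^-1 : sigma_spec r s%:E.

Lemma sigmaP r : 0 <= r < 1 -> sigma_spec r (sig r).
Proof.
move=> r01; have := radial_weight_ge0 rw r01; have := radial_weight_ge0 rn r01.
have [wz|wn] := eqVneq (w r) 0; first by move=> _ _; rewrite sigma0//; exact: SigmaZero.
have [nz|nn] := eqVneq (nu r) 0.
  by rewrite sigma_infty// => _ w0; apply: SigmaInfty => //; rewrite lt_neqAle eq_sym wn.
move=> n0 w0; have n0' : 0 < nu r by rewrite lt_neqAle eq_sym nn.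
have w0' : 0 < w r by rewrite lt_neqAle eq_sym wn.
have [s [-> s0 e1 e2]] := cid (sigma_pos n0' w0').
exact: SigmaPos.
Qed.

Lemma sigma_ge0 r : 0 <= r < 1 -> (0 <= sig r)%E.
Proof. by move=> /sigmaP[]// s _ _ s0 _ _; rewrite lee_fin ltW. Qed.

Lemma measurable_sigma : measurable_fun I01 sig.
Proof.
have mw := radial_weight_meas rw; have mn := radial_weight_meas rn.
have mI : measurable I01 by exact: measurable_itv.
have mn0 : measurable_fun I01 (fun r => nu r == 0) by apply: measurable_fun_eqr.
have mpw (t : R) (A : set R) h : measurable_fun A h -> measurable_fun A (fun r => h r `^ t).
  by move=> mh; apply: (@measurableT_comp _ _ _ _ _ _ (@powR R ^~ t)) => //; exact: measurable_powR.
have mA b : measurable (I01 `&` (fun r => nu r == 0) @^-1` [set b]) by exact: mn0.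
rewrite /sigma; apply: measurable_fun_if => //.
- apply: measurable_fun_if => //.
  by apply: measurable_fun_eqr => //; apply: measurable_funS mw => //; exact: subIsetl.
- apply/measurable_EFinP; apply: (mpw); apply: measurable_funS (mI) (@subIsetl _ _ _) _.
  apply: measurable_funM => //.
  rewrite (_ : (fun r => _) = (fun r => nu r `^ (- p^-1))); first exact: mpw.
  by apply/funext => r; rewrite powRN.
Qed.

(** Young's inequality for a sigma^(1/p') / al and b nu^(1/p) / be, multiplied by al be. It survives
    infinite sigma: then either a = 0 or the right side is [+oo]. Integrating it gives Hoelder with
    al and be in the role of the norms. *)
Lemma sigma_young r (a b al be : R) : 0 <= r < 1 -> 0 <= a -> 0 <= b -> 0 < al -> 0 < be ->
  ((a * b * w r)%:E <= (al * be / (al `^ p' * p'))%:E * ((a `^ p')%:E * sig r)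
     + (al * be / (be `^ p * p) * (b `^ p * nu r))%:E)%E.
Proof.
move=> r01 a0 b0 al0 be0.
have n0 := radial_weight_ge0 rn r01.
have q0 := conj_exp_gt0.
have c1 : 0 < al * be / (al `^ p' * p') by apply: divr_gt0; apply: mulr_gt0 => //; exact: powR_gt0.
have c2 : 0 < al * be / (be `^ p * p) by apply: divr_gt0; apply: mulr_gt0 => //; exact: powR_gt0.
case: (sigmaP r01) => [->|nz w0|s n0' w0 s0 e1 e2].
- rewrite mulr0 mule0 mule0 add0e lee_fin; apply: mulr_ge0; first exact: ltW.
  by rewrite mulr_ge0 ?powR_ge0.
- have [->|an] := eqVneq a 0.
    rewrite !mul0r powR0 ?gt_eqF// mul0e mule0 add0e lee_fin; apply: mulr_ge0; first exact: ltW.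
    by rewrite mulr_ge0 ?powR_ge0.
  have ap : 0 < a by rewrite lt_neqAle eq_sym an.
  by rewrite gt0_muley ?lte_fin ?powR_gt0// gt0_muley ?lte_fin// addye// leey.
- pose x := a * s `^ p'^-1 / al; pose y := b * nu r `^ p^-1 / be.
  have x0 : 0 <= x by rewrite divr_ge0 ?mulr_ge0 ?powR_ge0// ltW.
  have y0 : 0 <= y by rewrite divr_ge0 ?mulr_ge0 ?powR_ge0// ltW.
  have := conjugate_powR x0 y0 q0 p0 conj_exp_inv.
  have xq : x `^ p' = a `^ p' * s / al `^ p'.
    rewrite /x !powRM ?mulr_ge0 ?powR_ge0 ?invr_ge0 ?(ltW al0)// -powRrM mulVf ?gt_eqF// powRr1 ?(ltW s0)//.
    by rewrite powRV// ltW.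
  have yp : y `^ p = b `^ p * nu r / be `^ p.
    rewrite /y !powRM ?mulr_ge0 ?powR_ge0 ?invr_ge0 ?(ltW be0)// -powRrM mulVf ?gt_eqF// powRr1//.
    by rewrite powRV// ltW.
  rewrite xq yp => h.
  rewrite -!EFinM -EFinD lee_fin.
  have -> : a * b * w r = al * be * (x * y).
    by rewrite e2 /x /y; field; rewrite !gt_eqF.
  apply: le_trans (ler_wpM2l _ h) _; first by rewrite mulr_ge0 ?ltW.
  rewrite le_eqVlt; apply/orP; left; apply/eqP.
  by field; rewrite !gt_eqF ?powR_gt0.
Qed.

Lemma Lp_pow_meas (e : R -> \bar R) (t : R) f : cmeasurable f -> measurable_fun I01 e ->
  measurable_fun D (fun q => ((cabs (f (cplx q))) `^ t)%:E * e (rad q))%E.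
Proof.
move=> mf me; apply: emeasurable_funM; last exact: measurable_radial.
by apply/measurable_EFinP; exact: (measurable_cabs_powR t mf).
Qed.

Lemma Lp_pow_sigma_ge0 f : (0 <= Lp_pow p' sig f)%E.
Proof. by apply: dAint_ge0 => q qD; rewrite mule_ge0 ?lee_fin ?powR_ge0// sigma_ge0// rad_in01. Qed.

Lemma Lp_pow_nu_ge0 f : (0 <= Lp_pow p nuE f)%E.
Proof.
by apply: dAint_ge0 => q qD; rewrite mule_ge0 ?lee_fin ?powR_ge0// (radial_weight_ge0 rn)// rad_in01.
Qed.

Lemma holder_pos f g (al be : R) : cmeasurable f -> cmeasurable g -> 0 < al -> 0 < be ->
  (Lp_pow p' sig f <= (al `^ p')%:E)%E -> (Lp_pow p nuE g <= (be `^ p)%:E)%E ->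
  (absint (pair_int w g f) <= (al * be)%:E)%E.
Proof.
move=> mf mg al0 be0 hf hg.
have q0 := conj_exp_gt0.
have c1 : 0 < al * be / (al `^ p' * p') by apply: divr_gt0; apply: mulr_gt0 => //; exact: powR_gt0.
have c2 : 0 < al * be / (be `^ p * p) by apply: divr_gt0; apply: mulr_gt0 => //; exact: powR_gt0.
have mnu : measurable_fun I01 nuE by apply/measurable_EFinP; exact: radial_weight_meas.
have mF := Lp_pow_meas p' mf measurable_sigma.
have mG := Lp_pow_meas p mg mnu.
have F0 q : D q -> (0 <= ((cabs (f (cplx q))) `^ p')%:E * sig (rad q))%E.
  by move=> qD; rewrite mule_ge0 ?lee_fin ?powR_ge0// sigma_ge0// rad_in01.
have G0 q : D q -> (0 <= ((cabs (g (cplx q))) `^ p)%:E * (nu (rad q))%:E)%E.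
  by move=> qD; rewrite mule_ge0 ?lee_fin ?powR_ge0// (radial_weight_ge0 rn)// rad_in01.
set k1 := _ / _ in c1; set k2 := _ / _ in c2.
apply: (@le_trans _ _ (k1%:E * Lp_pow p' sig f + k2%:E * Lp_pow p nuE g)%E).
  rewrite /Lp_pow -(dAintZ mF (ltW c1) F0) -(dAintZ mG (ltW c2) G0) -dAintD; last 4 first.
  - exact: measurable_funeM.
  - exact: measurable_funeM.
  - by move=> q qD; rewrite mule_ge0 ?F0// lee_fin ltW.
  - by move=> q qD; rewrite mule_ge0 ?G0// lee_fin ltW.
  apply: le_dAint.
  - exact: meas_cabsE (pair_int_cmeas rw mf mg).
  - by apply: emeasurable_funD; exact: measurable_funeM.
  - by move=> q _; rewrite lee_fin cabs_ge0.
  - move=> q qD; rewrite cabs_pair_int//.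
    apply: le_trans (sigma_young (rad_in01 qD) (cabs_ge0 _) (cabs_ge0 _) al0 be0) _.
    by rewrite -/k1 -/k2 -!EFinM.
apply: (@le_trans _ _ (k1%:E * (al `^ p')%:E + k2%:E * (be `^ p)%:E)%E).
  by rewrite leeD// lee_wpmul2l// lee_fin ltW.
rewrite -!EFinM -EFinD lee_fin le_eqVlt; apply/orP; left; apply/eqP.
rewrite -[RHS]mulr1 -conj_exp_inv /k1 /k2.
by field; rewrite !gt_eqF ?powR_gt0.
Qed.

(** [holder_pos] divides by its majorants, so both norms are enlarged by 1 / (n + 1) to cover the
    case of norm 0, and n tends to infinity. *)
Lemma holder f g : Lp p' sig f -> Lp p nuE g ->
  (absint (pair_int w g f) <= (Lpnorm p' sig f * Lpnorm p nuE g)%:E)%E.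
Proof.
move=> [mf If] [mg Ig]; have q0 := conj_exp_gt0.
have fin1 : Lp_pow p' sig f \is a fin_num by rewrite ge0_fin_numE ?Lp_pow_sigma_ge0.
have fin2 : Lp_pow p nuE g \is a fin_num by rewrite ge0_fin_numE ?Lp_pow_nu_ge0.
pose u (x : R) (n : nat) : R := x + n.+1%:R^-1.
have u0 x n : 0 <= x -> 0 < u x n by move=> x0; rewrite ltr_wpDl ?invr_gt0.
have cu x : u x n @[n --> \oo] --> x.
  by rewrite -[X in _ --> X]addr0; apply: cvgD; [exact: cvg_cst|exact: cvg_harmonic].
have n1 : 0 <= Lpnorm p' sig f by exact: powR_ge0.
have n2 : 0 <= Lpnorm p nuE g by exact: powR_ge0.
have h n : (absint (pair_int w g f) <= (u (Lpnorm p' sig f) n * u (Lpnorm p nuE g) n)%:E)%E.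
  have up (t x : R) : 0 < t -> 0 <= x -> x <= u (x `^ t^-1) n `^ t.
    move=> t0 x0; rewrite -{1}(powRr1 x0) -(@mulVf _ t) ?gt_eqF// powRrM.
    by apply: ge0_ler_powR; rewrite ?nnegrE ?powR_ge0 ?(ltW t0) ?(ltW (u0 _ _ _)) ?powR_ge0// lerDl invr_ge0.
  apply: holder_pos => //; [exact: u0|exact: u0| |].
  - by rewrite -{1}(fineK fin1) lee_fin; apply: up => //; rewrite fine_ge0 ?Lp_pow_sigma_ge0.
  - by rewrite -{1}(fineK fin2) lee_fin; apply: up => //; rewrite fine_ge0 ?Lp_pow_nu_ge0.
have a0 : (0 <= absint (pair_int w g f))%E by apply: dAint_ge0 => q _; rewrite lee_fin cabs_ge0.
have fa : absint (pair_int w g f) \is a fin_num.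
  by rewrite ge0_fin_numE// (le_lt_trans (h 0%N))// ltry.
rewrite -(fineK fa) lee_fin.
have cc : u (Lpnorm p' sig f) n * u (Lpnorm p nuE g) n @[n --> \oo] --> Lpnorm p' sig f * Lpnorm p nuE g.
  by apply: cvgM; exact: cu.
rewrite -(cvg_lim _ cc)//; apply: limr_ge; first exact: cvgP cc.
by apply: nearW => n; rewrite -lee_fin fineK.
Qed.

End DualWeight.

(** * Analytic functions and polynomials *)

Section AnalyticAlgebra.
Variable R : realType.
Implicit Types (f g : R[i] -> R[i]).

Lemma analytic_addZ f g (a : R[i]) : analytic_in_disc f -> analytic_in_disc g ->
  analytic_in_disc (fun z => f z + a * g z).
Proof.
move=> hf hg z z1.
have df : derivable (f : R[i]^o -> R[i]^o) z 1 by exact: hf.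
have dg : derivable (g : R[i]^o -> R[i]^o) z 1 by exact: hg.
exact: (derivableD df (derivableZ dg)).
Qed.

Lemma poly_ps (c : nat -> R[i]) N : exists2 b, rad1 b & forall z, \sum_(0 <= n < N) c n * z ^+ n = ps b z.
Proof.
pose b n := if (n < N)%N then c n else 0.
have b0 n : (N <= n)%N -> b n = 0 by move=> h; rewrite /b ltnNge h.
exists b.
  apply: rad1_bounded => r r01; exists (\sum_(0 <= n < N) cabs (b n) * r ^+ n) => n.
  have r0 : 0 <= r by case/andP: r01.
  have t0 k : 0 <= cabs (b k) * r ^+ k by rewrite mulr_ge0 ?cabs_ge0 ?exprn_ge0.
  have [nN|/b0 ->] := ltnP n N; last by rewrite cabs0 mul0r sumr_ge0.
  by rewrite (bigD1_seq n) ?mem_index_iota ?iota_uniq//= lerDl sumr_ge0.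
move=> z; rewrite /ps (@cser_finite _ _ N _).2.
  by rewrite /csums !big_mkord; apply: eq_bigr => n _; rewrite /b ltn_ord.
by move=> n nN; rewrite b0// mul0r.
Qed.

Lemma fejS_ps (a : nat -> R[i]) N : exists2 b, rad1 b & forall z, fejS a N z = ps b z.
Proof.
have [b hb e] := poly_ps (fun n => ((fejw R N n)%:C)%C * a n) N.
by exists b => // z; rewrite -e; apply: eq_bigr => n _; rewrite mulrA.
Qed.

Lemma analytic_fejS (a : nat -> R[i]) N : analytic_in_disc (fejS a N).
Proof. by have [b hb e] := fejS_ps a N; apply: (analytic_ps hb) => z _; exact: e. Qed.

Lemma mon_ps n : exists2 b : nat -> R[i], rad1 b & forall z, mon n z = ps b z.
Proof.
have [b hb e] := poly_ps (fun k => (k == n)%:R) n.+1; exists b => // z; rewrite -e.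
rewrite (bigD1_seq n) ?mem_index_iota ?iota_uniq//= big1 ?addr0 ?eqxx ?mul1r// => k kn.
by rewrite (negbTE kn) mul0r.
Qed.

Lemma analytic_mon n : analytic_in_disc (@mon R n).
Proof. by have [b hb e] := mon_ps n; apply: (analytic_ps hb) => z _; exact: e. Qed.

Lemma analytic_cmeasurable f : analytic_in_disc f -> cmeasurable f.
Proof.
move=> /analytic_taylor[a ha fa]; apply: cmeas_eq (cmeas_ps ha) => q qD.
by rewrite fa.
Qed.

End AnalyticAlgebra.

(** * Hoelder pairing, truncations of sigma and consequences of its integrability *)

Section SigmaIntegrable.
Variable R : realType.
Local Notation D := (@disc R).
Local Notation leb2 := (@leb2 R).
Local Notation rad := (@rad R).
Local Notation I01 := (`[(0 : R), 1[%classic : set R).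
Variables (p : R) (w nu : R -> R).
Hypothesis p1 : 1 < p.
Hypothesis rw : radial_weight w.
Hypothesis rn : radial_weight nu.
Local Notation p' := (conj_exp p).
Local Notation sig := (sigma p w nu).
Local Notation nuE := (fun r => (nu r)%:E).
Implicit Types (f g : R[i] -> R[i]).

Let p0 : 0 < p := lt_trans ltr01 p1.
Let q0 : 0 < p' := conj_exp_gt0 p1.
Let mD : measurable D := @measurable_disc R.
Let s0 q : D q -> (0 <= sig (rad q))%E.
Proof. by move=> qD; exact: sigma_ge0 p1 rw rn _ (rad_in01 qD). Qed.
Let msig : measurable_fun D (fun q => sig (rad q)) := measurable_radial (measurable_sigma p rw rn).

Lemma Lp_pow_nuE f : Lp_pow p nuE f = wint p nu (fun q => f (cplx q)).
Proof. by apply: eq_dAint => q _; rewrite /wfun EFinM. Qed.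

Lemma Lp_bounded (t : R) (e : R -> \bar R) f (M : R) : 0 < t -> measurable_fun I01 e ->
  (forall r, 0 <= r < 1 -> (0 <= e r)%E) -> (dAint (fun q => e (rad q)) < +oo)%E ->
  cmeasurable f -> 0 <= M -> (forall q, D q -> cabs (f (cplx q)) <= M) -> Lp t e f.
Proof.
move=> t0 me e0 Ie mf M0 fM; split => //.
have e0' q : D q -> (0 <= e (rad q))%E by move=> qD; exact: e0 (rad_in01 qD).
apply: (@le_lt_trans _ _ ((M `^ t)%:E * dAint (fun q => e (rad q)))%E); last first.
  by rewrite lte_mul_pinfty ?lee_fin ?powR_ge0.
rewrite -(dAintZ (measurable_radial me) (powR_ge0 M t) e0'); apply: le_dAint.
- exact: Lp_pow_meas.
- by apply: measurable_funeM; exact: measurable_radial.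
- by move=> q qD; rewrite mule_ge0 ?e0' ?lee_fin ?powR_ge0.
- move=> q qD; rewrite lee_wpmul2r ?e0' ?lee_fin//.
  by apply: ge0_ler_powR; rewrite ?nnegrE ?cabs_ge0 ?(ltW t0)// fM.
Qed.

Lemma Lp_nu_bounded f (M : R) : cmeasurable f -> 0 <= M -> (forall q, D q -> cabs (f (cplx q)) <= M) ->
  Lp p nuE f.
Proof.
apply: Lp_bounded => //.
- by apply/measurable_EFinP; exact: radial_weight_meas.
- by move=> r r01; rewrite lee_fin (radial_weight_ge0 rn).
- exact: dAint_weight_lty.
Qed.

Lemma L1w_of_pair f : cmeasurable f -> (absint (pair_int w (mon 0) f) < +oo)%E -> L1w w f.
Proof.
move=> mf h; split=> //; apply: le_lt_trans h; rewrite le_eqVlt; apply/orP; left; apply/eqP.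
by apply: eq_dAint => q qD; rewrite (cabs_pair_int rw)// /mon expr0 cabs1 mulr1.
Qed.

Lemma Lp_nu_mon n : Lp p nuE (mon n).
Proof. by apply: (@Lp_nu_bounded _ 1) => //; [exact: cmeasurable_mon|exact: cabs_mon]. Qed.

(** Hoelder against the constant 1, which lies in L^p_nu because nu is integrable. *)
Lemma Lp_sigma_L1w f : Lp p' sig f -> L1w w f.
Proof.
move=> hf; have [mf _] := hf; apply: L1w_of_pair => //.
by apply: le_lt_trans (holder p1 rw rn hf (Lp_nu_mon 0)) _; exact: ltry.
Qed.

Lemma pair_cintegrable f g : Lp p' sig f -> Lp p nuE g -> cintegrable (pair_int w g f).
Proof.
move=> hf hg; apply: cintegrableP; first by apply: pair_int_cmeas => //; [case: hf|case: hg].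
by apply: le_lt_trans (holder p1 rw rn hf hg) _; exact: ltry.
Qed.

Lemma Tg_le f g : Lp p' sig f -> Lp p nuE g -> cabs (Tg w g f) <= 2 * (Lpnorm p' sig f * Lpnorm p nuE g).
Proof.
move=> hf hg; rewrite -lee_fin.
have mp : cmeas (pair_int w g f) by apply: pair_int_cmeas => //; [case: hf|case: hg].
apply: le_trans (cint_bound mp) _; rewrite EFinM lee_wpmul2l ?lee_fin//.
exact: (holder p1 rw rn hf hg).
Qed.

(** A real-valued approximation of sigma from below, finite even where sigma is [+oo]; bounds
    uniform in n yield integrability of sigma by [sigma_int_trunc]. *)
Definition trunc (n : nat) (r : R) : R := fine (mine (sig r) n%:R%:E).

Lemma truncE n r : 0 <= r < 1 -> (trunc n r)%:E = mine (sig r) n%:R%:E.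
Proof.
move=> r01; rewrite /trunc fineK// ge0_fin_numE ?gt_min ?ltry ?orbT//.
by rewrite le_min (sigma_ge0 p1 rw rn r01) lee_fin ler0n.
Qed.

Lemma trunc_ge0 n r : 0 <= r < 1 -> 0 <= trunc n r.
Proof.
by move=> r01; rewrite -lee_fin truncE// le_min (sigma_ge0 p1 rw rn r01) lee_fin ler0n.
Qed.

Lemma trunc_le n r : 0 <= r < 1 -> trunc n r <= n%:R.
Proof. by move=> r01; rewrite -lee_fin truncE// ge_min lexx orbT. Qed.

Lemma trunc_le_sigma n r : 0 <= r < 1 -> ((trunc n r)%:E <= sig r)%E.
Proof. by move=> r01; rewrite truncE// ge_min lexx. Qed.

Lemma measurable_trunc n : measurable_fun I01 (trunc n).
Proof.
have h : measurable_fun I01 (fun r => mine (sig r) n%:R%:E).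
  by apply: measurable_mine; [exact: measurable_sigma|exact: measurable_cst].
exact: measurableT_comp (fine_measurable measurableT) h.
Qed.

Lemma trunc_cvg r : 0 <= r < 1 -> ((trunc n r)%:E @[n --> \oo] --> sig r)%E.
Proof.
move=> r01; have := sigma_ge0 p1 rw rn r01.
rewrite (_ : (fun n => _) = (fun n => mine (sig r) n%:R%:E)); last first.
  by apply/funext => n; rewrite truncE.
case: (sig r) => [s|_|//].
- rewrite lee_fin => s1.
  apply: (@cvg_near_cst _ _ s%:E); exists (Num.truncn s).+1 => // n /= hn.
  apply/min_idPl; rewrite lee_fin ltW// (lt_le_trans (truncnS_gt _))// ler_nat.
  exact: hn.
- have e : (fun n => mine +oo (n%:R : R)%:E)%E = (fun n => (n%:R : R)%:E).
    by apply/funext => n; rewrite /Order.min ltNge leey.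
  have c : ((n%:R : R)%:E @[n --> \oo] --> +oo)%E by exact/cvgenyP.
  by rewrite -e in c.
Qed.

Lemma sigma_int_trunc (K : R) : (forall n, dAint (fun q => (trunc n (rad q))%:E) <= K%:E)%E ->
  (dAint (fun q => sig (rad q)) < +oo)%E.
Proof.
move=> h; apply: le_lt_trans (ltry K).
apply: (@dAint_fatou _ (fun n q => (trunc n (rad q))%:E)) => //.
- by move=> n; apply/measurable_EFinP; apply: measurable_radial; exact: measurable_trunc.
- by move=> n q qD; rewrite lee_fin trunc_ge0 ?rad_in01.
- by move=> q qD; apply: trunc_cvg; exact: rad_in01.
Qed.

Hypothesis Is : (dAint (fun q => sig (rad q)) < +oo)%E.

(* [sigma] with the value [+oo] replaced by [0]. *)
Definition sigma_fin (r : R) : R := fine (sig r).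

Lemma sigma_fin_ge0 r : 0 <= r < 1 -> 0 <= sigma_fin r.
Proof. by move=> r01; rewrite fine_ge0// sigma_ge0. Qed.

Lemma sigma_fin_meas : measurable_fun I01 sigma_fin.
Proof. exact: measurableT_comp (fine_measurable measurableT) (measurable_sigma p rw rn). Qed.

Lemma sigma_fin_measD : measurable_fun D (fun q => sigma_fin (rad q)).
Proof. by apply: measurable_radial; exact: sigma_fin_meas. Qed.

(** An integrable sigma is finite almost everywhere. This gives access to the results on Fejer
    means, which are stated for real-valued weights. *)
Lemma Lp_pow_sigmaE f : cmeasurable f -> Lp_pow p' sig f = wint p' sigma_fin (fun q => f (cplx q)).
Proof.
move=> mf; rewrite /Lp_pow /wint /dAint; congr (_ * _)%E.
have ae : {ae leb2, forall q, D q -> sig (rad q) \is a fin_num}.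
  apply: (@integrable_ae _ _ _ leb2 D mD (fun q => sig (rad q))).
  apply/integrableP; split => //.
  move: Is; rewrite dAint_lty; apply: le_lt_trans; rewrite le_eqVlt; apply/orP; left; apply/eqP.
  by apply: eq_integral => q /[!inE] qD; rewrite gee0_abs// s0.
apply: ge0_ae_eq_integral => //.
- exact: (Lp_pow_meas p' mf (measurable_sigma p rw rn)).
- by apply: wint_meas => //; exact: sigma_fin_measD.
- by move=> q qD; rewrite mule_ge0 ?s0 ?lee_fin ?powR_ge0.
- by move=> q qD; rewrite lee_fin mulr_ge0 ?powR_ge0 ?sigma_fin_ge0 ?rad_in01.
- case: ae => A [mA A0 hA]; exists A; split => // q hq; apply: hA => h; apply: hq => qD.
  by rewrite /wfun EFinM /sigma_fin fineK//; exact: h.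
Qed.

Lemma Lp_sigma_bounded f (M : R) : cmeasurable f -> 0 <= M -> (forall q, D q -> cabs (f (cplx q)) <= M) ->
  Lp p' sig f.
Proof.
exact: (Lp_bounded q0 (measurable_sigma p rw rn) (sigma_ge0 p1 rw rn)).
Qed.

Lemma Lp_sigma_mon n : Lp p' sig (mon n).
Proof. by apply: (@Lp_sigma_bounded _ 1) => //; [exact: cmeasurable_mon|exact: cabs_mon]. Qed.

Lemma pair_absintC f g : absint (pair_int w g f) = absint (pair_int w f g).
Proof.
by apply: eq_dAint => q qD; rewrite !(cabs_pair_int rw)// [cabs (f _) * _]mulrC.
Qed.

(** Hoelder against the constant 1 again, which now has to lie in L^p'_sigma; integrability of sigma
    provides this. *)
Lemma Lp_nu_L1w f : Lp p nuE f -> L1w w f.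
Proof.
move=> hf; have [mf _] := hf; apply: L1w_of_pair => //; rewrite pair_absintC.
by apply: le_lt_trans (holder p1 rw rn (Lp_sigma_mon 0) hf) _; exact: ltry.
Qed.

End SigmaIntegrable.

(** * Duality *)

Section PairingAlgebra.
Variable R : realType.
Local Notation D := (@disc R).
Local Notation rad := (@rad R).
Implicit Types (f g : R[i] -> R[i]) (a : nat -> R[i]).

Lemma cint_real (k : R * R -> R) : measurable_fun D k -> (forall q, D q -> 0 <= k q) ->
  (dAint (fun q => (k q)%:E) < +oo)%E ->
  cint (fun q => ((k q)%:C)%C) = ((fine (dAint (fun q => (k q)%:E)))%:C)%C.
Proof.
move=> mk k0 Ik; rewrite /cint /= (_ : Rintegral _ _ (fun=> 0) = 0); last first.
  by rewrite Rintegral_cst ?mul0r//; exact: measurable_disc.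
rewrite mulr0; congr Complex; rewrite /dAint /Rintegral -[X in X * _]/(fine (pi^-1)%:E) -fineM//.
rewrite ge0_fin_numE -?dAint_lty//; apply: integral_ge0 => q qD.
by rewrite lee_fin k0.
Qed.

Lemma cint_conj (F : R * R -> R[i]) : cintegrable F -> cint (fun q => conjc (F q)) = conjc (cint F).
Proof.
move=> [iR iI]; rewrite /cint /conjc; apply: complex_ext => /=.
  by congr (_ * _); apply: eq_Rintegral => q _; case: (F q).
rewrite -mulrN; congr (_ * _); rewrite -mulN1r -RintegralZl//; last exact: measurable_disc.
by apply: eq_Rintegral => q _; rewrite mulN1r; case: (F q).
Qed.

Lemma conjc_real (r : R) : conjc (r%:C)%C = (r%:C)%C.
Proof. by rewrite /conjc /= oppr0. Qed.

Variable w : R -> R.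
Hypothesis rw : radial_weight w.

Lemma pair_intC f g q : pair_int w f g q = conjc (pair_int w g f q).
Proof. by rewrite /pair_int !conjcM conjcK /conjc /= oppr0 [conjc _ * _]mulrC. Qed.

Lemma TgC f g : cintegrable (pair_int w g f) -> Tg w f g = conjc (Tg w g f).
Proof.
by move=> h; rewrite /Tg -cint_conj//; apply: cint_eq => q _; exact: pair_intC.
Qed.

Lemma Tg_fejSr f a N : L1w w f ->
  Tg w (fejS a N) f = \sum_(0 <= n < N) ((fejw R N n)%:C)%C * (conjc (a n) * Tg w (mon n) f).
Proof.
move=> hf; pose H n q := (((fejw R N n)%:C)%C * conjc (a n)) * pair_int w (mon n) f q.
have iH n : cintegrable (H n) by apply: cintegrableZ; exact: mon_pair_int.
rewrite /Tg (@cint_eq _ _ (fun q => \sum_(0 <= n < N) H n q)); last first.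
  move=> q _; rewrite /pair_int /fejS conjc_sum mulr_sumr mulr_suml; apply: eq_bigr => n _.
  by rewrite /H /pair_int /mon !conjcM conjc_real; ring.
rewrite (cint_sum _ iH).2; apply: eq_bigr => n _.
by rewrite /H (cintZ _ (mon_pair_int rw n hf)) -mulrA.
Qed.

Lemma fejS_bounded a N : exists2 M, 0 <= M & forall q, D q -> cabs (fejS a N (cplx q)) <= M.
Proof.
exists (\sum_(0 <= n < N) cabs (a n)); first by apply: sumr_ge0 => n _; exact: cabs_ge0.
move=> q qD; apply: le_trans (cabs_sum _ _ _) _; apply: ler_sum => n _.
rewrite !cabsM cabs_real (ger0_norm (fejw_ge0 _ _ _)) (le_trans (ler_piMl _ (fejw_le1 _ _ _)))//.
  by rewrite mulr_ge0 ?cabs_ge0.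
by rewrite ler_piMr ?cabs_ge0// cabsX exprn_ile1 ?cabs_ge0// ltW.
Qed.

Lemma L1w_fejS a N : L1w w (fejS a N).
Proof.
have [M M0 hM] := fejS_bounded a N.
by apply: (L1w_bounded rw _ M0 hM); exact: cmeas_fejS.
Qed.

Lemma Tg_fejSl f a N : L1w w f ->
  Tg w f (fejS a N) = \sum_(0 <= n < N) ((fejw R N n)%:C)%C * (a n * conjc (Tg w (mon n) f)).
Proof.
move=> hf; have [M M0 hM] := fejS_bounded a N.
have ip : cintegrable (pair_int w (fejS a N) f).
  by apply: (L1w_cintegrable rw hf _ M0 hM); exact: cmeas_fejS.
rewrite TgC// Tg_fejSr// conjc_sum; apply: eq_bigr => n _.
by rewrite !conjcM conjcK conjc_real.
Qed.

Lemma conjc_bcoef n : conjc (bcoef w n) = bcoef w n.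
Proof. exact: conjc_real. Qed.

(** Both sides are the finite sum of [fejw N n] b_n <f, z^n> conj(<g, z^n>), with real multipliers
    and real b_n. So S_N P_w is symmetric without exchanging two integrals over the disc. *)
Lemma Tg_fejS_sym f g N : L1w w f -> L1w w g ->
  Tg w g (fejS (Pcoef w f) N) = Tg w (fejS (Pcoef w g) N) f.
Proof.
move=> hf hg; rewrite Tg_fejSl// Tg_fejSr//; apply: eq_bigr => n _.
by rewrite /Pcoef conjcM conjc_bcoef; congr (_ * _); ring.
Qed.

End PairingAlgebra.

(** * Integrability of sigma from a bounded projection *)

Section BoundedProjection.
Variable R : realType.
Local Notation D := (@disc R).
Local Notation rad := (@rad R).
Variables (p : R) (w nu : R -> R).
Hypothesis p1 : 1 < p.
Hypothesis rw : radial_weight w.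
Hypothesis rn : radial_weight nu.
Local Notation p' := (conj_exp p).
Local Notation sig := (sigma p w nu).
Local Notation nuE := (fun r => (nu r)%:E).
Implicit Types (f g : R[i] -> R[i]).

Let p0 : 0 < p := lt_trans ltr01 p1.
Let n0 q : D q -> 0 <= nu (rad q).
Proof. by move=> qD; exact: radial_weight_ge0 rn (rad_in01 qD). Qed.
Let w0 q : D q -> 0 <= w (rad q).
Proof. by move=> qD; exact: radial_weight_ge0 rw (rad_in01 qD). Qed.

Lemma Lpnorm_ge0 t e f : 0 <= @Lpnorm R t e f.
Proof. exact: powR_ge0. Qed.

Lemma Lpnorm_powR (t : R) e f : 0 < t -> (0 <= Lp_pow t e f)%E -> Lp t e f ->
  ((Lpnorm t e f `^ t)%:E = Lp_pow t e f)%E.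
Proof.
move=> t0 e0 [_ h]; rewrite /Lpnorm -powRrM mulVf ?gt_eqF// powRr1 ?fine_ge0//.
by rewrite fineK// ge0_fin_numE.
Qed.

Lemma Lpnorm_le (t : R) e f (M : R) : 0 < t -> (0 <= Lp_pow t e f)%E -> 0 <= M ->
  (Lp_pow t e f <= (M `^ t)%:E)%E -> Lpnorm t e f <= M.
Proof.
move=> t0 e0 M0 h; rewrite /Lpnorm -[leRHS](powRr1 M0) -(@mulfV _ t) ?gt_eqF// powRrM.
have fn : Lp_pow t e f \is a fin_num by rewrite ge0_fin_numE// (le_lt_trans h) ?ltry.
apply: ge0_ler_powR; rewrite ?nnegrE ?invr_ge0 ?(ltW t0) ?fine_ge0 ?powR_ge0//.
by rewrite -lee_fin fineK.
Qed.

(** Boundedness of P_w in the form used below: p-th powers in the extended reals, the power series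
    in place of the integral operator, and a strictly positive constant. *)
Definition projection_bound (C : R) := 0 < C /\ forall f, Lp p nuE f -> L1w w f ->
  (wint p nu (fun q => ps (Pcoef w f) (cplx q)) <= (C `^ p)%:E * Lp_pow p nuE f)%E.

Lemma Pw_bounded_projection : Pw_bounded p w nu -> exists C, projection_bound C.
Proof.
move=> [C hC]; exists (Num.max C 1); split; first by rewrite lt_max ltr01 orbT.
move=> f hf f1; have [_ [hP le1]] := hC f hf.
have -> : wint p nu (fun q => ps (Pcoef w f) (cplx q)) = Lp_pow p nuE (Pw w f).
  rewrite Lp_pow_nuE; apply: eq_dAint => q qD; rewrite /wfun.
  by rewrite (Pw_ps rw f1 qD).2.
have C0 : 0 <= Num.max C 1 by rewrite le_max ler01 orbT.
rewrite -(Lpnorm_powR p0 (Lp_pow_nu_ge0 p rn _) hP) -(Lpnorm_powR p0 (Lp_pow_nu_ge0 p rn _) hf).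
rewrite -EFinM lee_fin -powRM ?Lpnorm_ge0//.
apply: ge0_ler_powR; rewrite ?nnegrE ?(ltW p0) ?mulr_ge0 ?Lpnorm_ge0//.
by apply: le_trans le1 _; rewrite ler_wpM2r ?Lpnorm_ge0// le_max lexx.
Qed.

Local Notation trunc := (trunc p w nu).

(** With x = min(sigma, n) and both weights positive, the left side is x (x / sigma)^(p-1), because
    sigma^(p-1) = w^p / nu. For w = 0 it vanishes by the convention on division by 0. *)
Lemma truncw_le n r : 0 <= r < 1 -> (trunc n r / w r) `^ p * nu r <= trunc n r.
Proof.
move=> r01; have x0 := trunc_ge0 p1 rw rn n r01; have := trunc_le_sigma p1 rw rn n r01.
case: (sigmaP p1 rw rn r01) => [->|-> _ _|s nu0 wr0 s0 e1 e2].
- by rewrite invr0 mulr0 powR0 ?gt_eqF// mul0r.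
- by rewrite mulr0.
- rewrite lee_fin => xs.
  rewrite powRM ?invr_ge0 ?(ltW wr0)// powRV ?(ltW wr0)// -mulrA -{1}(mulr_powRB1 x0 p0) -mulrA.
  rewrite ler_piMr// (_ : _^-1 * _ = (w r `^ p / nu r)^-1); last by rewrite invf_div mulrC.
  rewrite -e1 ler_pdivrMr ?powR_gt0// mul1r.
  by apply: ge0_ler_powR; rewrite ?nnegrE ?(ltW s0) ?subr_ge0 ?(ltW p1).
Qed.

Lemma truncwK n r : 0 <= r < 1 -> trunc n r / w r * w r = trunc n r.
Proof.
move=> r01; have [wz|wn] := eqVneq (w r) 0; last by rewrite divfK.
rewrite wz mulr0; apply/eqP; rewrite eq_le (trunc_ge0 p1 rw rn)//=.
by have := trunc_le_sigma p1 rw rn n r01; rewrite (sigma0 nu p1 wz) lee_fin.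
Qed.

Lemma dAint_trunc_lty n : (dAint (fun q => (trunc n (rad q))%:E) < +oo)%E.
Proof.
apply: le_lt_trans (@dAint_cst R n%:R (ler0n _ _)); apply: le_dAint.
- by apply/measurable_EFinP; apply: measurable_radial; exact: measurable_trunc.
- exact: measurable_cst.
- by move=> q qD; rewrite lee_fin (trunc_ge0 p1 rw rn)// rad_in01.
- by move=> q qD; rewrite lee_fin (trunc_le p1 rw rn)// rad_in01.
Qed.

Lemma measurable_weightV : measurable_fun D (fun q => (w (rad q))^-1).
Proof.
apply: (@eq_measurable_fun _ _ _ _ _ (fun q => w (rad q) `^ (-1))).
  by move=> q /[!inE] qD; rewrite powR_inv1// w0.
apply: (@measurableT_comp _ _ _ _ _ _ (@powR R ^~ (-1))); first exact: measurable_powR.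
exact: radial_weight_measD.
Qed.

Lemma projection_sigma C : projection_bound C -> (dAint (fun q => sig (rad q)) < +oo)%E.
Proof.
move=> [C0 hC].
pose N := fine (dAint (fun q => (nu (rad q))%:E)).
have fN : dAint (fun q => (nu (rad q))%:E) = N%:E.
  by rewrite /N fineK// ge0_fin_numE ?dAint_weight_lty// ltW ?dAint_weight_gt0.
have N0 : 0 < N by rewrite -lte_fin -fN dAint_weight_gt0.
pose b := (2 * moment w (2 * 0 + 1))^-1.
have b0 : 0 < b by rewrite invr_gt0 mulr_gt0 ?moment_gt0.
pose c := b `^ p * N.
have c0 : 0 < c by rewrite mulr_gt0 ?powR_gt0.
(* The estimate will read (b A)^p N <= C^p A. Dividing by A gives A^(p-1) <= C^p / c, free of n; the
   truncation is what makes A finite and the division legitimate. *)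
pose K := (C `^ p / c) `^ (p - 1)^-1.
apply: (@sigma_int_trunc _ p w nu p1 rw rn K) => n.
(* [h * w = trunc n] and [h ^ p * nu <= trunc n], whence [A ^ p <= const * A]. *)
pose h (z : R[i]) : R[i] := ((trunc n (cabs z) / w (cabs z))%:C)%C.
have mt : measurable_fun D (fun q => trunc n (rad q)) by apply: measurable_radial; exact: measurable_trunc.
have mV := measurable_weightV.
have mh : cmeasurable h by apply: (@cmeas_real _ (fun q => trunc n (rad q) / w (rad q))); exact: measurable_funM.
have ch q : D q -> cabs (h (cplx q)) = trunc n (rad q) / w (rad q).
  move=> qD; rewrite cabs_real ger0_norm// mulr_ge0 ?invr_ge0 ?w0//.
  by rewrite (trunc_ge0 p1 rw rn)// rad_in01.
set A := dAint (fun q => (trunc n (rad q))%:E).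
have A0 : (0 <= A)%E.
  by apply: dAint_ge0 => q qD; rewrite lee_fin (trunc_ge0 p1 rw rn)// rad_in01.
have Afin : A \is a fin_num by rewrite ge0_fin_numE// dAint_trunc_lty.
have hA : (Lp_pow p nuE h <= A)%E.
  rewrite Lp_pow_nuE; apply: le_dAint.
  - by apply: wint_meas => //; exact: radial_weight_measD.
  - exact/measurable_EFinP.
  - by move=> q qD; rewrite lee_fin mulr_ge0 ?powR_ge0 ?n0.
  - by move=> q qD; rewrite /wfun ch// lee_fin truncw_le// rad_in01.
have Lh : Lp p nuE h by split => //; apply: le_lt_trans hA _; rewrite dAint_trunc_lty.
have L1h : L1w w h.
  split => //; rewrite (_ : dAint _ = A); first exact: dAint_trunc_lty.
  by apply: eq_dAint => q qD; rewrite ch// truncwK// rad_in01.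
have e1 : Tg w (mon 0) h = ((fine A)%:C)%C.
  rewrite /Tg -cint_real//; last 2 first.
  - by move=> q qD; rewrite (trunc_ge0 p1 rw rn)// rad_in01.
  - exact: dAint_trunc_lty.
  apply: cint_eq => q qD; rewrite /pair_int /mon expr0 conjc1 mulr1 /h -rmorphM /=.
  by rewrite truncwK// rad_in01.
have := le_trans (wint_coef0 (ltW p1) (fun r => radial_weight_ge0 rn (r := r)) (radial_weight_measD rn) (rad1_Pcoef rw L1h)) (hC _ Lh L1h).
rewrite /Pcoef e1 cabsM /bcoef !cabs_real -/b fN (ger0_norm (ltW b0)) ger0_norm ?fine_ge0//.
have [Az|An] := eqVneq (fine A) 0.
  by move=> _; rewrite -/A -(fineK Afin) Az lee_fin powR_ge0.
have Ap : 0 < fine A by rewrite lt_neqAle eq_sym An fine_ge0.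
move=> h1; have := le_trans h1 (lee_wpmul2l _ hA).
rewrite lee_fin powR_ge0 => /(_ isT).
rewrite -/A -[in X in (_ <= _ * X)%E](fineK Afin) -!EFinM lee_fin powRM ?(ltW b0) ?(ltW Ap)// => h2.
rewrite -/A -(fineK Afin) lee_fin.
have : fine A `^ (p - 1) <= C `^ p / c.
  rewrite ler_pdivlMr// -(ler_pM2l Ap) mulrA (mulr_powRB1 (ltW Ap) p0).
  by rewrite [leRHS]mulrC /c mulrA.
move=> h3; rewrite -[leLHS](powRr1 (ltW Ap)) -(@mulfV _ (p - 1)) ?gt_eqF ?subr_gt0// powRrM.
by apply: ge0_ler_powR; rewrite ?nnegrE ?invr_ge0 ?subr_ge0 ?(ltW p1) ?powR_ge0 ?divr_ge0 ?powR_ge0 ?(ltW c0).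
Qed.

End BoundedProjection.

(** * Representation of functionals under a bounded projection *)

Section Duality.
Variable R : realType.
Local Notation D := (@disc R).
Local Notation rad := (@rad R).
Local Notation kap := (@kap R).
Local Notation I01 := (`[(0 : R), 1[%classic : set R).
Variables (p : R) (w nu : R -> R).
Hypothesis p1 : 1 < p.
Hypothesis rw : radial_weight w.
Hypothesis rn : radial_weight nu.
Local Notation p' := (conj_exp p).
Local Notation sig := (sigma p w nu).
Local Notation rsig := (sigma_fin p w nu).
Local Notation nuE := (fun r => (nu r)%:E).
Implicit Types (f g h : R[i] -> R[i]) (a : nat -> R[i]).

Let p0 : 0 < p := lt_trans ltr01 p1.
Let q1 : 1 < p' := conj_exp_gt1 p1.
Let q0 : 0 < p' := conj_exp_gt0 p1.
Let n0 r : 0 <= r < 1 -> 0 <= nu r. Proof. exact: radial_weight_ge0. Qed.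
Let w0 r : 0 <= r < 1 -> 0 <= w r. Proof. exact: radial_weight_ge0. Qed.
Let s0 r : 0 <= r < 1 -> 0 <= rsig r. Proof. exact: sigma_fin_ge0. Qed.

Lemma powR_conj_split (t x : R) : 1 < t -> 0 <= x -> x = x `^ (conj_exp t)^-1 * x `^ t^-1.
Proof.
move=> t1; rewrite le_eqVlt => /orP[/eqP <-|xp].
  by rewrite powR0 ?mul0r// invr_eq0 gt_eqF// conj_exp_gt0.
by rewrite -powRD ?(gt_eqF xp) ?implybT// (conj_exp_inv t1) powRr1// ltW.
Qed.

(* As [x / 0 = 0], [dualfun t e f] vanishes where [w] does. *)
Definition dualfun (t : R) (e : R -> R) f (z : R[i]) : R[i] :=
  f z * ((cabs (f z) `^ (t - 2) * (e (cabs z) / w (cabs z)))%:C)%C.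

Lemma cabs_dualfun t e f q : 1 < t -> D q -> 0 <= e (rad q) ->
  cabs (dualfun t e f (cplx q)) = cabs (f (cplx q)) `^ (t - 1) * e (rad q) / w (rad q).
Proof.
move=> t1 qD e0; rewrite /dualfun cabsM cabs_real -/(rad q) ger0_norm; last first.
  by rewrite mulr_ge0 ?powR_ge0// divr_ge0// w0 ?rad_in01.
rewrite !mulrA; congr (_ * _ * _).
(* At a zero of f the factor f z decides, whatever the value of 0 to the power t - 2. *)
have [->|xn] := eqVneq (cabs (f (cplx q))) 0; first by rewrite mul0r powR0// subr_eq0 gt_eqF.
have xp : 0 < cabs (f (cplx q)) by rewrite lt_neqAle eq_sym xn cabs_ge0.
rewrite (_ : t - 1 = 1 + (t - 2)); last by ring.
by rewrite (@powRD _ _ 1 (t - 2)) ?(gt_eqF xp) ?implybT// powRr1 ?cabs_ge0.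
Qed.

(** The density w of the pairing cancels the quotient e / w except where w = 0, and there the
    condition on e makes both sides vanish. *)
Lemma dualfun_pair t e f q : 0 < t -> D q -> (w (rad q) = 0 -> e (rad q) = 0) ->
  dualfun t e f (cplx q) * conjc (f (cplx q)) * ((w (rad q))%:C)%C =
  ((cabs (f (cplx q)) `^ t * e (rad q))%:C)%C.
Proof.
move=> t0 qD we; rewrite /dualfun -/(rad q) [f _ * _ * conjc _]mulrAC mul_conjc.
rewrite -!rmorphM /=; congr (_%:C)%C.
have -> : cabs (f (cplx q)) `^ t = cabs (f (cplx q)) ^+ 2 * cabs (f (cplx q)) `^ (t - 2).
  have [->|xn] := eqVneq (cabs (f (cplx q))) 0.
    by rewrite expr0n mul0r powR0 ?gt_eqF.
  by rewrite -powR_mulrn ?cabs_ge0// -powRD ?xn ?implybT//; congr (_ `^ _); ring.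
have [wz|wn] := eqVneq (w (rad q)) 0; first by rewrite wz (we wz) mulr0 mulr0.
by field.
Qed.

Lemma measurable_dualfun t e f : cmeasurable f -> measurable_fun I01 e ->
  cmeasurable (dualfun t e f).
Proof.
move=> mf me; apply: (cmeasM mf).
apply: (@cmeas_real _ (fun q => cabs (f (cplx q)) `^ (t - 2) * (e (rad q) / w (rad q)))).
apply: measurable_funM; first exact: (measurable_cabs_powR (t - 2) mf).
by apply: measurable_funM; [exact: measurable_radial|exact: measurable_weightV].
Qed.

(** The part of nu visible to the pairing, whose density is w: testing against phi controls norms
    only in this weight. *)
Definition nuw (r : R) : R := if w r == 0 then 0 else nu r.

Lemma nuw_ge0 r : 0 <= r < 1 -> 0 <= nuw r.
Proof. by move=> /n0; rewrite /nuw; case: ifP. Qed.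

Lemma nuw_le r : 0 <= r < 1 -> nuw r <= nu r.
Proof. by move=> /n0; rewrite /nuw; case: ifP. Qed.

Lemma measurable_nuw : measurable_fun I01 nuw.
Proof.
have mn := radial_weight_meas rn.
have mI : measurable I01 by exact: measurable_itv.
rewrite /nuw; apply: measurable_fun_if => //.
- by apply: measurable_fun_eqr => //; exact: radial_weight_meas.
- by apply: measurable_funS mn.
Qed.

(** (p - 1) p' = p, and (nu / w)^p' sigma = nu where both weights are positive. Where nu = 0 < w,
    sigma is infinite but its factor is 0, and the product is 0. *)
Lemma sigma_nu_dual r (b : R) : 0 <= r < 1 -> 0 <= b ->
  (((b `^ (p - 1) * nuw r / w r) `^ p')%:E * sig r <= (b `^ p * nuw r)%:E)%E.
Proof.
move=> r01 b0; have h0 : (0 <= (b `^ p * nuw r)%:E)%E by rewrite lee_fin mulr_ge0 ?powR_ge0 ?nuw_ge0.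
move: h0; rewrite /nuw; case: (sigmaP p1 rw rn r01) => [wz|nz wp|s nup wp sp e1 e2] h0.
- by rewrite mule0.
- by rewrite gt_eqF// nz mulr0 mul0r powR0 ?gt_eqF// mul0e mulr0.
- rewrite gt_eqF// -EFinM lee_fin -[b `^ _ * _ / _]mulrA powRM ?powR_ge0 ?divr_ge0 ?(ltW wp) ?(ltW nup)//.
  rewrite -powRrM (conj_expB1 p1) -mulrA ler_wpM2l ?powR_ge0//.
  have nn : nu r `^ p'^-1 != 0 by rewrite gt_eqF// powR_gt0.
  have ss : s `^ p'^-1 != 0 by rewrite gt_eqF// powR_gt0.
  have nn' : nu r `^ p^-1 != 0 by rewrite gt_eqF// powR_gt0.
  have -> : nu r / w r = (nu r / s) `^ p'^-1.
    rewrite powRM ?invr_ge0 ?(ltW sp) ?(ltW nup)// powRV ?(ltW sp)//.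
    by rewrite {1}(powR_conj_split p1 (ltW nup)) e2; field; rewrite ?nn' ?ss.
  rewrite -powRrM mulVf ?gt_eqF// powRr1 ?divr_ge0 ?(ltW sp) ?(ltW nup)//.
  by rewrite divfK// gt_eqF.
Qed.

(** The mirror estimate: (p' - 1) p = p', and (sigma / w)^p nu = sigma where both weights are
    positive. *)
Lemma sigma_rsig_dual r (b : R) : 0 <= r < 1 -> 0 <= b ->
  (b `^ (p' - 1) * rsig r / w r) `^ p * nu r <= b `^ p' * rsig r.
Proof.
move=> r01 b0; rewrite /sigma_fin.
case: (sigmaP p1 rw rn r01) => [wz|nz wp|s nup wp sp e1 e2] /=.
- by rewrite mulr0 mul0r powR0 ?gt_eqF// mul0r mulr0.
- by rewrite nz !mulr0.
- rewrite -[b `^ _ * s / _]mulrA powRM ?powR_ge0 ?divr_ge0 ?(ltW wp) ?(ltW sp)//.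
  rewrite -powRrM (conj_expB1' p1) -mulrA ler_wpM2l ?powR_ge0//.
  rewrite powRM ?invr_ge0 ?(ltW wp) ?(ltW sp)// powRV ?(ltW wp)// -(mulr_powRB1 (ltW sp) p0) e1.
  rewrite le_eqVlt; apply/orP; left; apply/eqP.
  by field; rewrite !gt_eqF ?powR_gt0.
Qed.

Hypothesis Is : (dAint (fun q => sig (rad q)) < +oo)%E.
Variable C : R.
Hypothesis hC : projection_bound p w nu C.

Let C0 : 0 < C. Proof. by case: hC. Qed.
Let mrs : measurable_fun D (fun q => rsig (rad q)) := @sigma_fin_measD R p w nu rw rn.

(** B is a real number, so B^(1/t) can be cancelled when it is nonzero. The finiteness this
    presupposes is secured by testing on Fejer means. *)
Lemma self_bound (t B X : R) : 1 < t -> 0 <= B -> 0 <= X -> B <= X * B `^ t^-1 ->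
  B `^ (conj_exp t)^-1 <= X.
Proof.
move=> t1 B0 X0 h; have t0 : 0 < t := lt_trans ltr01 t1.
have [->|Bn] := eqVneq B 0.
  by rewrite powR0// invr_eq0 gt_eqF// conj_exp_gt0.
have Bp : 0 < B by rewrite lt_neqAle eq_sym Bn.
by rewrite -(ler_pM2r (powR_gt0 t^-1 Bp)) -powR_conj_split.
Qed.

Lemma Lp_sigma_fejS a N : Lp p' sig (fejS a N).
Proof.
have [M M0 hM] := fejS_bounded a N.
by apply: (Lp_sigma_bounded p1 rw rn Is _ M0 hM); exact: cmeas_fejS.
Qed.

Lemma Lp_nu_fejS a N : Lp p nuE (fejS a N).
Proof.
have [M M0 hM] := fejS_bounded a N.
by apply: (Lp_nu_bounded p1 rn _ M0 hM); exact: cmeas_fejS.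
Qed.

(** The norm is computed by testing against [psi], and symmetry moves S_N P_w onto [psi]. The 2
    comes from [Tg_le] and C from the projection; the Fejer mean contributes no constant, so the
    bound is uniform in N. *)
Lemma fejS_Pcoef_sigma f N : (0 < N)%N -> Lp p' sig f ->
  Lpnorm p' sig (fejS (Pcoef w f) N) <= 2 * C * Lpnorm p' sig f.
Proof.
move=> N0 hf; set h := fejS _ N.
have hh : Lp p' sig h := Lp_sigma_fejS _ _.
have [mh _] := hh.
pose psi := dualfun p' rsig h.
have mpsi : cmeasurable psi by exact: (measurable_dualfun p' mh (@sigma_fin_meas R p w nu rw rn)).
(* [B = <h, psi> = <f, S_N P_w psi> <= 2 |f| C |psi|_nu] and [|psi|_nu ^ p <= B]. *)
set B := Lpnorm p' sig h `^ p'.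
have B0 : 0 <= B by exact: powR_ge0.
have eB : Lp_pow p' sig h = B%:E.
  by rewrite /B Lpnorm_powR// Lp_pow_sigma_ge0.
have hpsi : (Lp_pow p nuE psi <= B%:E)%E.
  rewrite -eB (Lp_pow_sigmaE p1 rw rn Is mh) Lp_pow_nuE; apply: le_dAint.
  - by apply: wint_meas => //; exact: radial_weight_measD.
  - exact: wint_meas.
  - by move=> q qD; rewrite lee_fin mulr_ge0 ?powR_ge0// n0 ?rad_in01.
  - move=> q qD; rewrite lee_fin cabs_dualfun ?s0 ?rad_in01//.
    by apply: sigma_rsig_dual; [exact: rad_in01|exact: cabs_ge0].
have Lpsi : Lp p nuE psi by split => //; apply: le_lt_trans hpsi (ltry _).
have L1psi : L1w w psi by exact: Lp_nu_L1w Is _ Lpsi.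
have L1f : L1w w f by exact: Lp_sigma_L1w hf.
have e1 : Tg w psi h = (B%:C)%C.
  have [M M0 hM] := fejS_bounded (Pcoef w f) N.
  rewrite TgC; last exact: (L1w_cintegrable rw L1psi mh M0 hM).
  rewrite /Tg (@cint_eq _ _ (fun q => ((cabs (h (cplx q)) `^ p' * rsig (rad q))%:C)%C)); last first.
    move=> q qD; rewrite /pair_int dualfun_pair//.
    by move=> wz; rewrite /sigma_fin (sigma0 nu p1 wz).
  rewrite cint_real.
  - by rewrite conjc_real (_ : dAint _ = B%:E)//; rewrite -eB (Lp_pow_sigmaE p1 rw rn Is mh).
  - by apply: measurable_funM => //; exact: measurable_cabs_powR.
  - by move=> q qD; rewrite mulr_ge0 ?powR_ge0// s0 ?rad_in01.
  - by case: hh => _; rewrite (Lp_pow_sigmaE p1 rw rn Is mh).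
have hB : B <= 2 * (Lpnorm p' sig f * (C * B `^ p^-1)).
  rewrite -[leLHS](ger0_norm B0) -cabs_real -e1 /h (Tg_fejS_sym rw _ L1f L1psi).
  apply: le_trans (Tg_le p1 rw rn hf (Lp_nu_fejS (Pcoef w psi) N)) _.
  rewrite ler_wpM2l// ler_wpM2l ?Lpnorm_ge0//.
  apply: (Lpnorm_le p0 (Lp_pow_nu_ge0 p rn _)); first by rewrite mulr_ge0 ?powR_ge0 ?(ltW C0).
  rewrite Lp_pow_nuE.
  apply: le_trans (wint_fejS (ltW p1) n0 (radial_weight_measD rn) (rad1_Pcoef rw L1psi) N0) _.
  apply: le_trans (hC.2 _ Lpsi L1psi) _.
  rewrite powRM ?powR_ge0 ?(ltW C0)// -powRrM mulVf ?gt_eqF// powRr1// EFinM.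
  by rewrite lee_wpmul2l ?lee_fin ?powR_ge0.
have -> : Lpnorm p' sig h = B `^ p'^-1.
  by rewrite /B -powRrM mulfV ?gt_eqF// powRr1 ?Lpnorm_ge0.
apply: self_bound => //; first by rewrite !mulr_ge0 ?Lpnorm_ge0 ?(ltW C0).
by apply: le_trans hB _; rewrite le_eqVlt; apply/orP; left; apply/eqP; ring.
Qed.

Lemma Ap_sigma_fejS a N : Ap p' sig (fejS a N).
Proof. by split; [exact: Lp_sigma_fejS|exact: analytic_fejS]. Qed.

Lemma Ap_sigma_poly (c : nat -> R[i]) N : Ap p' sig (fun z => \sum_(0 <= n < N) c n * z ^+ n).
Proof.
split.
  apply: (@Lp_sigma_bounded _ p w nu p1 rw rn Is _ (\sum_(0 <= n < N) cabs (c n))).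
  - apply: cmeas_sum => n; apply: cmeasM; first exact: cmeas_cst.
    by apply: cmeasX; exact: cmeas_cplx.
  - by apply: sumr_ge0 => n _; exact: cabs_ge0.
  - move=> q qD; apply: le_trans (cabs_sum _ _ _) _; apply: ler_sum => n _.
    by rewrite cabsM ler_piMr ?cabs_ge0//; exact: cabs_mon.
by have [b hb e] := poly_ps c N; apply: (analytic_ps hb) => z _; exact: e.
Qed.

Lemma Ap_sigma_mon n : Ap p' sig (mon n).
Proof. by split; [exact: Lp_sigma_mon|exact: analytic_mon]. Qed.

Section Functional.
Variable L : (R[i] -> R[i]) -> R[i].
Hypothesis lL : linear_on (Ap p' sig) L.
Variable CL : R.
Hypothesis CL0 : 0 <= CL.
Hypothesis bL : forall f, Ap p' sig f -> cabs (L f) <= CL * Lpnorm p' sig f.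

Lemma functional_sum (c : nat -> R[i]) N :
  L (fun z => \sum_(0 <= n < N) c n * z ^+ n) = \sum_(0 <= n < N) c n * L (mon n).
Proof.
elim: N => [|N ih].
  have e : (fun z : R[i] => \sum_(0 <= n < 0) c n * z ^+ n) = fejS c 0.
    by apply/funext => z; rewrite /fejS !big_nil.
  rewrite e big_nil.
  (* [fejS c 0] is the zero function; with a = 1, linearity reads L(0) = L(0) + L(0). *)
  have := lL 1 (Ap_sigma_fejS c 0) (Ap_sigma_fejS c 0).
  have -> : (fun z => fejS c 0 z + 1 * fejS c 0 z) = fejS c 0.
    by apply/funext => z; rewrite /fejS !big_nil mulr0 addr0.
  rewrite mul1r => /eqP; rewrite -subr_eq0 opprD addrA subrr sub0r oppr_eq0 => /eqP.
  exact.
have e : (fun z => \sum_(0 <= n < N.+1) c n * z ^+ n) =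
    (fun z => (fun z => \sum_(0 <= n < N) c n * z ^+ n) z + c N * mon N z).
  by apply/funext => z; rewrite big_nat_recr.
rewrite e (lL (c N) (Ap_sigma_poly c N) (Ap_sigma_mon N)) ih.
by rewrite big_nat_recr.
Qed.

Lemma functional_fejS a N :
  L (fejS a N) = \sum_(0 <= n < N) ((fejw R N n)%:C)%C * (a n * L (mon n)).
Proof.
have -> : fejS a N = (fun z => \sum_(0 <= n < N) (((fejw R N n)%:C)%C * a n) * z ^+ n).
  by apply/funext => z; apply: eq_bigr => n _; rewrite mulrA.
by rewrite functional_sum; apply: eq_bigr => n _; rewrite mulrA.
Qed.

(** Forced by the requirement <z^n, g> = L(z^n), since <z^n, z^n> = 2 [kap] w_(2n+1). *)
Definition symbol n : R[i] := conjc (L (mon n)) * bcoef w n * ((kap^-1)%:C)%C.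

(** |L(z^n)| is bounded uniformly in n by CL times the norm of 1 in L^p'_sigma, so the growth is
    that of the kernel coefficients. *)
Lemma rad1_symbol : rad1 symbol.
Proof.
pose M := CL * (fine (dAint (fun q => sig (rad q)))) `^ p'^-1.
have M0 : 0 <= M by rewrite mulr_ge0 ?powR_ge0.
have hM n : cabs (L (mon n)) <= M.
  apply: le_trans (bL (Ap_sigma_mon n)) (ler_wpM2l CL0 _).
  have sg : (0 <= dAint (fun q => sig (rad q)))%E.
    by apply: dAint_ge0 => q qD; exact: sigma_ge0 p1 rw rn _ (rad_in01 qD).
  apply: (Lpnorm_le q0 (Lp_pow_sigma_ge0 p1 rw rn _)); first exact: powR_ge0.
  rewrite -powRrM mulVf ?gt_eqF// powRr1 ?fine_ge0// fineK ?ge0_fin_numE//.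
  have msig : measurable_fun D (fun q => sig (rad q)) := measurable_radial (measurable_sigma p rw rn).
  apply: le_dAint.
  - exact: (Lp_pow_meas p' (cmeasurable_mon R n) (measurable_sigma p rw rn)).
  - exact: msig.
  - by move=> q qD; rewrite mule_ge0 ?lee_fin ?powR_ge0// (sigma_ge0 p1 rw rn) ?rad_in01.
  - move=> q qD; rewrite -[leRHS]mul1e lee_wpmul2r ?(sigma_ge0 p1 rw rn) ?rad_in01// lee_fin.
    rewrite -[leRHS](_ : 1 `^ p' = 1); last by rewrite powR1.
    apply: ge0_ler_powR; rewrite ?nnegrE ?cabs_ge0 ?(ltW q0)//.
    exact: cabs_mon.
apply: rad1_bounded => r r01; have [K K0 hK] := rad1_bound (rad1_bcoef rw) r01.
exists (M * K * kap^-1) => n; rewrite /symbol !cabsM cabs_conj (cabs_real kap^-1).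
have k0 := kap_gt0 R; rewrite ger0_norm ?invr_ge0 ?(ltW k0)// mulrAC ler_wpM2r ?invr_ge0 ?(ltW k0)//.
rewrite -mulrA ler_pM ?cabs_ge0// mulr_ge0 ?cabs_ge0 ?exprn_ge0//.
by case/andP: r01.
Qed.

Let g : R[i] -> R[i] := ps symbol.

(** The constant is a product of two: testing against phi controls G in the weight [nuw] with 2 C CL
    / [kap], and one more application of the projection passes from [nuw] to nu at the cost of C /
    [kap]. *)
Lemma fejS_symbol_bound N : (0 < N)%N ->
  (wint p nu (fun q => fejS symbol N (cplx q)) <= ((C / kap * (2 * C * CL / kap)) `^ p)%:E)%E.
Proof.
move=> N0; set G := fejS symbol N; have k0 := kap_gt0 R.
have mG : cmeasurable G := @cmeas_fejS _ symbol N.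
have LG : Lp p nuE G := Lp_nu_fejS _ _.
pose phi := dualfun p nuw G.
have mphi : cmeasurable phi := measurable_dualfun p mG measurable_nuw.
have mnw : measurable_fun D (fun q => nuw (rad q)) := measurable_radial measurable_nuw.
pose A := wint p nuw (fun q => G (cplx q)).
have A0 : (0 <= A)%E by apply: wint_ge0; exact: nuw_ge0.
have Aoo : (A < +oo)%E.
  case: LG => _; rewrite Lp_pow_nuE; apply: le_lt_trans; apply: le_dAint.
  - exact: wint_meas.
  - by apply: wint_meas => //; exact: radial_weight_measD.
  - by move=> q qD; rewrite lee_fin mulr_ge0 ?powR_ge0 ?nuw_ge0 ?rad_in01.
  - by move=> q qD; rewrite lee_fin ler_wpM2l ?powR_ge0 ?nuw_le ?rad_in01.
have fA : A \is a fin_num by rewrite ge0_fin_numE.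
have hphi : (Lp_pow p' sig phi <= A)%E.
  apply: le_dAint.
  - exact: (Lp_pow_meas p' mphi (measurable_sigma p rw rn)).
  - exact: wint_meas.
  - by move=> q qD; rewrite mule_ge0 ?lee_fin ?powR_ge0// (sigma_ge0 p1 rw rn) ?rad_in01.
  - move=> q qD; rewrite cabs_dualfun ?nuw_ge0 ?rad_in01//.
    by apply: sigma_nu_dual; [exact: rad_in01|exact: cabs_ge0].
have Lphi : Lp p' sig phi by split => //; exact: le_lt_trans hphi Aoo.
have L1phi : L1w w phi by exact: Lp_sigma_L1w Lphi.
have nphi : Lpnorm p' sig phi <= fine A `^ p'^-1.
  apply: (Lpnorm_le q0 (Lp_pow_sigma_ge0 p1 rw rn _)); first exact: powR_ge0.
  by rewrite -powRrM mulVf ?gt_eqF// powRr1 ?fine_ge0// fineK.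
have e1 : Tg w G phi = ((fine A)%:C)%C.
  rewrite /Tg (@cint_eq _ _ (fun q => ((cabs (G (cplx q)) `^ p * nuw (rad q))%:C)%C)); last first.
    by move=> q qD; rewrite /pair_int dualfun_pair// /nuw => ->; rewrite eqxx.
  rewrite cint_real//.
  - by apply: measurable_funM => //; exact: measurable_cabs_powR.
  - by move=> q qD; rewrite mulr_ge0 ?powR_ge0 ?nuw_ge0 ?rad_in01.
(* Both sides are finite sums over n: the n-th term of L(S_N P_w phi) contains b_n L(z^n), which is
   [kap] times the conjugate of the n-th coefficient of g. *)
have e2 : L (fejS (Pcoef w phi) N) = ((kap * fine A)%:C)%C.
  rewrite rmorphM /= -e1 /G (Tg_fejSr rw _ _ L1phi) functional_fejS mulr_sumr.
  apply: eq_bigr => n _; rewrite /symbol /Pcoef !conjcM conjcK conjc_bcoef conjc_real.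
  have -> : ((kap^-1)%:C)%C = ((kap%:C)%C)^-1 by rewrite fmorphV.
  have kn : (kap%:C)%C != 0 by rewrite fmorph_eq0 gt_eqF.
  have kk := mulfV kn; set kc := (kap%:C)%C in kk *; set ki := kc^-1 in kk *.
  by rewrite -[LHS]mul1r -kk; ring.
have hA : kap * fine A <= CL * (2 * C * fine A `^ p'^-1).
  rewrite -[leLHS]ger0_norm ?mulr_ge0 ?fine_ge0 ?(ltW k0)// -cabs_real -e2.
  apply: le_trans (bL (Ap_sigma_fejS _ _)) _; rewrite ler_wpM2l//.
  apply: le_trans (fejS_Pcoef_sigma N0 Lphi) _.
  by rewrite ler_wpM2l// mulr_ge0// ltW.
pose X := 2 * C * CL / kap.
have X0 : 0 <= X by rewrite divr_ge0 ?mulr_ge0 ?(ltW C0) ?(ltW k0).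
have hX : fine A `^ p^-1 <= X.
  have pp : conj_exp p' = p.
    by rewrite {1}/conj_exp; apply: (canLR (mulfK _)); rewrite ?gt_eqF ?subr_gt0// mulrC conj_expB1'.
  rewrite -{1}pp; apply: self_bound => //; first by rewrite fine_ge0.
  rewrite -(ler_pM2l k0); apply: le_trans hA _.
  rewrite le_eqVlt; apply/orP; left; apply/eqP; rewrite /X; field.
  by rewrite gt_eqF.
have hX' : fine A <= X `^ p.
  rewrite -[leLHS](powRr1 (fine_ge0 A0)) -(@mulVf _ p) ?gt_eqF// powRrM.
  by apply: ge0_ler_powR; rewrite ?nnegrE ?powR_ge0 ?(ltW p0).
(* G1 differs from G only where w = 0, so both have the same projection, [kap] G by reproduction;
   yet the norm of G1 in L^p_nu is the [nuw]-norm of G, already bounded by X. *)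
pose G1 z := G z * (((w (cabs z) != 0)%:R)%:C)%C.
have mwn : measurable_fun D (fun q => (w (rad q) != 0)%:R : R).
  apply: (@measurable_radial _ _ _ (fun r => (w r != 0)%:R : R)).
  rewrite (_ : (fun r => _) = (fun r => if w r == 0 then 0 else 1)); last first.
    by apply/funext => r; case: (w r == 0).
  have mI : measurable I01 by exact: measurable_itv.
  apply: measurable_fun_if => //.
  by apply: measurable_fun_eqr => //; exact: radial_weight_meas.
have mG1 : cmeasurable G1 by apply: (cmeasM mG); exact: (cmeas_real mwn).
have eG1 : Lp_pow p nuE G1 = A.
  rewrite Lp_pow_nuE; apply: eq_dAint => q qD; rewrite /wfun /G1 /nuw cabsM cabs_real -/(rad q).
  case: (w (rad q) == 0) => /=; last by rewrite normr1 mulr1.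
  by rewrite normr0 !mulr0 powR0 ?gt_eqF// mul0r.
have LG1 : Lp p nuE G1 by split => //; rewrite eG1.
have L1G1 : L1w w G1 by exact: Lp_nu_L1w Is _ LG1.
have L1G : L1w w G := L1w_fejS rw _ _.
have ePc : Pcoef w G1 = Pcoef w G.
  apply/funext => n; rewrite /Pcoef; congr (_ * _); apply: cint_eq => q _.
  rewrite /pair_int /G1 -/(rad q); have [->|_] := eqVneq (w (rad q)) 0; first by rewrite !mulr0.
  by rewrite mulr1.
have [b hb Gb] := fejS_ps symbol N.
have := hC.2 _ LG1 L1G1; rewrite ePc eG1.
have -> : wint p nu (fun q => ps (Pcoef w G) (cplx q)) = ((kap `^ p)%:E * wint p nu (fun q => G (cplx q)))%E.
  rewrite /wint -dAintZ ?powR_ge0//.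
  - apply: eq_dAint => q qD; rewrite /wfun -(Pw_ps rw L1G qD).2.
    rewrite (Pw_reproduce rw hb (fun z _ => Gb z) L1G qD) cabsM cabs_real (ger0_norm (ltW k0)).
    by rewrite powRM ?cabs_ge0 ?(ltW k0)// -EFinM mulrA.
  - by apply: wint_meas => //; exact: radial_weight_measD.
  - by move=> q qD; apply: wfun_ge0.
have [_ GI] := LG; rewrite Lp_pow_nuE in GI.
have fG : wint p nu (fun q => G (cplx q)) \is a fin_num.
  by rewrite ge0_fin_numE//; apply: wint_ge0.
rewrite -(fineK fG) -(fineK fA) -!EFinM !lee_fin => h1.
have ck0 : 0 <= C / kap by rewrite divr_ge0 ?(ltW C0) ?(ltW k0).
have ki0 : 0 <= kap^-1 by rewrite invr_ge0 (ltW k0).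
rewrite -/X (@powRM _ _ X p ck0 X0) (@powRM _ C kap^-1 p (ltW C0) ki0) (powRV _ (ltW k0)).
rewrite -(ler_pM2l (powR_gt0 p k0)); apply: le_trans h1 _.
apply: (@le_trans _ _ (C `^ p * X `^ p)); first by rewrite ler_wpM2l ?powR_ge0.
rewrite le_eqVlt; apply/orP; left; apply/eqP; field.
by rewrite gt_eqF// powR_gt0.
Qed.

Let norm_bound := C / kap * (2 * C * CL / kap).

Let norm_bound_ge0 : 0 <= norm_bound.
Proof. by rewrite /norm_bound !mulr_ge0 ?invr_ge0 ?(ltW C0) ?(ltW (kap_gt0 R)). Qed.

Lemma symbol_bound : (Lp_pow p nuE g <= (norm_bound `^ p)%:E)%E.
Proof.
rewrite Lp_pow_nuE.
apply: (@dAint_fatou _ (fun N => wfun p nu (fun q => fejS symbol N.+1 (cplx q)))).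
- move=> N; apply: wint_meas; first exact: radial_weight_measD.
  exact: cmeas_fejS.
- by move=> N q qD; apply: wfun_ge0.
- move=> q qD; apply: cvg_EFin; first exact: nearW.
  apply: cvgM; last exact: cvg_cst.
  apply: cvg_powR => //; first by move=> n; exact: cabs_ge0.
  have := ccvg_cabs (ccvg_shift 1 (fejS_cvg rad1_symbol qD)).
  by under eq_fun do rewrite addn1.
- by move=> N; exact: fejS_symbol_bound.
Qed.

Lemma Ap_symbol : Ap p nuE g.
Proof.
split; last by apply: (analytic_ps rad1_symbol).
split; first exact: cmeas_ps rad1_symbol.
exact: le_lt_trans symbol_bound (ltry _).
Qed.

Lemma Tg_symbol_mon n : Tg w g (mon n) = L (mon n).
Proof.
have L1g : L1w w g by apply: Lp_nu_L1w Is _ _ => //; case: Ap_symbol.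
rewrite TgC; last exact: mon_pair_int.
rewrite (Tg_coef rw n rad1_symbol (fun z _ => erefl) L1g) /symbol !conjcM conjcK conjc_bcoef !conjc_real.
have k0 := kap_gt0 R; have m0 := moment_gt0 rw (2 * n + 1).
rewrite /bcoef -!mulrA -!rmorphM /= [X in (X%:C)%C](_ : _ = 1) ?mulr1//.
by field; rewrite !gt_eqF.
Qed.

(** L and T_g agree on Fejer means since they agree on monomials. Both are bounded, with constants
    adding up to K, so |L f - T_g f| is at most K times the distance from f to a Fejer mean, which
    can be made arbitrarily small. *)
Lemma functional_symbol f : Ap p' sig f -> L f = Tg w g f.
Proof.
move=> hf; have [Lf af] := hf; have [a ha fa] := analytic_taylor af.
have [Lg _] := Ap_symbol; have L1g : L1w w g by exact: Lp_nu_L1w Is _ Lg.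
have g0 := Lpnorm_ge0 p nuE g.
pose K := CL + 2 * Lpnorm p nuE g.
have K0 : 0 <= K by rewrite addr_ge0 ?mulr_ge0.
have If : (wint p' rsig (fun q => ps a (cplx q)) < +oo)%E.
  case: Lf => mf; rewrite (Lp_pow_sigmaE p1 rw rn Is mf).
  have -> : wint p' rsig (fun q => f (cplx q)) = wint p' rsig (fun q => ps a (cplx q)).
    by apply: eq_dAint => q qD; rewrite /wfun (fa _ qD).
  exact.
have key (e : R) : 0 < e -> cabs (L f - Tg w g f) <= K * e.
  move=> e0; have e0' : 0 < e `^ p' by exact: powR_gt0.
  have [N _ hN] := wint_cvg (ltW q1) s0 mrs ha If 0 e0'.
  pose d z := fejS a N z + (-1) * f z.
  have mS : cmeasurable (fejS a N) := @cmeas_fejS _ a N.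
  have md : cmeasurable d.
    by apply: (cmeasD mS); apply: cmeasM; [exact: cmeas_cst|case: Lf].
  have dle : (Lp_pow p' sig d <= (e `^ p')%:E)%E.
    rewrite (Lp_pow_sigmaE p1 rw rn Is md); apply: le_trans (ltW hN).
    rewrite le_eqVlt; apply/orP; left; apply/eqP; apply: eq_dAint => q qD.
    by rewrite /wfun /d (fa _ qD) mulN1r.
  have Ld : Lp p' sig d by split => //; exact: le_lt_trans dle (ltry _).
  have ad : analytic_in_disc d.
    exact: (@analytic_addZ R _ _ (-1) (@analytic_fejS R a N) af).
  have Ad : Ap p' sig d := conj Ld ad.
  have nd : Lpnorm p' sig d <= e by exact: (Lpnorm_le q0 (Lp_pow_sigma_ge0 p1 rw rn _) (ltW e0) dle).
  have eL : L d = L (fejS a N) - L f by rewrite (lL (-1) (Ap_sigma_fejS a N) hf) mulN1r.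
  have eT : Tg w g d = Tg w g (fejS a N) - Tg w g f.
    have i1 := pair_cintegrable p1 rw rn (Lp_sigma_fejS a N) Lg.
    have i2 := pair_cintegrable p1 rw rn Lf Lg.
    rewrite /Tg -[- cint _]mulN1r -(cintZ (-1) i2) -(cintD i1 (cintegrableZ (-1) i2)).
    by apply: cint_eq => q _; rewrite /pair_int /d; ring.
  have eS : L (fejS a N) = Tg w g (fejS a N).
    rewrite functional_fejS (Tg_fejSl rw _ _ L1g); apply: eq_bigr => n _; congr (_ * (_ * _)).
    by rewrite -Tg_symbol_mon TgC//; exact: mon_pair_int.
  have -> : L f - Tg w g f = Tg w g d - L d by rewrite eL eT eS; ring.
  rewrite (le_trans (cabsD _ _))// cabsN addrC mulrDl; apply: lerD.
    by apply: le_trans (bL Ad) _; rewrite ler_wpM2l.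
  apply: le_trans (Tg_le p1 rw rn Ld Lg) _; rewrite -mulrA ler_wpM2l//.
  by rewrite [leLHS]mulrC; exact: (ler_wpM2l g0 nd).
apply/eqP; rewrite -subr_eq0 -cabs_eq0 eq_le cabs_ge0 andbT.
apply/ler_addgt0Pr => e e0; rewrite add0r.
have K1 : 0 < K + 1 by rewrite ltr_wpDl.
apply: le_trans (key (e / (K + 1)) (divr_gt0 e0 K1)) _.
rewrite mulrA ler_pdivrMr// mulrC ler_wpM2l ?(ltW e0)//.
by rewrite lerDl.
Qed.

Lemma Lpnorm_symbol : Lpnorm p nuE g <= norm_bound.
Proof. exact: (Lpnorm_le p0 (Lp_pow_nu_ge0 p rn _) norm_bound_ge0 symbol_bound). Qed.

End Functional.

Lemma functional_representation L CL : linear_on (Ap p' sig) L -> 0 <= CL ->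
  (forall f, Ap p' sig f -> cabs (L f) <= CL * Lpnorm p' sig f) ->
  exists g, [/\ Ap p nuE g, forall f, Ap p' sig f -> L f = Tg w g f &
    Lpnorm p nuE g <= 2 * (C / kap) ^+ 2 * CL].
Proof.
move=> lL CL0 bL; exists (ps (symbol L)); split.
- exact: (Ap_symbol lL CL0 bL).
- by move=> f; exact: (functional_symbol lL CL0 bL).
- apply: le_trans (Lpnorm_symbol lL CL0 bL) _.
  rewrite le_eqVlt; apply/orP; left; apply/eqP; rewrite expr2; field.
  by rewrite gt_eqF ?kap_gt0.
Qed.

(** Testing on monomials, which lie in A^p'_sigma since sigma is integrable, recovers the Taylor
    coefficients of both functions. *)
Lemma Ap_nu_unique g1 g2 : Ap p nuE g1 -> Ap p nuE g2 ->
  (forall f, Ap p' sig f -> Tg w g1 f = Tg w g2 f) -> forall z, cdisc z -> g1 z = g2 z.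
Proof.
move=> [L1 A1] [L2 A2] h z z1.
have [a ha ga] := analytic_taylor A1; have [b hb gb] := analytic_taylor A2.
have l1 : L1w w g1 by exact: Lp_nu_L1w Is _ L1.
have l2 : L1w w g2 by exact: Lp_nu_L1w Is _ L2.
have e : a = b.
  apply/funext => n.
  have := h (mon n) (Ap_sigma_mon n).
  rewrite (TgC (mon_pair_int rw n l1)) (TgC (mon_pair_int rw n l2)).
  move=> /(congr1 (@conjc R)); rewrite !conjcK (Tg_coef rw n ha ga l1) (Tg_coef rw n hb gb l2).
  apply: mulIf; rewrite fmorph_eq0 gt_eqF// !mulr_gt0 ?kap_gt0 ?moment_gt0//.
by rewrite ga// gb// e.
Qed.

End Duality.

(** * Equivalence of bounded projection and duality *)

Section BoundedIffDual.
Variable R : realType.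
Local Notation D := (@disc R).
Local Notation rad := (@rad R).
Local Notation kap := (@kap R).
Variables (p : R) (w nu : R -> R).
Hypothesis p1 : 1 < p.
Hypothesis rw : radial_weight w.
Hypothesis rn : radial_weight nu.
Local Notation p' := (conj_exp p).
Local Notation sig := (sigma p w nu).
Local Notation nuE := (fun r => (nu r)%:E).
Implicit Types (f g h : R[i] -> R[i]).

Let p0 : 0 < p := lt_trans ltr01 p1.
Let q1 : 1 < p' := conj_exp_gt1 p1.
Let q0 : 0 < p' := conj_exp_gt0 p1.

Lemma Tg_linear g : Lp p nuE g -> linear_on (Ap p' sig) (Tg w g).
Proof.
move=> hg f h a [hf _] [hh _].
have i1 := pair_cintegrable p1 rw rn hf hg; have i2 := pair_cintegrable p1 rw rn hh hg.
rewrite /Tg -(cintZ a i2) -(cintD i1 (cintegrableZ a i2)).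
by apply: cint_eq => q _; rewrite /pair_int; ring.
Qed.

Lemma Tg_bounded g : Lp p nuE g -> forall f, Ap p' sig f ->
  cabs (Tg w g f) <= 2 * Lpnorm p nuE g * Lpnorm p' sig f.
Proof.
move=> hg f [hf _]; rewrite -mulrA [_ * Lpnorm p' sig f]mulrC; exact: (Tg_le p1 rw rn hf hg).
Qed.

(** Stated for any L that coincides with T_g on the space: in the converse direction one functional
    is induced both by an arbitrary f in L^p_nu and by an analytic g, and the norm of f must bound
    it. *)
Lemma opnorm_Tg_le g (L : (R[i] -> R[i]) -> R[i]) : Lp p nuE g ->
  (forall f, Ap p' sig f -> L f = Tg w g f) ->
  (opnorm (Ap p' sig) (Lpnorm p' sig) L <= (2 * Lpnorm p nuE g)%:E)%E.
Proof.
move=> hg e; apply: ge_ereal_sup => _ [f [hf f1] <-]; rewrite lee_fin e//.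
apply: le_trans (Tg_bounded hg hf) _.
by rewrite -[leRHS]mulr1 ler_wpM2l// mulr_ge0 ?Lpnorm_ge0.
Qed.

Lemma Ap_sigma_scale (k : R[i]) f : Ap p' sig f -> Ap p' sig (fun z => k * f z) /\
  (Lp_pow p' sig (fun z => (k * f z)%R) = (cabs k `^ p')%:E * Lp_pow p' sig f)%E.
Proof.
move=> [[mf If] af].
have e : (Lp_pow p' sig (fun z => (k * f z)%R) = (cabs k `^ p')%:E * Lp_pow p' sig f)%E.
  rewrite /Lp_pow -dAintZ ?powR_ge0//.
  - by apply: eq_dAint => q _; rewrite cabsM powRM ?cabs_ge0// EFinM muleA.
  - exact: (Lp_pow_meas p' mf (measurable_sigma p rw rn)).
  - by move=> q qD; rewrite mule_ge0 ?lee_fin ?powR_ge0// (sigma_ge0 p1 rw rn) ?rad_in01.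
split; last exact: e.
split; last first.
  move=> z z1; have df : derivable (f : R[i]^o -> R[i]^o) z 1 by exact: af.
  exact: (derivableZ df).
split; first by apply: cmeasM => //; exact: cmeas_cst.
by rewrite e lte_mul_pinfty ?lee_fin ?powR_ge0.
Qed.

(** Scaling f to norm 1. If the norm of f is 0, no scaling is possible, but [Tg_bounded] makes the
    value 0. *)
Lemma Tg_opnorm g f : Lp p nuE g -> Ap p' sig f ->
  cabs (Tg w g f) <= fine (opnorm (Ap p' sig) (Lpnorm p' sig) (Tg w g)) * Lpnorm p' sig f.
Proof.
move=> hg hf; set N := opnorm _ _ _.
have N1 : (N <= (2 * Lpnorm p nuE g)%:E)%E by exact: opnorm_Tg_le.
have [z0|zn] := eqVneq (Lpnorm p' sig f) 0.
  by have := Tg_bounded hg hf; rewrite z0 !mulr0.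
have np : 0 < Lpnorm p' sig f by rewrite lt_neqAle eq_sym zn Lpnorm_ge0.
pose k : R := (Lpnorm p' sig f)^-1.
have k0 : 0 < k by rewrite invr_gt0.
have [hk ek] := Ap_sigma_scale (k%:C)%C hf.
have nk : Lpnorm p' sig (fun z => (k%:C)%C * f z) <= 1.
  apply: (Lpnorm_le q0 (Lp_pow_sigma_ge0 p1 rw rn _) ler01).
  rewrite ek -(Lpnorm_powR q0 (Lp_pow_sigma_ge0 p1 rw rn _) hf.1) -EFinM lee_fin.
  by rewrite cabs_real (gtr0_norm k0) -powRM ?Lpnorm_ge0 ?(ltW k0)// mulVf.
have le1 : ((k * cabs (Tg w g f))%:E <= N)%E.
  apply: ereal_sup_ubound; exists (fun z => (k%:C)%C * f z) => //.
  congr (_%:E); rewrite (_ : Tg _ _ _ = (k%:C)%C * Tg w g f).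
    by rewrite cabsM cabs_real gtr0_norm.
  rewrite /Tg -cintZ; last exact: (pair_cintegrable p1 rw rn hf.1 hg).
  by apply: cint_eq => q _; rewrite /pair_int; ring.
have fN : N \is a fin_num.
  rewrite ge0_fin_numE; first exact: le_lt_trans N1 (ltry _).
  by apply: le_trans le1; rewrite lee_fin mulr_ge0 ?cabs_ge0 ?(ltW k0).
by move: le1; rewrite -[N]fineK// lee_fin /k mulrC ler_pdivrMr.
Qed.

Definition dual_statement :=
 [/\
    (forall g, Ap p nuE g ->
       (forall f, Ap p' sig f -> cintegrable (pair_int w g f)) /\
       linear_on (Ap p' sig) (Tg w g) /\
       bounded_on (Ap p' sig) (Lpnorm p' sig) (Tg w g)),
    (forall L : (R[i] -> R[i]) -> R[i],
       linear_on (Ap p' sig) L -> bounded_on (Ap p' sig) (Lpnorm p' sig) L ->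
       exists g, [/\ Ap p nuE g,
         (forall f, Ap p' sig f -> L f = Tg w g f) &
         (forall g', Ap p nuE g' -> (forall f, Ap p' sig f -> L f = Tg w g' f) ->
            forall z, cdisc z -> g' z = g z)]) &
    (exists c C : R, [/\ 0 < c, 0 < C &
       forall g, Ap p nuE g ->
         ((c * Lpnorm p nuE g)%:E <= opnorm (Ap p' sig) (Lpnorm p' sig) (Tg w g))%E /\
         (opnorm (Ap p' sig) (Lpnorm p' sig) (Tg w g) <= (C * Lpnorm p nuE g)%:E)%E])].

Lemma Pw_bounded_dual : Pw_bounded p w nu -> dual_statement.
Proof.
move=> /(Pw_bounded_projection p1 rw rn)[C hC].
have Is := projection_sigma p1 rw rn hC.
have rep := functional_representation p1 rw rn Is hC.
have C0 : 0 < C by case: hC.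
have k0 := kap_gt0 R.
split.
- move=> g [hg _]; split; first by move=> f [hf _]; exact: (pair_cintegrable p1 rw rn hf hg).
  by split; [exact: Tg_linear|exists (2 * Lpnorm p nuE g); exact: Tg_bounded].
- move=> L lL [M hM].
  have M0 : 0 <= Num.max M 0 by rewrite le_max lexx orbT.
  have hM' f : Ap p' sig f -> cabs (L f) <= Num.max M 0 * Lpnorm p' sig f.
    move=> hf; apply: le_trans (hM f hf) _.
    by rewrite ler_wpM2r ?Lpnorm_ge0// le_max lexx.
  have [g [hg Lg _]] := rep L _ lL M0 hM'.
  exists g; split => // g' hg' Lg'.
  apply: (Ap_nu_unique p1 rw rn Is hg' hg) => f hf.
  by rewrite -Lg// -Lg'.
- pose K := 2 * (C / kap) ^+ 2.
  have K0 : 0 < K by rewrite mulr_gt0 ?exprn_gt0 ?divr_gt0.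
  exists K^-1, 2; split => //; first by rewrite invr_gt0.
  move=> g hg; have [Lg _] := hg; split; last exact: opnorm_Tg_le.
  set N := opnorm _ _ _.
  have N0 : (0 <= N)%E.
    (* The zero function is exhibited in the unit ball, so the supremum is over a nonempty set and
       is not [-oo]. *)
    have h0 := Ap_sigma_fejS p1 rw rn Is (fun=> 0) 0.
    have [hz ez] := Ap_sigma_scale 0 h0.
    apply: (@le_trans _ _ (cabs (Tg w g (fun z => 0 * fejS (fun=> 0) 0 z)))%:E).
      by rewrite lee_fin cabs_ge0.
    apply: ereal_sup_ubound; exists (fun z => 0 * fejS (fun=> 0) 0 z) => //; split => //.
    apply: (Lpnorm_le q0 (Lp_pow_sigma_ge0 p1 rw rn _) ler01).
    by rewrite ez cabs0 powR0 ?gt_eqF// mul0e lee_fin powR_ge0.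
  have fN : N \is a fin_num.
    by rewrite ge0_fin_numE//; apply: le_lt_trans (opnorm_Tg_le Lg (fun _ _ => erefl)) (ltry _).
  (* T_g itself is represented, with its operator norm as bound. Uniqueness identifies g' with g, so
     the norm estimate of the representation is the lower bound sought. *)
  have [g' [hg' Lg' ng']] := rep _ _ (Tg_linear Lg) (fine_ge0 N0) (fun f hf => Tg_opnorm Lg hf).
  have e := Ap_nu_unique p1 rw rn Is hg hg' Lg'.
  have -> : Lpnorm p nuE g = Lpnorm p nuE g'.
    have eI : Lp_pow p nuE g = Lp_pow p nuE g'.
      by apply: eq_dAint => q qD; rewrite (e _ qD).
    by rewrite /Lpnorm eI.
  by rewrite -(fineK fN) lee_fin mulrC ler_pdivrMr// mulrC.
Qed.

Lemma dual_sigma_lty : dual_statement -> (dAint (fun q => sig (rad q)) < +oo)%E.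
Proof.
move=> [_ _ [c [C [c0 _ hN]]]].
have h1 : Ap p nuE (mon 0) by split; [exact: Lp_nu_mon|exact: analytic_mon].
have [lo _] := hN _ h1; have L1 := h1.1.
have n1 : 0 < Lpnorm p nuE (mon 0).
  rewrite powR_gt0// fine_gt0//; case: L1 => _ -> /[!andbT].
  rewrite (_ : Lp_pow _ _ _ = dAint (fun q => (nu (rad q))%:E)); first exact: dAint_weight_gt0.
  by apply: eq_dAint => q _; rewrite /mon expr0 cabs1 powR1 mul1e.
(* If T_1 vanished identically, its operator norm would be at most 0, against the lower bound c
   times the positive norm of 1. *)
have [f [hf Tf]] : exists f, Ap p' sig f /\ Tg w (mon 0) f != 0.
  apply: contrapT => hn.
  have : (opnorm (Ap p' sig) (Lpnorm p' sig) (Tg w (mon 0)) <= 0)%E.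
    apply: ge_ereal_sup => _ [f [hf _] <-]; rewrite lee_fin.
    have [->|ne] := eqVneq (Tg w (mon 0) f) 0; first by rewrite cabs0.
    by exfalso; apply: hn; exists f.
  by move=> /(le_trans lo); rewrite lee_fin leNgt mulr_gt0.
have [Lf af] := hf; have [a ha fa] := analytic_taylor af; have [mf If] := Lf.
have l1 : L1w w f := Lp_sigma_L1w p1 rw rn Lf.
have a0 : a 0%N != 0.
  by apply: contra_neq Tf => a0; rewrite (Tg_coef rw 0 ha fa l1) a0 mul0r.
have ap : 0 < cabs (a 0%N) `^ p' by rewrite powR_gt0// cabs_gt0.
have J0 := Lp_pow_sigma_ge0 p1 rw rn f.
have fJ : Lp_pow p' sig f \is a fin_num by rewrite ge0_fin_numE.
(* The sub-mean-value inequality is available for real-valued weights, so it is applied to each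
   truncation; the resulting bound, the integral of |f|^p' sigma over |f(0)|^p', is independent of
   n. *)
apply: (@sigma_int_trunc _ p w nu p1 rw rn (fine (Lp_pow p' sig f) / cabs (a 0%N) `^ p')) => n.
have t0 r : 0 <= r < 1 -> 0 <= trunc p w nu n r by move=> r01; exact: trunc_ge0.
have mt : measurable_fun D (fun q => trunc p w nu n (rad q)).
  by apply: measurable_radial; exact: measurable_trunc.
have := wint_coef0 (ltW q1) t0 mt ha.
have : (wint p' (trunc p w nu n) (fun q => ps a (cplx q)) <= Lp_pow p' sig f)%E.
  have -> : wint p' (trunc p w nu n) (fun q => ps a (cplx q)) = wint p' (trunc p w nu n) (fun q => f (cplx q)).
    by apply: eq_dAint => q qD; rewrite /wfun (fa _ qD).
  apply: le_dAint.
  - exact: wint_meas.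
  - exact: (Lp_pow_meas p' mf (measurable_sigma p rw rn)).
  - by move=> q qD; apply: wfun_ge0.
  - move=> q qD; rewrite /wfun EFinM lee_wpmul2l ?lee_fin ?powR_ge0//.
    by apply: trunc_le_sigma => //; exact: rad_in01.
move=> h2 /le_trans/(_ h2); rewrite -{1}(fineK fJ).
have t1 := dAint_trunc_lty p1 rw rn n.
have t2 : (0 <= dAint (fun q => (trunc p w nu n (rad q))%:E))%E.
  by apply: dAint_ge0 => q qD; rewrite lee_fin t0// rad_in01.
rewrite -(fineK (x := dAint _)) ?ge0_fin_numE// -EFinM !lee_fin => h3.
by rewrite ler_pdivlMr// mulrC.
Qed.

Lemma dual_Pw_bounded : dual_statement -> Pw_bounded p w nu.
Proof.
move=> hd; have Is := dual_sigma_lty hd; have [_ hL [c [C [c0 _ hN]]]] := hd.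
have k0 := kap_gt0 R.
(* P_w f will be [kap] g, where g is analytic with T_g = T_f on A^p'_sigma; and c |g| <= |T_g| =
   |T_f| <= 2 |f|. *)
exists (kap * (2 / c)) => f Lf.
have l1 : L1w w f := Lp_nu_L1w p1 rw rn Is Lf.
have [g [hg eg _]] := hL _ (Tg_linear Lf) (ex_intro _ _ (Tg_bounded Lf)).
have [Lg ag] := hg; have lg : L1w w g := Lp_nu_L1w p1 rw rn Is Lg.
have [b hb gb] := analytic_taylor ag.
have ePc : Pcoef w f = Pcoef w g.
  apply/funext => n; rewrite /Pcoef; congr (_ * _).
  have hm : Ap p' sig (mon n) by split; [exact: Lp_sigma_mon|exact: analytic_mon].
  rewrite -[LHS]conjcK -[RHS]conjcK; congr conjc.
  have := eg _ hm.
  by rewrite (TgC (mon_pair_int rw n l1)) (TgC (mon_pair_int rw n lg)).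
have ePw z : cdisc z -> Pw w f z = (kap%:C)%C * g z.
  move=> z1; rewrite (Pw_ps rw l1 z1).2 ePc -(Pw_ps rw lg z1).2.
  exact: (Pw_reproduce rw hb gb lg z1).
have eI : (Lp_pow p nuE (Pw w f) = (kap `^ p)%:E * Lp_pow p nuE g)%E.
  have mnu : measurable_fun (`[(0 : R), 1[%classic : set R) nuE by apply/measurable_EFinP; exact: radial_weight_meas.
  rewrite /Lp_pow -dAintZ ?powR_ge0//.
  - apply: eq_dAint => q qD; rewrite ePw// cabsM cabs_real (gtr0_norm k0) powRM ?cabs_ge0 ?(ltW k0)//.
    by rewrite EFinM muleA.
  - by apply: (Lp_pow_meas p _ mnu); case: Lg.
  - by move=> q qD; rewrite mule_ge0 ?lee_fin ?powR_ge0// (radial_weight_ge0 rn)// rad_in01.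
split; first by move=> z z1; case: (Pw_ps rw l1 z1).
split.
  split; first by apply: analytic_cmeasurable; exact: Pw_analytic.
  by rewrite eI lte_mul_pinfty ?lee_fin ?powR_ge0//; case: Lg.
have ng : Lpnorm p nuE g <= 2 / c * Lpnorm p nuE f.
  have [lo _] := hN _ hg.
  have := le_trans lo (opnorm_Tg_le Lf (fun h hh => esym (eg h hh))).
  by rewrite lee_fin mulrAC ler_pdivlMr// mulrC.
have ng0 := Lpnorm_ge0 p nuE g; have nf0 := Lpnorm_ge0 p nuE f.
have A0 : 0 <= kap * Lpnorm p nuE g := mulr_ge0 (ltW k0) ng0.
have le1 : kap * Lpnorm p nuE g <= kap * (2 / c) * Lpnorm p nuE f.
  by rewrite -mulrA; exact: (ler_wpM2l (ltW k0) ng).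
apply: (Lpnorm_le p0 (Lp_pow_nu_ge0 p rn _) (le_trans A0 le1)).
rewrite eI -(Lpnorm_powR p0 (Lp_pow_nu_ge0 p rn _) Lg) -EFinM lee_fin -(powRM p (ltW k0) ng0).
move: A0 le1; move: (kap * _) (kap * _ * _) => x y x0 xy.
by apply: ge0_ler_powR; rewrite ?nnegrE ?(ltW p0)// (le_trans x0).
Qed.

End BoundedIffDual.

Unset Implicit Arguments.

Theorem theorem2 (R : realType) (p : R) (w nu : R -> R) :
  1 < p -> radial_weight w -> Dhat w -> radial_weight nu ->
  let p' := conj_exp p in
  let sig := sigma p w nu in
  let nuE := fun r => (nu r)%:E in
  (Pw_bounded p w nu <->
   [/\
    (* every g in A^p_nu induces a bounded linear functional T_g on A^{p'}_sigma *)
    (forall g, Ap p nuE g ->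
       (forall f, Ap p' sig f -> cintegrable (pair_int w g f)) /\
       linear_on (Ap p' sig) (Tg w g) /\
       bounded_on (Ap p' sig) (Lpnorm p' sig) (Tg w g)),
    (* every bounded linear functional is T_g for a unique g in A^p_nu *)
    (forall L : (R[i] -> R[i]) -> R[i],
       linear_on (Ap p' sig) L -> bounded_on (Ap p' sig) (Lpnorm p' sig) L ->
       exists g, [/\ Ap p nuE g,
         (forall f, Ap p' sig f -> L f = Tg w g f) &
         (forall g', Ap p nuE g' -> (forall f, Ap p' sig f -> L f = Tg w g' f) ->
            forall z, cdisc z -> g' z = g z)]) &
    (* ||T_g|| is comparable to ||g||_{A^p_nu} *)
    (exists c C : R, [/\ 0 < c, 0 < C &
       forall g, Ap p nuE g ->
         ((c * Lpnorm p nuE g)%:E <= opnorm (Ap p' sig) (Lpnorm p' sig) (Tg w g))%E /\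
         (opnorm (Ap p' sig) (Lpnorm p' sig) (Tg w g) <= (C * Lpnorm p nuE g)%:E)%E])]).
Proof.
by move=> p1 rw _ rn p' sig nuE; split; [exact: Pw_bounded_dual|exact: dual_Pw_bounded].
Qed.
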